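(* Let $1\le N<\infty$, $\mathbb S=\{1,\dots,N\}$, $b:\mathbb R^n\times\mathbb S\to\mathbb R^n$ and $\sigma:\mathbb R^n\times\mathbb S\to\mathbb R^{n\times m}$. Assume that the Markov chain $\{\Lambda_t\}_{t\ge0}$ is reversible with respect to a probability measure $\pi=(\pi_1,\dots,\pi_N)$, i.e. $\pi_iq_{ij}=\pi_jq_{ji}$ for all $i,j\in\mathbb S$, and the following. (1) There is $L>0$ such that $|b(x,i)-b(y,i)|+\|\sigma(x,i)-\sigma(y,i)\|\le L|x-y|$ for all $i\in\mathbb S$, $x,y\in\mathbb R^n$. (2) There exist $c_0>0$ and $\beta_1,\dots,\beta_N\in\mathbb R$ such that for all $i\in\mathbb S$ and $x,y\in\mathbb R^n$: $2\langle x,b(x,i)\rangle+\|\sigma(x,i)\|^2\le c_0+\beta_i|x|^2$ and $2\langle x-y,b(x,i)-b(y,i)\rangle+\|\sigma(x,i)-\sigma(y,i)\|^2\le\beta_i|x-y|^2$. (3) $\lambda_0>0$, where $$\lambda_0:=\inf\Big\{D(f):f:\mathbb S\to\mathbb R,\ \sum_{i=1}^N\pi_if_i^2=1\Big\},\qquad D(f):=\frac12\sum_{i,j=1}^N\pi_iq_{ij}(f_j-f_i)^2-\sum_{i=1}^N\pi_i\beta_if_i^2 .$$ With $\kappa>0$ as defined in the context, for every stepsize $\delta\in(0,1)$ with $$\delta<\frac1{32L^2}\wedge\Big(\frac{\lambda_0}{\kappa}\Big)^2,$$ the Euler-Maruyama chain $(\bar Y_{k\delta}^{x,i},\Lambda_{k\delta}^i)_{k\ge0}$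 admits a unique invariant measure $\pi^\delta\in\mathcal P(\mathbb R^n\times\mathbb S)$.
   Context: $\{W_t\}_{t\ge0}$ is an $m$-dimensional Brownian motion and $\{\Lambda_t\}_{t\ge0}$ is an independent continuous-time Markov chain on $\mathbb S$ with irreducible conservative $Q$-matrix $Q=(q_{ij})_{N\times N}$. $\Lambda^i$ denotes the chain started at $i$. $\|\cdot\|$ is the Hilbert-Schmidt norm, $a\wedge b=\min\{a,b\}$, and $\mathcal P(\mathbb R^n\times\mathbb S)$ is the set of probability measures on $\mathbb R^n\times\mathbb S$. The Euler-Maruyama scheme for $dX_t=b(X_t,\Lambda_t)\,dt+\sigma(X_t,\Lambda_t)\,dW_t$ with stepsize $\delta\in(0,1)$ is $$\bar Y_{(k+1)\delta}^{x,i}=\bar Y_{k\delta}^{x,i}+b(\bar Y_{k\delta}^{x,i},\Lambda_{k\delta}^i)\delta+\sigma(\bar Y_{k\delta}^{x,i},\Lambda_{k\delta}^i)\,(W_{(k+1)\delta}-W_{k\delta}),\quad k\ge0,\quad \bar Y_0^{x,i}=x,\ \Lambda_0^i=i.$$ The pair $(\bar Y_{k\delta}^{x,i},\Lambda_{k\delta}^i)$ is a time-homogeneous Markov chain on $\mathbb R^n\times\mathbb S$ with transition kernel $P^\delta_{k\delta}(x,i;dy\times\{j\})$. A measure $\pi^\delta\in\mathcal P(\mathbb R^n\times\mathbb S)$ is invariant for it if $\pi^\delta(\Gamma\times\{i\})=\sum_{j=1}^N\int_{\mathbb R^n}P^\delta_{k\delta}(x,j;\Gamma\times\{i\})\,\pi^\delta(dx\times\{j\})$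 for all $k\ge0$, Borel $\Gamma\subseteq\mathbb R^n$, $i\in\mathbb S$. Since $\mathbb S$ is finite, the infimum $\lambda_0$ (the principal eigenvalue of $D$) is attained: there is $\xi=(\xi_1,\dots,\xi_N)$ with all $\xi_i>0$ and $D(\xi)=\lambda_0\sum_i\pi_i\xi_i^2$. Fix such $\xi$ and put $\tilde\xi_1:=\max_i\xi_i$, $\tilde\xi_2:=(\min_i\xi_i)^{-1}$, $\beta_0:=\max_i|\beta_i|$, $q_0:=\max_i(-q_{ii})$ and $$\kappa:=\{(1+12q_0)\beta_0+8L^2(5+6\beta_0)\}\,\tilde\xi_1\,\tilde\xi_2.$$ *)

(* Defs.v *)
(* MathComp-Analysis *)
From HB Require Import structures.
From mathcomp Require Export all_boot all_order all_algebra.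
From mathcomp Require Export all_classical all_reals all_analysis.

Set Implicit Arguments.
Unset Strict Implicit.
Unset Printing Implicit Defensive.

Export Order.TTheory GRing.Theory Num.Theory.
Export numFieldNormedType.Exports.

Local Open Scope classical_set_scope.
Local Open Scope ring_scope.

(* Euclidean structure. The library norm on matrices is the sup norm, so the
   Euclidean (on column vectors) and Hilbert-Schmidt norms are defined here. *)

Definition hsnorm (R : realType) (p q : nat) (A : 'M[R]_(p, q)) : R :=
  Num.sqrt (\sum_i \sum_j A i j ^+ 2).

Definition inner (R : realType) (n : nat) (x y : 'cV[R]_n) : R :=
  \sum_i x i 0 * y i 0.

Definition borelV (R : realType) (n : nat) :=
  g_sigma_algebraType (@open 'cV[R]_n).

(* The state space {1, ..., N+1}, with the discrete sigma-algebra. *)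
Definition stateS (N : nat) : Type := 'I_N.+1.

HB.instance Definition _ (N : nat) := Choice.on (stateS N).
HB.instance Definition _ (N : nat) := isPointed.Build (stateS N) ord0.
HB.instance Definition _ (N : nat) := @isMeasurable.Build default_measure_display
  (stateS N) discrete_measurable discrete_measurable0
  discrete_measurableC discrete_measurableU.

Definition max_state (R : realType) (N : nat) (f : 'I_N.+1 -> R) : R :=
  \big[Num.max/f ord0]_i f i.

Definition min_state (R : realType) (N : nat) (f : 'I_N.+1 -> R) : R :=
  \big[Num.min/f ord0]_i f i.

(* Independence *)

(* Taking [B i = setT] for some of the [i] gives the product rule for every
   subfamily. *)
Definition mutually_independent d (T : measurableType d) (R : realType)
    (P : probability T R) (I : finType) (X : I -> T -> R) : Prop :=
  forall B : I -> set R, (forall i, measurable (B i)) ->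
    P (\bigcap_(i in [set: I]) (X i @^-1` B i))
    = (\prod_i P (X i @^-1` B i))%E.

Definition sigma_of d (T : Type) (U : measurableType d) (R : realType)
    (X : R -> T -> U) : set (set T) :=
  <<s [set A | exists t B, 0 <= t /\ measurable B /\ A = X t @^-1` B] >>.

Definition independent_processes d d1 d2 (T : measurableType d)
    (U1 : measurableType d1) (U2 : measurableType d2) (R : realType)
    (P : probability T R) (X : R -> T -> U1) (Y : R -> T -> U2) : Prop :=
  forall A B, sigma_of X A -> sigma_of Y B ->
    P (A `&` B) = (P A * P B)%E.

(* Processes indexed by [0, +oo[ are functions of a real time; their values at
   negative times are never used. *)

Record brownian_motion d (T : measurableType d) (R : realType)
    (P : probability T R) (m : nat) (W : R -> T -> borelV R m) : Prop := {
  bm_measurable : forall t, 0 <= t -> measurable_fun setT (W t) ;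
  bm_start : {ae P, forall w, W 0 w = (0 : 'cV[R]_m)} ;
  bm_continuous :
    {ae P, forall w, {within `[0, +oo[%classic,
      continuous (fun t => W t w : 'cV[R]_m)}} ;
  bm_gaussian : forall s t (j : 'I_m) (B : set R), 0 <= s -> s < t ->
    measurable B ->
    P [set w | B ((W t w : 'cV[R]_m) j 0 - (W s w : 'cV[R]_m) j 0)]
    = normal_prob 0 (Num.sqrt (t - s)) B ;
  (* independence of the increments and of their coordinates *)
  bm_independent : forall (k : nat) (t : nat -> R), 0 <= t 0%N ->
    (forall l, t l < t l.+1) ->
    mutually_independent P (fun (a : 'I_k * 'I_m) w =>
      (W (t a.1.+1) w : 'cV[R]_m) a.2 0 - (W (t a.1) w : 'cV[R]_m) a.2 0) }.

(* Continuous-time Markov chains *)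

Definition conservative_Qmatrix (R : realType) (N : nat)
    (Q : 'M[R]_N.+1) : Prop :=
  (forall i j, i != j -> 0 <= Q i j) /\ (forall i, \sum_j Q i j = 0).

Definition irreducible_Qmatrix (R : realType) (N : nat)
    (Q : 'M[R]_N.+1) : Prop :=
  forall i j, connect (fun a b => (a != b) && (0 < Q a b)) i j.

Record transition_function (R : realType) (N : nat) (Q : 'M[R]_N.+1)
    (p : R -> 'M[R]_N.+1) : Prop := {
  tf_ge0 : forall t i j, 0 <= t -> 0 <= p t i j ;
  tf_sum1 : forall t i, 0 <= t -> \sum_j p t i j = 1 ;
  tf_0 : p 0 = 1%:M ;
  tf_semigroup : forall s t, 0 <= s -> 0 <= t -> p (s + t) = p s *m p t ;
  tf_generator : forall i j,
    (fun h => (p h i j - (i == j)%:R) / h) @ 0^'+ --> Q i j }.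

(* Markov property, in the form of the finite-dimensional distributions. *)
Definition markov_chain_from d (T : measurableType d) (R : realType)
    (P : probability T R) (N : nat) (Q : 'M[R]_N.+1) (i : 'I_N.+1)
    (La : R -> T -> stateS N) : Prop :=
  (forall t, 0 <= t -> measurable_fun setT (La t)) /\
  exists2 p, transition_function Q p &
    forall (k : nat) (t : nat -> R) (a : nat -> 'I_N.+1),
      t 0%N = 0 -> (forall l, t l < t l.+1) ->
      P [set w | forall l, (l <= k)%N -> La (t l) w = a l]
      = ((a 0%N == i)%:R *
         \prod_(l < k) p (t l.+1 - t l) (a l) (a l.+1))%:E.

(* Principal eigenvalue *)

Definition dirichlet (R : realType) (N : nat) (Q : 'M[R]_N.+1)
    (pi beta f : 'I_N.+1 -> R) : R :=
  2^-1 * (\sum_i \sum_j pi i * Q i j * (f j - f i) ^+ 2)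
  - \sum_i pi i * beta i * f i ^+ 2.

Definition lambda0 (R : realType) (N : nat) (Q : 'M[R]_N.+1)
    (pi beta : 'I_N.+1 -> R) : R :=
  inf [set dirichlet Q pi beta f |
         f in [set f | \sum_i pi i * f i ^+ 2 = 1]].

Definition kappa (R : realType) (N : nat) (Q : 'M[R]_N.+1)
    (beta xi : 'I_N.+1 -> R) (L : R) : R :=
  let beta0 := max_state (fun i => `|beta i|) in
  let q0 := max_state (fun i => - Q i i) in
  ((1 + 12 * q0) * beta0 + 8 * L ^+ 2 * (5 + 6 * beta0))
  * max_state xi * (min_state xi)^-1.

(* Euler-Maruyama scheme *)

Fixpoint euler_maruyama (R : realType) (n m N : nat) (T : Type)
    (b : 'cV[R]_n -> 'I_N.+1 -> 'cV[R]_n)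
    (sigma : 'cV[R]_n -> 'I_N.+1 -> 'M[R]_(n, m))
    (delta : R) (W : R -> T -> borelV R m) (La : R -> T -> stateS N)
    (x : 'cV[R]_n) (k : nat) (w : T) : 'cV[R]_n :=
  if k is l.+1 then
    let y := euler_maruyama b sigma delta W La x l w in
    let s := La (l%:R * delta) w in
    y + delta *: b y s
    + sigma y s *m ((W (l.+1%:R * delta) w : 'cV[R]_m)
                    - (W (l%:R * delta) w : 'cV[R]_m))
  else x.

Definition em_kernel d (T : measurableType d) (R : realType)
    (P : probability T R) (n m N : nat)
    (b : 'cV[R]_n -> 'I_N.+1 -> 'cV[R]_n)
    (sigma : 'cV[R]_n -> 'I_N.+1 -> 'M[R]_(n, m))
    (delta : R) (W : R -> T -> borelV R m)
    (La : 'I_N.+1 -> R -> T -> stateS N)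
    (k : nat) (x : 'cV[R]_n) (i : 'I_N.+1)
    (A : set (borelV R n * stateS N)) : \bar R :=
  P [set w | A (euler_maruyama b sigma delta W (La i) x k w,
                La i (k%:R * delta) w)].

Definition em_invariant d (T : measurableType d) (R : realType)
    (P : probability T R) (n m N : nat)
    (b : 'cV[R]_n -> 'I_N.+1 -> 'cV[R]_n)
    (sigma : 'cV[R]_n -> 'I_N.+1 -> 'M[R]_(n, m))
    (delta : R) (W : R -> T -> borelV R m)
    (La : 'I_N.+1 -> R -> T -> stateS N)
    (mu : probability (borelV R n * stateS N)%type R) : Prop :=
  forall (k : nat) (G : set (borelV R n)) (i : 'I_N.+1), measurable G ->
    mu (G `*` [set (i : stateS N)])
    = (\sum_(j < N.+1)
         \int[fun B : set (borelV R n) => mu (B `*` [set (j : stateS N)])]_x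
           em_kernel P b sigma delta W La k x j
             (G `*` [set (i : stateS N)]))%E.

(* Main.v *)
From HB Require Import structures.
Require Import Defs.
From mathcomp Require Import measurable_realfun ring lra.

(** The scheme is a composition of random maps chosen by the switching chain, and the
    proof couples two copies of it that use the same noise and the same states.

    Contraction.  In state [i] a step multiplies the mean squared distance of two
    points by at most [1 + beta i * delta + L ^+ 2 * delta ^+ 2]
    ([em_map_contraction]), which may exceed [1].  The switching compensates for
    this on average.  A minimiser [xi] of the Dirichlet form satisfies
    [Q xi = - (lambda0 + beta) xi] ([minimizer_eigen]), so that weighing the
    squared distance by [xi] cancels the growth due to [beta] and leaves a factor
    [1 - lambda0 * delta] up to terms of order two in [delta]; the bound on [delta]
    keeps the resulting rate [rho] below [1] ([em_contraction_rate]).  A bound on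
    the oscillation of a function of the point by [A + B * xi i * cost] is thus
    improved by each step, [B] becoming [rho * B] ([modulus_transfer]).

    Uniqueness.  The marginal of an invariant law on the states is stationary for
    the switching chain, hence equal to [pi] ([invariant_marginal]).  So such a law
    can be compared with the chain started at a fixed point, its state being drawn
    from [pi]: the integral of a test function against the invariant law is the
    limit of its averages along that chain ([invariant_limit]).  Test functions
    determine a probability ([test_functions_determine]).

    Existence.  Since the switching chain is reversible,
    the chain started from [pi] has at time [k] the same law as the composition of
    the maps in the opposite order ([backward_forward]).  For that order, two
    consecutive iterates differ only in the innermost map and share all the others,
    so their squared distance has a mean of order [rho ^+ k] ([backward_steps]) and
    the iterates converge almost surely ([geometric_limit]).  The law of the limit
    together with the initial state attracts the averages of all test functions
    ([backward_limit_law]), and a limit of this kind is invariant.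

    The link with the scheme is made by [euler_expectation]: because the increments
    of the noise are independent of each other and of the switching path, the
    transition kernel over [k] steps is the [k]-th power of an explicit one-step
    operator ([transfer]).
    Finally the transition function at time [delta], which enters this operator, is
    determined by [Q] ([tf_unique]), inherits reversibility ([tf_reversible]), is
    positive ([tf_gt0]), and has a second-order expansion in time
    ([tf_second_order]). *)

Set Implicit Arguments.
Unset Strict Implicit.
Unset Printing Implicit Defensive.

Local Open Scope classical_set_scope.
Local Open Scope ring_scope.

(** * Transition functions of a conservative Q-matrix *)

Section semigroup.
Context (R : realType) (N : nat) (Q : 'M[R]_N.+1) (p : R -> 'M[R]_N.+1).
Hypothesis tfp : transition_function Q p.

Lemma tf_le1 t i j : 0 <= t -> p t i j <= 1.
Proof.
move=> t0; rewrite -(tf_sum1 tfp i t0) (bigD1 j)//= lerDl.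
by apply: sumr_ge0 => l _; exact: (tf_ge0 tfp).
Qed.

(** First-order expansion at time [0], uniform over the finitely many entries. *)
Lemma tf_expansion (e : R) : 0 < e -> exists2 h0 : R, 0 < h0 &
  forall h : R, 0 < h -> h < h0 -> forall i j,
    `|p h i j - (i == j)%:R - h * Q i j| <= e * h.
Proof.
move=> e0.
have H i j : \forall h \near 0^'+,
    `|p h i j - (i == j)%:R - h * Q i j| <= e * h.
  have /cvgrPdist_le /(_ _ e0) := @tf_generator _ _ _ _ tfp i j.
  apply: filterS2 (nbhs_right_gt (0 : R)) => h h0 /=; rewrite distrC => H.
  have -> : p h i j - (i == j)%:R - h * Q i j
      = ((p h i j - (i == j)%:R) / h - Q i j) * h.
    by field; rewrite gt_eqF.
  by rewrite normrM (gtr0_norm h0) ler_wpM2r// ltW.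
have : \forall h \near (0:R)^'+, forall i j,
    `|p h i j - (i == j)%:R - h * Q i j| <= e * h.
  by apply: filter_forall => i; apply: filter_forall => j; exact: H.
rewrite near_withinE => -[h0 /= h00 Hh]; exists h0 => // h hp hlt i j.
by apply: Hh => //=; rewrite sub0r normrN gtr0_norm.
Qed.

Lemma tf_expansion_col (g : 'cV[R]_N.+1) (e : R) : 0 < e -> exists2 h0 : R, 0 < h0 &
  forall h : R, 0 < h -> h < h0 -> forall i,
    `|(p h *m g - g - h *: (Q *m g)) i 0| <= e * h.
Proof.
move=> e0; pose S : R := 1 + \sum_j `|g j 0|.
have S0 : 0 < S by rewrite ltr_pwDl// sumr_ge0.
have [h0 h00 H] := @tf_expansion (e / S) (divr_gt0 e0 S0).
exists h0 => // h hp hlt i.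
have -> : (p h *m g - g - h *: (Q *m g)) i 0
    = \sum_j (p h i j - (i == j)%:R - h * Q i j) * g j 0.
  rewrite !mxE mulr_sumr.
  have -> : g i 0 = \sum_j (i == j)%:R * g j 0.
    rewrite (bigD1 i)//= eqxx mul1r big1 ?addr0// => j ji.
    by rewrite eq_sym (negbTE ji) mul0r.
  by rewrite -!sumrB; apply: eq_bigr => j _; ring.
apply: le_trans (ler_norm_sum _ _ _) _.
apply: (@le_trans _ _ (\sum_j (e / S * h) * `|g j 0|)).
  by apply: ler_sum => j _; rewrite normrM ler_wpM2r//; exact: H.
rewrite -mulr_sumr mulrAC ler_wpM2r ?(ltW hp)// mulrAC ler_pdivrMr//.
by rewrite ler_wpM2l ?(ltW e0)// /S lerDr.
Qed.

Lemma tf_averaging s (v : 'cV[R]_N.+1) B : 0 <= s -> (forall i, `|v i 0| <= B) ->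
  forall i, `|(p s *m v) i 0| <= B.
Proof.
move=> s0 vB i; rewrite mxE; apply: le_trans (ler_norm_sum _ _ _) _.
rewrite -[B]mul1r -(tf_sum1 tfp i s0) mulr_suml; apply: ler_sum => j _.
by rewrite normrM (ger0_norm (tf_ge0 tfp i j s0)) ler_wpM2l// (tf_ge0 tfp).
Qed.

Lemma tf_mulrn h n : 0 <= h -> p (n.+1%:R * h) = p (n%:R * h) *m p h.
Proof.
move=> h0; rewrite -natr1 mulrDl mul1r (tf_semigroup tfp)//.
by rewrite mulr_ge0.
Qed.

Lemma fine_mesh t (h0 : R) : 0 < t -> 0 < h0 ->
  exists n, exists2 h : R, 0 < h < h0 & t = n%:R * h.
Proof.
move=> t0 h00; have := truncnS_gt (t / h0).
set n := (Num.trunc (t / h0)).+1 => tn.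
have n0 : 0 < n%:R :> R by rewrite ltr0n.
exists n, (t / n%:R); last by field; rewrite gt_eqF.
by rewrite divr_gt0//= ltr_pdivrMr// mulrC -ltr_pdivrMr.
Qed.

(** Over a fine mesh of [0, s] the increments [p h *m g - g] have size about [h * B],
    and each is averaged by a stochastic matrix: they add up to [s * B]. *)
Lemma tf_first_order s (g : 'cV[R]_N.+1) B : 0 <= s ->
  (forall i, `|(Q *m g) i 0| <= B) ->
  forall i, `|(p s *m g - g) i 0| <= s * B.
Proof.
rewrite le_eqVlt => /orP[/eqP <- _ i|s0 gB i].
  by rewrite (tf_0 tfp) mul1mx subrr mxE normr0 mul0r.
apply/ler_addgt0Pr => e e0.
have [h0 h00 H] := tf_expansion_col g (divr_gt0 e0 s0).
have [n [h /andP[hp hlt] sE]] := fine_mesh s0 h00.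
have step j : `|(p h *m g - g) j 0| <= h * (B + e / s).
  have -> : (p h *m g - g) j 0
      = (p h *m g - g - h *: (Q *m g)) j 0 + h * (Q *m g) j 0.
    by rewrite !mxE; ring.
  apply: le_trans (ler_normD _ _) _; rewrite mulrDr addrC lerD//.
    by rewrite normrM gtr0_norm// ler_wpM2l// ltW.
  by rewrite [h * _]mulrC; exact: H.
suff K m : forall j, `|(p (m%:R * h) *m g - g) j 0| <= m%:R * h * (B + e / s).
  rewrite {1}sE; apply: le_trans (K n i) _; rewrite -sE mulrDr lerD2l.
  by rewrite mulrCA divff ?mulr1// gt_eqF.
elim: m => [j|m IH j].
  by rewrite !mul0r (tf_0 tfp) mul1mx subrr mxE normr0.
rewrite tf_mulrn ?(ltW hp)//.
have -> : p (m%:R * h) *m p h *m g - g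
    = p (m%:R * h) *m (p h *m g - g) + (p (m%:R * h) *m g - g).
  by rewrite mulmxBr mulmxA addrA subrK.
rewrite mxE; apply: le_trans (ler_normD _ _) _.
have mh0 : 0 <= m%:R * h by rewrite mulr_ge0// ltW.
have := tf_averaging mh0 step j; have := IH j; rewrite -natr1.
move: (_ + e / s) => B'; nra.
Qed.

(** Telescoping over a fine mesh again: each step now makes an error [h * (s * B)],
    since [Q *m g] is moved by at most [s * B] up to time [s]. *)
Lemma tf_second_order s (g : 'cV[R]_N.+1) B : 0 <= s ->
  (forall i, `|(Q *m (Q *m g)) i 0| <= B) ->
  forall i, `|(p s *m g - g - s *: (Q *m g)) i 0| <= s ^+ 2 * B.
Proof.
rewrite le_eqVlt => /orP[/eqP <- _ i|s0 gB i].
  by rewrite (tf_0 tfp) mul1mx subrr scale0r subr0 mxE normr0 expr0n mul0r.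
apply/ler_addgt0Pr => e e0.
have [h0 h00 H] := tf_expansion_col g (divr_gt0 e0 s0).
have [n [h /andP[hp hlt] sE]] := fine_mesh s0 h00.
have B0 : 0 <= B by apply: le_trans (gB i).
suff K m : (m <= n)%N -> forall j,
    `|(p (m%:R * h) *m g - g - (m%:R * h) *: (Q *m g)) j 0|
    <= m%:R * h * (s * B + e / s).
  rewrite {1 2}sE; apply: le_trans (K n _ i) _ => //.
  rewrite -sE mulrDr expr2 mulrA lerD2l.
  by rewrite mulrCA divff ?mulr1// gt_eqF.
elim: m => [_ j|m IH mn j].
  by rewrite !mul0r (tf_0 tfp) mul1mx subrr scale0r subr0 mxE normr0.
rewrite tf_mulrn ?(ltW hp)//; set q := p (m%:R * h).
have -> : q *m p h *m g - g - (m.+1%:R * h) *: (Q *m g)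
    = q *m (p h *m g - g - h *: (Q *m g))
      + ((q *m g - g - (m%:R * h) *: (Q *m g))
         + h *: (q *m (Q *m g) - Q *m g)).
  apply/matrixP => a c; rewrite !mulmxBr -scalemxAr !mulmxA -natr1 mulrDl mul1r.
  rewrite !mxE; ring.
have mh0 : 0 <= m%:R * h by rewrite mulr_ge0// ltW.
have ms : m%:R * h <= s.
  by rewrite sE ler_wpM2r ?(ltW hp)// ler_nat ltnW.
have b1 := tf_averaging mh0 (fun j => H h hp hlt j) j.
have b2 := IH (ltnW mn) j.
have b3 := tf_first_order mh0 gB j.
rewrite mxE; apply: le_trans (ler_normD _ _) _.
rewrite [X in _ + `|X|]mxE [X in _ + `|_ + X|]mxE.
apply: le_trans (lerD b1 (ler_normD _ _)) _.
rewrite normrM (gtr0_norm hp) -natr1.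
have b4 : `|(q *m (Q *m g) - Q *m g) j 0| <= s * B.
  by apply: le_trans b3 _; rewrite ler_wpM2r.
rewrite [(_ + 1) * h]mulrDl mul1r [leRHS]mulrDl [X in _ <= _ + X]mulrDr.
have := ler_wpM2l (ltW hp) b4; move: b2; rewrite [e / s * h]mulrC; lra.
Qed.

Lemma tf_diag_gt0_small i : exists2 h0 : R, 0 < h0 &
  forall h : R, 0 <= h -> h < h0 -> 0 < p h i i.
Proof.
pose q : R := 1 + `|Q i i|; have q0 : 0 < q by rewrite ltr_pwDl.
have [h0 h00 H] := tf_expansion (@ltr01 R).
exists (Num.min h0 ((1 + q)^-1)).
  by rewrite lt_min h00 invr_gt0 addr_gt0.
move=> h hp; rewrite lt_min => /andP[hh0 hq].
move: hp; rewrite le_eqVlt => /orP[/eqP <-|hp].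
  by rewrite (tf_0 tfp) mxE eqxx ltr01.
have := H h hp hh0 i i; rewrite eqxx mulr1n mul1r.
have q1 : 0 < 1 + q by rewrite addr_gt0.
have : h * (1 + q) < 1.
  have := hq; rewrite -(ltr_pM2r q1). by rewrite mulVf// gt_eqF.
have := ler_norm (- Q i i); rewrite normrN => Qq.
have : h * - Q i i <= h * `|Q i i| by rewrite ler_wpM2l// ltW.
rewrite ler_norml => hQ hq1 /andP[+ _]; move: hq1; rewrite /q; nra.
Qed.

Lemma tf_diag_gt0 t i : 0 <= t -> 0 < p t i i.
Proof.
rewrite le_eqVlt => /orP[/eqP <-|t0]; first by rewrite (tf_0 tfp) mxE eqxx ltr01.
have [h0 h00 H] := tf_diag_gt0_small i.
have [n [h /andP[hp hlt] ->]] := fine_mesh t0 h00.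
elim: n => [|n IH]; first by rewrite mul0r (tf_0 tfp) mxE eqxx ltr01.
rewrite tf_mulrn ?(ltW hp)// mxE (bigD1 i)//=.
apply: ltr_pwDl; first by rewrite mulr_gt0// H// ltW.
have nh : 0 <= n%:R * h by rewrite mulr_ge0// ltW.
by apply: sumr_ge0 => l _; rewrite mulr_ge0 ?(tf_ge0 tfp)// ltW.
Qed.

Lemma tf_chain_gt0 s t i j l : 0 <= s -> 0 <= t ->
  0 < p s i j -> 0 < p t j l -> 0 < p (s + t) i l.
Proof.
move=> s0 t0 h1 h2; rewrite (tf_semigroup tfp s0 t0) mxE (bigD1 j)//=.
apply: ltr_pwDl; first by rewrite mulr_gt0.
by apply: sumr_ge0 => k _; rewrite mulr_ge0// (tf_ge0 tfp).
Qed.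

Lemma tf_edge_gt0_small i j : i != j -> 0 < Q i j ->
  exists2 h0 : R, 0 < h0 & forall h : R, 0 < h -> h < h0 -> 0 < p h i j.
Proof.
move=> ij Qij; have Q2 : 0 < Q i j / 2 by rewrite divr_gt0.
have [h0 h00 H] := tf_expansion Q2; exists h0 => // h hp hh0.
have := H h hp hh0 i j; rewrite (negbTE ij) mulr0n subr0 ler_norml => /andP[].
nra.
Qed.

(** The semigroup property propagates positivity along a path of the graph of [Q]:
    edges have positive probability in a short time, and staying put has
    positive probability at every time. *)
Lemma tf_gt0 t i j : irreducible_Qmatrix Q -> 0 < t -> 0 < p t i j.
Proof.
move=> irr t0; have /connectP[s] := irr i j.
elim: s i t t0 => [i t t0 _ /= ->|k s IH i t t0 /= /andP[/andP[ik Qik]] pth jE].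
  exact/tf_diag_gt0/ltW.
have [h0 h00 H] := tf_edge_gt0_small ik Qik.
pose h : R := Num.min h0 t / 2.
have m0 : 0 < Num.min h0 t by rewrite lt_min h00.
have mh : Num.min h0 t <= h0 by rewrite ge_min lexx.
have mt : Num.min h0 t <= t by rewrite ge_min lexx orbT.
have h_gt0 : 0 < h by rewrite divr_gt0.
have h_h0 : h < h0 by rewrite /h ltr_pdivrMr//; nra.
have th : 0 < t - h by rewrite subr_gt0 /h ltr_pdivrMr//; nra.
have -> : t = h + (t - h) by ring.
apply: (@tf_chain_gt0 _ _ _ k); rewrite ?(ltW th) ?(ltW h_gt0)//; first exact: H.
exact: IH.
Qed.

End semigroup.

Section intertwine.
Context (R : realType) (N : nat).
Implicit Types (E : 'M[R]_N.+1).

(** This norm does not grow under multiplication by a stochastic matrix on the right,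
    and grows by a bounded factor on the left. *)
Definition entry_norm E := \sum_i \sum_j `|E i j|.

Lemma entry_normD E E' : entry_norm (E + E') <= entry_norm E + entry_norm E'.
Proof.
rewrite /entry_norm -big_split; apply: ler_sum => i _ /=.
rewrite -big_split; apply: ler_sum => j _ /=.
by rewrite mxE ler_normD.
Qed.

Lemma entry_norm_mulr E (P : 'M[R]_N.+1) : (forall i j, 0 <= P i j) ->
  (forall i, \sum_j P i j = 1) -> entry_norm (E *m P) <= entry_norm E.
Proof.
move=> P0 P1; apply: ler_sum => i _.
apply: (@le_trans _ _ (\sum_j \sum_l `|E i l| * P l j)).
  apply: ler_sum => j _; rewrite mxE; apply: le_trans (ler_norm_sum _ _ _) _.
  by apply: ler_sum => l _; rewrite normrM (ger0_norm (P0 _ _)).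
rewrite exchange_big/=; apply: ler_sum => l _.
by rewrite -mulr_sumr P1 mulr1.
Qed.

Lemma entry_norm_mull (P E : 'M[R]_N.+1) : (forall i j, `|P i j| <= 1) ->
  entry_norm (P *m E) <= N.+1%:R * entry_norm E.
Proof.
move=> P1; rewrite mulr_natl -[N.+1 in leRHS]card_ord -sumr_const.
apply: ler_sum => i _.
rewrite /entry_norm exchange_big /=; apply: ler_sum => j _.
rewrite mxE; apply: le_trans (ler_norm_sum _ _ _) _; apply: ler_sum => l _.
by rewrite normrM ler_piMl.
Qed.

(** If [D] intertwines two semigroups up to [o(h)] in time [h], the error over a mesh
    of [0, t] is a sum of [t / h] terms that are each [o(h)].  It is used with [D]
    the identity for uniqueness, and with [D = diag pi] for reversibility. *)
Lemma intertwine (p q : R -> 'M[R]_N.+1) (D : 'M[R]_N.+1) :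
  (forall t i j, 0 <= t -> 0 <= p t i j) ->
  (forall t i, 0 <= t -> \sum_j p t i j = 1) ->
  p 0 = 1%:M -> q 0 = 1%:M ->
  (forall t i j, 0 <= t -> `|q t i j| <= 1) ->
  (forall s t, 0 <= s -> 0 <= t -> p (s + t) = p s *m p t) ->
  (forall s t, 0 <= s -> 0 <= t -> q (s + t) = q s *m q t) ->
  (forall e : R, 0 < e -> exists2 h0 : R, 0 < h0 & forall h : R, 0 < h -> h < h0 ->
     forall i j, `|(D *m p h - q h *m D) i j| <= e * h) ->
  forall t, 0 <= t -> D *m p t = q t *m D.
Proof.
move=> p0 p1 p0E q0E q1 pD qD H t.
rewrite le_eqVlt => /orP[/eqP <-|t0]; first by rewrite p0E q0E mulmx1 mul1mx.
suff : entry_norm (D *m p t - q t *m D) <= 0.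
  move=> le0; apply/eqP; rewrite -subr_eq0; apply/eqP/matrixP => i j.
  apply/eqP; rewrite [X in _ == X]mxE -normr_le0.
  apply: le_trans le0; rewrite /entry_norm (bigD1 i)//= (bigD1 j)//=.
  rewrite -addrA lerDl addr_ge0//; apply: sumr_ge0 => // k _.
  exact: sumr_ge0.
apply/ler_addgt0Pr => e e0; rewrite add0r.
pose K : R := N.+1%:R; have K0 : 0 < K by rewrite ltr0n.
have C0 : 0 < t * (K * (K * K)) by rewrite !mulr_gt0.
have [h0 h00 {}H] := H _ (divr_gt0 e0 C0).
have [n [h /andP[hp hlt] tE]] := fine_mesh t0 h00.
set c := e / _ in H.
have hK : entry_norm (D *m p h - q h *m D) <= K * (K * (c * h)).
  rewrite /entry_norm mulr_natl -[N.+1 in leRHS]card_ord -sumr_const.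
  apply: ler_sum => i _.
  rewrite /K mulr_natl -[N.+1 in leRHS]card_ord -sumr_const.
  by apply: ler_sum => j _; exact: H.
have hp' := ltW hp.
suff L m : entry_norm (D *m p (m%:R * h) - q (m%:R * h) *m D)
    <= m%:R * (K * (K * (K * (c * h)))).
  rewrite tE; apply: le_trans (L n) _.
  have -> : n%:R * (K * (K * (K * (c * h)))) = t * (K * (K * K)) * c.
    by rewrite tE; ring.
  by rewrite /c mulrCA divff ?mulr1// gt_eqF.
elim: m => [|m IH].
  rewrite !mul0r p0E q0E mulmx1 mul1mx subrr /entry_norm big1// => i _.
  by rewrite big1// => j _; rewrite mxE normr0.
have mh : 0 <= m%:R * h by rewrite mulr_ge0.
rewrite -natr1 [(_ + 1) * h]mulrDl mul1r pD// qD//.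
have -> : D *m (p (m%:R * h) *m p h) - q (m%:R * h) *m q h *m D
    = (D *m p (m%:R * h) - q (m%:R * h) *m D) *m p h
      + q (m%:R * h) *m (D *m p h - q h *m D).
  by rewrite mulmxBl mulmxBr !mulmxA addrA subrK.
apply: le_trans (entry_normD _ _) _; rewrite mulrDl mul1r lerD//.
  apply: le_trans IH; apply: entry_norm_mulr => *; [exact: p0|exact: p1].
apply: (@le_trans _ _ (K * entry_norm (D *m p h - q h *m D))).
  by apply: entry_norm_mull => *; exact: q1.
by rewrite ler_pM2l.
Qed.

Lemma tf_unique (Q : 'M[R]_N.+1) p q : transition_function Q p ->
  transition_function Q q -> forall t, 0 <= t -> p t = q t.
Proof.
move=> tp tq t t0; rewrite -[LHS]mul1mx -[RHS]mulmx1.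
apply: intertwine t0; try by case: tp.
- by case: tq.
- by move=> s i j s0; rewrite ger0_norm ?(tf_ge0 tq)// (tf_le1 tq).
- by case: tq.
move=> e e0; have e2 : 0 < e / 2 by rewrite divr_gt0.
have [h1 h10 H1] := tf_expansion tp e2; have [h2 h20 H2] := tf_expansion tq e2.
exists (Num.min h1 h2); first by rewrite lt_min h10.
move=> h hp; rewrite lt_min => /andP[hh1 hh2] i j; rewrite mul1mx mulmx1 !mxE.
have -> : p h i j - q h i j = (p h i j - (i == j)%:R - h * Q i j)
   - (q h i j - (i == j)%:R - h * Q i j) by ring.
apply: le_trans (ler_normB _ _) _.
by have := H1 h hp hh1 i j; have := H2 h hp hh2 i j; nra.
Qed.

Lemma tf_reversible (Q : 'M[R]_N.+1) p (pi : 'I_N.+1 -> R) :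
  transition_function Q p -> (forall i j, pi i * Q i j = pi j * Q j i) ->
  forall t i j, 0 <= t -> pi i * p t i j = pi j * p t j i.
Proof.
move=> tp rev t i j t0; pose D := diag_mx (\row_k pi k).
suff : D *m p t = (p t)^T *m D.
  move=> /matrixP/(_ i j); rewrite mul_diag_mx mul_mx_diag !mxE => ->.
  by rewrite mulrC.
apply: (@intertwine p (fun t => (p t)^T)) t0; try by case: tp.
- by rewrite (tf_0 tp) trmx1.
- by move=> s k l s0; rewrite mxE ger0_norm ?(tf_ge0 tp)// (tf_le1 tp).
- move=> r s r0 s0; rewrite addrC (tf_semigroup tp s0 r0).
  by rewrite trmx_mul.
move=> e e0; pose S : R := 1 + 2 * \sum_k `|pi k|.
have sp k : `|pi k| <= \sum_k `|pi k|.
  by rewrite (bigD1 k)//= lerDl sumr_ge0.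
have S0 : 0 < S by rewrite ltr_pwDl// mulr_ge0// sumr_ge0.
have [h0 h00 H] := tf_expansion tp (divr_gt0 e0 S0).
exists h0 => // h hp hh0 {}i {}j; rewrite mxE mul_diag_mx [X in _ + X]mxE mul_mx_diag !mxE.
have -> : pi i * p h i j - p h j i * pi j
   = pi i * (p h i j - (i == j)%:R - h * Q i j)
   - pi j * (p h j i - (j == i)%:R - h * Q j i).
  have e1 : pi i * (i == j)%:R = pi j * (j == i)%:R.
    by rewrite eq_sym; case: eqP => [->//|_]; rewrite !mulr0.
  by have := rev i j; nra.
apply: le_trans (ler_normB _ _) _; rewrite !normrM.
have := H h hp hh0 i j; have := H h hp hh0 j i.
set c := e / S => H1 H2.
apply: (@le_trans _ _ (`|pi i| * (c * h) + `|pi j| * (c * h))).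
  by rewrite lerD// ler_wpM2l.
rewrite -mulrDl -[leRHS](_ : S * (c * h) = _).
  rewrite ler_wpM2r// ?mulr_ge0 ?(ltW hp) ?invr_ge0 ?(ltW e0) ?(ltW S0)//.
  by have := sp i; have := sp j; rewrite /S; nra.
by rewrite mulrA /c mulrCA divff ?mulr1// gt_eqF.
Qed.

End intertwine.

(** * The principal eigenvector and the contraction rate of a step *)

Lemma le_max_state (R : realType) (N : nat) (f : 'I_N.+1 -> R) i :
  f i <= max_state f.
Proof. exact: le_bigmax. Qed.

Lemma min_state_le (R : realType) (N : nat) (f : 'I_N.+1 -> R) i :
  min_state f <= f i.
Proof. exact: bigmin_le. Qed.

Lemma min_state_gt0 (R : realType) (N : nat) (f : 'I_N.+1 -> R) :
  (forall i, 0 < f i) -> 0 < min_state f.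
Proof. by move=> f0; rewrite /min_state; elim/big_ind: _ => // x y; rewrite lt_min => -> ->. Qed.

(** First-order condition at a minimum of a quadratic function. *)
Lemma linear_term_eq0 (R : realFieldType) (b c : R) :
  (forall t, 0 <= 2 * t * b + t ^+ 2 * c) -> b = 0.
Proof.
move=> H; apply/eqP/negPn/negP => b0.
pose k : R := `|c| + 1; have k0 : 0 < k by rewrite ltr_wpDl.
have := H (- b / k).
have -> : 2 * (- b / k) * b + (- b / k) ^+ 2 * c
    = b ^+ 2 / k ^+ 2 * (c - 2 * k) by field; rewrite gt_eqF.
rewrite pmulr_rge0; last by rewrite divr_gt0// exprn_even_gt0//= gt_eqF.
rewrite leNgt => /negP; apply; rewrite subr_lt0.
by have := ler_norm c; rewrite /k; have := normr_ge0 c; lra.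
Qed.

Section spectral.
Context (R : realType) (N : nat) (Q : 'M[R]_N.+1) (pi beta xi : 'I_N.+1 -> R).
Hypothesis consQ : conservative_Qmatrix Q.
Hypothesis irrQ : irreducible_Qmatrix Q.
Hypothesis pi_ge0 : forall i, 0 <= pi i.
Hypothesis pi_sum1 : \sum_i pi i = 1.
Hypothesis rev : forall i j, pi i * Q i j = pi j * Q j i.

(** Detailed balance carries positivity of [pi] along the edges of [Q]. *)
Lemma invariant_gt0 i : 0 < pi i.
Proof.
have [a pia] : exists a, 0 < pi a.
  apply/not_existsP => H; have := @ltr01 R; rewrite -pi_sum1 big1 ?ltxx// => a _.
  by apply/eqP; rewrite eq_le pi_ge0 andbT leNgt; apply/negP/H.
have /connectP[s] := irrQ a i.
elim: s a pia => [a pia _ /= -> //|k s IH a pia /= /andP[/andP[ak Qak]]].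
apply: IH; rewrite lt_def pi_ge0 andbT; apply/eqP => pik.
have := mulr_gt0 pia Qak; rewrite rev pik mul0r ltxx //.
Qed.

Let lam := lambda0 Q pi beta.
Let beta0 := max_state (fun i => `|beta i|).
Let q0 := max_state (fun i => - Q i i).

Lemma absbeta_le i : `|beta i| <= beta0. Proof. exact: le_max_state. Qed.

Lemma beta_le i : beta i <= beta0.
Proof. exact: le_trans (ler_norm _) (absbeta_le i). Qed.

(** Expanding the square, both terms in [f ^+ 2] vanish: the rows of [Q] sum to zero,
    and so do the columns of [pi * Q] by reversibility. *)
Lemma dirichletE f : dirichlet Q pi beta f =
  - (\sum_i \sum_j pi i * Q i j * (f i * f j)) - \sum_i pi i * beta i * f i ^+ 2.
Proof.
rewrite /dirichlet; congr (_ - _).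
have z1 : \sum_i \sum_j pi i * Q i j * f i ^+ 2 = 0.
  rewrite big1// => i _; rewrite -mulr_suml -mulr_sumr.
  by rewrite (consQ.2 i) mulr0 mul0r.
have z2 : \sum_i \sum_j pi i * Q i j * f j ^+ 2 = 0.
  rewrite exchange_big/= big1// => j _; under eq_bigr do rewrite rev.
  by rewrite -mulr_suml -mulr_sumr (consQ.2 j) mulr0 mul0r.
transitivity (2^-1 * (\sum_i \sum_j pi i * Q i j * f i ^+ 2
   + \sum_i \sum_j pi i * Q i j * f j ^+ 2
   - 2 * \sum_i \sum_j pi i * Q i j * (f i * f j))); last first.
  by rewrite z1 z2; field.
congr (_ * _); rewrite mulr_sumr -sumrN -!big_split; apply: eq_bigr => i _ /=.
rewrite mulr_sumr -sumrN -!big_split; apply: eq_bigr => j _ /=; ring.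
Qed.

Lemma dirichlet_ge f : - beta0 * \sum_i pi i * f i ^+ 2 <= dirichlet Q pi beta f.
Proof.
rewrite /dirichlet mulNr -[leLHS]add0r lerD//.
  apply: mulr_ge0 => //; apply: sumr_ge0 => i _; apply: sumr_ge0 => j _.
  have [->|ij] := eqVneq i j; first by rewrite subrr expr0n mulr0.
  by rewrite mulr_ge0 ?sqr_ge0// mulr_ge0// consQ.1.
rewrite lerN2 mulr_sumr; apply: ler_sum => i _.
by rewrite mulrAC [leLHS]mulrC ler_wpM2r ?beta_le// mulr_ge0 ?sqr_ge0.
Qed.

(** Both sides are homogeneous of degree two, so normalising [f] is enough. *)
Lemma lambda0_le f : lam * \sum_i pi i * f i ^+ 2 <= dirichlet Q pi beta f.
Proof.
set S := \sum_i _.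
have S0 : 0 <= S by apply: sumr_ge0 => i _; rewrite mulr_ge0 ?sqr_ge0.
have unit g : \sum_i pi i * g i ^+ 2 = 1 -> lam <= dirichlet Q pi beta g.
  move=> g1; apply: ge_inf; last by exists g.
  exists (- beta0) => _ [h /= h1 <-].
  by have := dirichlet_ge h; rewrite h1 mulr1.
have [SE|Sn0] := eqVneq S 0.
  have f0 i : f i = 0.
    have /psumr_eq0P/(_ i) := SE.
    rewrite /= => /(_ (fun j _ => mulr_ge0 (pi_ge0 j) (sqr_ge0 _)) isT)/eqP.
    by rewrite mulf_eq0 gt_eqF ?invariant_gt0//= sqrf_eq0 => /eqP.
  rewrite SE mulr0 dirichletE !big1 ?oppr0 ?addr0// => i _.
    by rewrite f0 expr0n mulr0.
  by rewrite big1// => j _; rewrite f0 mul0r mulr0.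
have Sp : 0 < S by rewrite lt_def Sn0.
pose r := Num.sqrt S; have r2 : r ^+ 2 = S by rewrite sqr_sqrtr.
have rn0 : r != 0 by rewrite gt_eqF// sqrtr_gt0.
have := unit (fun i => f i / r).
have -> : \sum_i pi i * (f i / r) ^+ 2 = 1.
  transitivity (S / S); last by rewrite divff.
  by rewrite mulr_suml; apply: eq_bigr => i _; rewrite expr_div_n r2 mulrA.
move=> /(_ erefl).
have -> : dirichlet Q pi beta (fun i => f i / r) = dirichlet Q pi beta f / S.
  rewrite !dirichletE mulrBl mulNr !mulr_suml; congr (- _ - _).
    apply: eq_bigr => i _; rewrite mulr_suml; apply: eq_bigr => j _.
    by rewrite -r2; field.
  by apply: eq_bigr => i _; rewrite -r2; field.
by rewrite ler_pdivlMr.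
Qed.

Lemma lambda0_le_of_beta B : (forall i, - beta i <= B) -> lam <= B.
Proof.
move=> HB; have := lambda0_le (fun=> 1).
under eq_bigr do rewrite /= expr1n mulr1.
rewrite pi_sum1 mulr1 => /le_trans; apply.
rewrite dirichletE; under eq_bigr do under eq_bigr do rewrite !mulr1.
rewrite big1 => [|i _]; last by rewrite -mulr_sumr (consQ.2 i) mulr0.
rewrite oppr0 add0r -sumrN -[B]mul1r -[X in X * B]pi_sum1 mulr_suml.
by apply: ler_sum => i _; rewrite /= expr1n mulr1 -mulrN ler_wpM2l.
Qed.

Lemma lambda0_le_beta0 : lam <= beta0.
Proof.
apply: lambda0_le_of_beta => i; apply: le_trans (absbeta_le i).
by rewrite -normrN ler_norm.
Qed.

Hypothesis xi_min : dirichlet Q pi beta xi = lam * \sum_i pi i * xi i ^+ 2.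

(** The quadratic form [dirichlet - lambda0] is nonnegative and vanishes at [xi], so
    its polar form vanishes at [xi] against the indicator of [i]. *)
Lemma minimizer_eigen i : \sum_j Q i j * xi j = - (lam + beta i) * xi i.
Proof.
pose B (f g : 'I_N.+1 -> R) := - (\sum_i \sum_j pi i * Q i j * (f i * g j))
  - \sum_i pi i * (beta i + lam) * (f i * g i).
have BE f : B f f = dirichlet Q pi beta f - lam * \sum_i pi i * f i ^+ 2.
  rewrite dirichletE -addrA; congr (_ + _); rewrite -opprD; congr (- _).
  rewrite mulr_sumr -big_split/=; apply: eq_bigr => k _; ring.
have Bge0 f : 0 <= B f f by rewrite BE subr_ge0; exact: lambda0_le.
have Bsym f g : B f g = B g f.
  rewrite /B; congr (- _ - _).
    rewrite exchange_big /=; apply: eq_bigr => k _; apply: eq_bigr => l _.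
    by rewrite -rev [f _ * _]mulrC.
  by apply: eq_bigr => k _; rewrite [f _ * _]mulrC.
have BD f g h t : B (fun k => f k + t * g k) h = B f h + t * B g h.
  have E1 : \sum_k \sum_j pi k * Q k j * ((f k + t * g k) * h j)
     = \sum_k \sum_j pi k * Q k j * (f k * h j)
       + t * \sum_k \sum_j pi k * Q k j * (g k * h j).
    rewrite mulr_sumr -big_split/=; apply: eq_bigr => k _.
    rewrite mulr_sumr -big_split/=; apply: eq_bigr => l _; ring.
  have E2 : \sum_k pi k * (beta k + lam) * ((f k + t * g k) * h k)
     = \sum_k pi k * (beta k + lam) * (f k * h k)
       + t * \sum_k pi k * (beta k + lam) * (g k * h k).
    rewrite mulr_sumr -big_split/=; apply: eq_bigr => k _; ring.
  by rewrite /B E1 E2; ring.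
pose e (k : 'I_N.+1) : R := (k == i)%:R.
have Bexi : B e xi = - (pi i * (\sum_j Q i j * xi j + (beta i + lam) * xi i)).
  rewrite /B (bigD1 i)//= [X in - (_ + X) - _]big1 => [|k ki]; last first.
    by rewrite big1// => l _; rewrite /e (negbTE ki) mul0r mulr0.
  rewrite [X in _ - X](bigD1 i)//= [X in _ - (_ + X)]big1 => [|k ki]; last first.
    by rewrite /e (negbTE ki) mul0r mulr0.
  rewrite !addr0 /e eqxx.
  have -> : \sum_j pi i * Q i j * (true%:R * xi j) = pi i * \sum_j Q i j * xi j.
    by rewrite mulr_sumr; apply: eq_bigr => l _; rewrite mul1r mulrA.
  by rewrite mulr1n; ring.
have : B e xi = 0.
  apply: (@linear_term_eq0 _ _ (B e e)) => t.
  have := Bge0 (fun k => xi k + t * e k).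
  rewrite BD [B xi _]Bsym [B e (fun _ => _)]Bsym !BD (Bsym xi e).
  have -> : B xi xi = 0 by rewrite BE xi_min subrr.
  by congr (0 <= _); ring.
rewrite Bexi => /eqP; rewrite oppr_eq0 mulf_eq0 gt_eqF ?invariant_gt0//=.
by rewrite addr_eq0 => /eqP ->; ring.
Qed.

Lemma generator_bound (g : 'I_N.+1 -> R) G i : (forall j, `|g j| <= G) ->
  `|\sum_j Q i j * g j| <= 2 * q0 * G.
Proof.
move=> gG; apply: le_trans (ler_norm_sum _ _ _) _.
have G0 : 0 <= G by exact: le_trans (gG i).
apply: (@le_trans _ _ (\sum_j `|Q i j| * G)).
  by apply: ler_sum => j _; rewrite normrM ler_wpM2l.
rewrite -mulr_suml ler_wpM2r//.
have off : \sum_(j | j != i) `|Q i j| = - Q i i.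
  have := consQ.2 i; rewrite (bigD1 i)//= => /eqP; rewrite addrC addr_eq0 => /eqP <-.
  by apply: eq_bigr => j ji; rewrite ger0_norm// consQ.1// eq_sym.
have Qii : Q i i <= 0 by rewrite -oppr_ge0 -off sumr_ge0.
rewrite (bigD1 i)//= off ler0_norm//.
by have := le_max_state (fun i => - Q i i) i; rewrite -/q0; lra.
Qed.

Variables (p : R -> 'M[R]_N.+1) (L delta : R).
Hypothesis tfp : transition_function Q p.
Hypothesis L_gt0 : 0 < L.
Hypothesis lam_gt0 : 0 < lam.
Hypothesis xi_gt0 : forall i, 0 < xi i.
Hypothesis delta_gt0 : 0 < delta.
Hypothesis delta_lt1 : delta < 1.
Hypothesis delta_small :
  delta < Num.min (1 / (32 * L ^+ 2)) ((lam / kappa Q beta xi L) ^+ 2).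
Hypothesis beta_ge : forall i, - (2 * L) <= beta i.

(** This is at least [(1 - L * delta) ^+ 2]. *)
Lemma em_factor_ge0 i : 0 <= 1 + beta i * delta + L ^+ 2 * delta ^+ 2.
Proof.
have := sqr_ge0 (1 - L * delta).
have : - (2 * L) * delta <= beta i * delta by rewrite ler_wpM2r// ltW.
nra.
Qed.

(** To first order [p delta xi = xi + delta * Q xi = (1 - delta * (lam + beta)) xi], so
    the growth [1 + beta i * delta] cancels and a factor [1 - delta * lam] remains.
    The bound on [delta] is what absorbs the second-order terms. *)
Lemma em_contraction_rate : exists2 rho, 0 <= rho < 1 &
  forall i, (1 + beta i * delta + L ^+ 2 * delta ^+ 2)
     * (\sum_j p delta i j * xi j) <= rho * xi i.
Proof.
move: delta_small; rewrite lt_min => /andP[dL dk].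
set kap := kappa Q beta xi L in dk.
have beta0_ge0 : 0 <= beta0 by apply: le_trans (absbeta_le ord0).
have q0_ge0 : 0 <= q0.
  have := generator_bound ord0 (G := 1) (g := fun=> 1).
  rewrite normr1 => /(_ (fun=> lexx _)) /(le_trans (normr_ge0 _)).
  by rewrite mulr1 pmulr_rge0.
set M := max_state xi; set mm := min_state xi.
have xiM i : xi i <= M by exact: le_max_state.
have mxi i : mm <= xi i by exact: min_state_le.
have mm0 : 0 < mm by exact: min_state_gt0.
have M0 : 0 < M by exact: lt_le_trans (xiM ord0).
pose K : R := (1 + 12 * q0) * beta0 + 8 * L ^+ 2 * (5 + 6 * beta0).
have L2 : 0 < L ^+ 2 by rewrite exprn_gt0.
have qb : 0 <= q0 * beta0 by rewrite mulr_ge0.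
have K0 : 0 < K by rewrite /K; nra.
have kapE : kap = K * M / mm by [].
have kap0 : 0 < kap by rewrite kapE divr_gt0// mulr_gt0.
have Kkap : K <= kap.
  rewrite kapE ler_pdivlMr// ler_wpM2l ?(ltW K0)//.
  exact: le_trans (mxi ord0) (xiM ord0).
pose s : R := Num.sqrt delta.
have s0 : 0 < s by rewrite sqrtr_gt0.
have s2 : s ^+ 2 = delta by rewrite sqr_sqrtr// ltW.
have s1 : s < 1 by rewrite -(@ltr_pXn2r _ 2)// ?nnegrE ?ltW// s2 expr1n.
have slam : s * kap < lam.
  rewrite -ltr_pdivlMr//.
  have q0' : 0 <= lam / kap by exact: divr_ge0 (ltW lam_gt0) (ltW kap0).
  by rewrite -(@ltr_pXn2r _ 2) ?nnegrE ?s2// ltW.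
have lamL : lam <= 2 * L by apply: lambda0_le_of_beta => i; rewrite lerNl.
have lamb := lambda0_le_beta0.
have Ls : L * s < 4^-1.
  rewrite -(@ltr_pXn2r _ 2)// ?nnegrE ?mulr_ge0 ?(ltW s0) ?(ltW L_gt0)//.
  rewrite exprMn s2; move: dL; rewrite ltr_pdivlMr ?mulr_gt0//.
  lra.
have d2 : L ^+ 2 * delta ^+ 2 <= 4^-1.
  have : L ^+ 2 * delta <= 4^-1.
    rewrite -s2 -exprMn; have : 0 <= L * s by rewrite mulr_ge0// ltW.
    nra.
  apply: le_trans; rewrite expr2 mulrA ler_piMr ?(ltW delta_lt1)//.
  by rewrite mulr_ge0// ltW.
have sb : s * beta0 <= 2 * L.
  have : s * beta0 <= s * kap.
    rewrite ler_wpM2l ?(ltW s0)//; apply: le_trans Kkap.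
    by rewrite /K; nra.
  move=> /le_trans; apply; exact: le_trans (ltW slam) lamL.
have bd : beta0 * delta <= 2^-1.
  rewrite -s2 expr2; have := ler_wpM2l (ltW s0) sb; nra.
exists (1 - delta * (lam - s * kap)); last first.
  move=> i; set c := 1 + _ + _.
  have c0 : 0 <= c by exact: em_factor_ge0.
  have c2 : c <= 2.
    have : beta i * delta <= beta0 * delta.
      by rewrite ler_wpM2r ?beta_le// ltW.
    by rewrite /c; lra.
  pose g : 'cV[R]_N.+1 := \col_k xi k.
  have QgE k : (Q *m g) k 0 = - (lam + beta k) * xi k.
    by rewrite mxE -minimizer_eigen; apply: eq_bigr => j _; rewrite mxE.
  have Qg k : `|(Q *m g) k 0| <= 2 * beta0 * M.
    rewrite QgE normrM normrN (gtr0_norm (xi_gt0 k)) ler_pM ?(ltW (xi_gt0 k))//.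
    apply: le_trans (ler_normD _ _) _; rewrite (gtr0_norm lam_gt0).
    by have := absbeta_le k; lra.
  have QQg k : `|(Q *m (Q *m g)) k 0| <= 4 * q0 * beta0 * M.
    rewrite [(Q *m (Q *m g)) k 0]mxE.
    apply: le_trans (@generator_bound (fun j => (Q *m g) j 0) _ k Qg) _.
    by rewrite le_eqVlt; apply/orP; left; apply/eqP; ring.
  have := tf_second_order tfp (ltW delta_gt0) QQg i.
  have -> : (p delta *m g - g - delta *: (Q *m g)) i 0
      = \sum_j p delta i j * xi j - xi i - delta * (- (lam + beta i) * xi i).
    rewrite -minimizer_eigen !mxE; congr (_ - _ - _ * _);
      by apply: eq_bigr => j _; rewrite mxE.
  set r := \sum_j _; set A := - (lam + beta i) * xi i.
  move=> /(le_trans (ler_norm _)) rB.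
  have xi0 := xi_gt0 i.
  have kxi : K * M <= kap * xi i.
    rewrite kapE -[leRHS]mulrA ler_peMr ?(ltW (mulr_gt0 K0 M0))//.
    by rewrite mulrC ler_pdivlMr// mul1r.
  apply: (@le_trans _ _ (xi i - delta * lam * xi i + delta * s * (K * M))); last first.
    have : delta * s * (K * M) <= delta * s * (kap * xi i).
      by rewrite ler_wpM2l// mulr_ge0 ?ltW.
    lra.
  have cr : c * r <= c * (xi i + delta * A + delta ^+ 2 * (4 * q0 * beta0 * M)).
    by rewrite ler_wpM2l//; lra.
  apply: le_trans cr _.
  have dd : 0 < delta ^+ 2 by rewrite exprn_gt0.
  (* Multiplying out, [delta * lam * xi i] is the gain; the four other terms are of
     order [delta ^+ 2] and [e5] bounds their sum by [delta * s * K * M], using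
     [delta <= s] for [s = sqrt delta]. *)
  have e1 : L ^+ 2 * delta ^+ 2 * xi i <= delta ^+ 2 * M * L ^+ 2.
    have := ler_wpM2l (ltW (mulr_gt0 L2 dd)) (xiM i); lra.
  have e2 : beta i * delta ^+ 2 * A <= delta ^+ 2 * M * L ^+ 2.
    have -> : beta i * delta ^+ 2 * A
       = delta ^+ 2 * xi i * (- (beta i * (lam + beta i))) by rewrite /A; ring.
    have t1 : - (beta i * (lam + beta i)) <= L ^+ 2.
      have l2 : lam * lam <= (2 * L) * (2 * L) by exact: ler_pM (ltW _) (ltW _) _ _.
      by have := sqr_ge0 (beta i + lam / 2); lra.
    have := ler_wpM2l (ltW (mulr_gt0 dd xi0)) t1.
    have := ler_wpM2l (ltW (mulr_gt0 L2 dd)) (xiM i); lra.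
  have e3 : L ^+ 2 * delta * delta ^+ 2 * A <= delta ^+ 2 * M * (2 * L ^+ 2 * beta0).
    have t1 : A <= 2 * beta0 * M.
      by apply: le_trans (ler_norm _) _; rewrite /A -QgE.
    have t2 : A * delta <= 2 * beta0 * M.
      have t3 : 0 <= 2 * beta0 * M by rewrite !mulr_ge0// ltW.
      apply: le_trans (ler_wpM2r (ltW delta_gt0) t1) _.
      by rewrite ler_piMr// ltW.
    have := ler_wpM2l (ltW (mulr_gt0 L2 dd)) t2; lra.
  have e4 : c * (delta ^+ 2 * (4 * q0 * beta0 * M)) <= delta ^+ 2 * M * (8 * q0 * beta0).
    have t1 : 0 <= delta ^+ 2 * (4 * q0 * beta0 * M).
      by rewrite !mulr_ge0// ltW.
    have := ler_wpM2r t1 c2; lra.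
  have e5 : delta ^+ 2 * M * (2 * L ^+ 2 + 2 * L ^+ 2 * beta0 + 8 * q0 * beta0)
     <= delta * s * (K * M).
    have t1 : delta ^+ 2 * M <= delta * s * M.
      rewrite ler_wpM2r ?(ltW M0)// expr2 ler_wpM2l ?(ltW delta_gt0)//.
      by rewrite -s2 expr2 ler_piMl// ltW.
    rewrite [K * M]mulrC [leRHS]mulrA ler_pM//.
    - by rewrite mulr_ge0// ltW.
    - have := ltW L2; have : 0 <= L ^+ 2 * beta0 by rewrite mulr_ge0// ltW.
      nra.
    - have := ltW L2; have : 0 <= L ^+ 2 * beta0 by rewrite mulr_ge0// ltW.
      rewrite /K; nra.
  rewrite /c in e4 *.
  set E1 := L ^+ 2 * delta ^+ 2 * xi i in e1.
  set E2 := beta i * delta ^+ 2 * A in e2.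
  set E3 := L ^+ 2 * delta * delta ^+ 2 * A in e3.
  have -> : (1 + beta i * delta + L ^+ 2 * delta ^+ 2) *
     (xi i + delta * A + delta ^+ 2 * (4 * q0 * beta0 * M))
     = xi i - delta * lam * xi i + (E1 + E2 + E3
       + (1 + beta i * delta + L ^+ 2 * delta ^+ 2) *
         (delta ^+ 2 * (4 * q0 * beta0 * M))).
    by rewrite /E1 /E2 /E3 /A; ring.
  rewrite lerD2l; lra.
have t1 : delta * (lam - s * kap) <= 1.
  have : delta * (lam - s * kap) <= delta * lam.
    rewrite ler_wpM2l ?(ltW delta_gt0)// gerBl mulr_ge0// ltW//.
  have : delta * lam <= delta * beta0 by rewrite ler_wpM2l// ltW.
  lra.
rewrite subr_ge0 t1/= ltrBlDr ltrDl mulr_gt0// subr_gt0//.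
Qed.

End spectral.

(** * Borel sets of column vectors *)

Section borel_vectors.
Context (R : realType) (n : nat).
Implicit Types x y : 'cV[R]_n.

Lemma borelV_open (U : set 'cV[R]_n) : open U -> measurable (U : set (borelV R n)).
Proof. exact: sub_sigma_algebra. Qed.

Lemma borelV_continuous (f : 'cV[R]_n -> R) : continuous f ->
  measurable_fun setT (f : borelV R n -> R).
Proof.
move=> fc; apply: (measurability (@RGenOInfty.G R)).
  exact: RGenOInfty.measurableE.
move=> _ [_ [a ->] <-]; rewrite setTI; apply: borelV_open.
by apply: open_comp => //; exact: interval_open.
Qed.

Lemma measurable_coord j : measurable_fun setT (fun x : borelV R n => (x : 'cV[R]_n) j 0).
Proof. by apply: borelV_continuous; exact: coord_continuous. Qed.

(** Rational data make the family countable. *)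
Definition rbox (q : 'cV[rat]_n * nat) : set 'cV[R]_n :=
  [set x | forall j, `|x j 0 - ratr (q.1 j 0)| < q.2.+1%:R^-1].

Lemma open_bigcup_rbox (U : set 'cV[R]_n) : open U ->
  U = \bigcup_(q in [set q | rbox q `<=` U]) rbox q.
Proof.
move=> oU; apply/seteqP; split => [x Ux|x [q /= qU xq]]; last exact: qU.
have /nbhs_ballP[e /= e0 eU] : nbhs x U by exact: open_nbhs_nbhs.
pose k := Num.trunc (2 / e).
have ke : 2 / e < k.+1%:R by rewrite truncnS_gt.
have [u [uE u0 u2]] : exists u : R, [/\ u = k.+1%:R^-1, 0 < u & u + u < e].
  exists k.+1%:R^-1; split=> //.
  move: ke; rewrite ltr_pdivrMr// -ltr_pdivrMl ?ltr0n// => ke.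
  by move: (k.+1%:R^-1) ke => u ke; lra.
have H j : exists q : rat, `|x j 0 - ratr q| < u.
  have [|q] := @rat_in_itvoo R (x j 0 - u) (x j 0 + u); first by lra.
  rewrite in_itv/= => /andP[q1 q2]; exists q.
  by rewrite ltr_norml; apply/andP; split; lra.
have [q qH] := choice H.
exists (\col_j q j, k) => [y yq|j]; last by rewrite mxE -uE.
apply: eU; split => // i j; rewrite (ord1 j) /ball /=.
have := qH i; have := yq i; rewrite /= mxE -uE => h1 h2.
have -> : x i 0 - y i 0 = (x i 0 - ratr (q i)) - (y i 0 - ratr (q i)) by ring.
apply: le_lt_trans (ler_normB _ _) _; lra.
Qed.

(** An open set is a countable union of boxes, which only involve coordinates. *)
Lemma measurable_vec d (T : measurableType d) (f : T -> borelV R n) :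
  (forall j, measurable_fun setT (fun w => (f w : 'cV[R]_n) j 0)) ->
  measurable_fun setT f.
Proof.
move=> mf; apply: (@measurability _ _ T (borelV R n) _ _ (@open 'cV[R]_n)) => //.
move=> _ [U oU <-]; rewrite setTI (open_bigcup_rbox oU) preimage_bigcup bigcup_mkcond.
apply: countable_bigcupT_measurable => [|q]; first exact: countableP.
case: ifPn => // _.
have -> : f @^-1` rbox q = \bigcap_(j in [set: 'I_n])
    [set w | `|(f w : 'cV[R]_n) j 0 - ratr (q.1 j 0)| < q.2.+1%:R^-1].
  by apply/seteqP; split => [w wq j _|w wq j]; [exact: wq|exact: wq j I].
apply: fin_bigcap_measurable => [|j _]; first exact: finite_finset.
have mg : measurable_fun setT (fun w => `|(f w : 'cV[R]_n) j 0 - ratr (q.1 j 0)|).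
  by apply: measurableT_comp => //; exact: measurable_funB.
have /(_ measurableT [set true] I) :=
  measurable_fun_ltr mg (measurable_cst (q.2.+1%:R^-1 : R)).
by rewrite setTI.
Qed.

Definition orthant (b : 'cV[R]_n) : set 'cV[R]_n := [set x | forall j, x j 0 <= b j 0].

Lemma orthantI : setI_closed (range orthant).
Proof.
move=> _ _ [a _ <-] [b _ <-]; exists (\col_j Num.min (a j 0) (b j 0)) => //.
apply/seteqP; split => [x xab|x [xa xb] j].
  by split => j; have := xab j; rewrite mxE le_min => /andP[].
by rewrite mxE le_min xa xb.
Qed.

Lemma orthant_cover : \bigcup_k orthant (const_mx k%:R) = setT.
Proof.
rewrite -subTset => x _; exists (Num.trunc `|x|).+1 => // j; rewrite mxE.
apply: le_trans (ltW (truncnS_gt _)).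
apply: le_trans (ler_norm _) _; rewrite /Num.norm/= mx_normrE.
exact: (le_bigmax _ (fun i : 'I_n * 'I_1 => `|x i.1 i.2|) (j, 0)).
Qed.

(** The coordinates are measurable for the sigma-algebra of the orthants, hence so is
    the identity into the Borel sets. *)
Lemma borelV_orthant : @measurable _ (borelV R n) = <<s range orthant >>.
Proof.
apply/seteqP; split => [A mA|]; last first.
  apply: smallest_sub; first exact: sigma_algebra_measurable.
  move=> _ [b _ <-].
  have -> : orthant b = \bigcap_(j in [set: 'I_n]) [set x : 'cV[R]_n | x j 0 <= b j 0].
    by apply/seteqP; split => [w wq j _|w wq j]; [exact: wq|exact: wq j I].
  apply: fin_bigcap_measurable => [|j _]; first exact: finite_finset.
  rewrite -[X in measurable X]setTI.
  apply: (measurable_fun_le measurableT); [exact: measurable_coord|exact: measurable_cst].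
have mid : measurable_fun setT
    (id : g_sigma_algebraType (range orthant) -> borelV R n).
  apply: measurable_vec => j.
  apply: (measurability (@RGenOInfty.G R)); first exact: RGenOInfty.measurableE.
  move=> _ [_ [a ->] <-]; rewrite setTI.
  have -> : (fun w : g_sigma_algebraType (range orthant) => (w : 'cV[R]_n) j 0) @^-1` `]a, +oo[
     = ~` \bigcup_k orthant (\col_l if l == j then a else k%:R).
    apply/seteqP; split => [x /= + [k _ /(_ j)]|x nx].
      by rewrite in_itv/= andbT mxE eqxx ltNge => /negP.
    rewrite /= in_itv/= andbT ltNge; apply/negP => xa; apply: nx.
    have [k _ kx] : (\bigcup_k orthant (const_mx k%:R)) x by rewrite orthant_cover.
    exists k => // l; rewrite mxE; case: eqP => [->//|_].
    by have := kx l; rewrite mxE.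
  apply: measurableC; apply: bigcupT_measurable => k.
  by apply: sub_sigma_algebra; exists (\col_l if l == j then a else k%:R).
by have := mid measurableT A mA; rewrite setTI.
Qed.

Lemma borelV_measure_eq (m1 m2 : {measure set (borelV R n) -> \bar R}) :
  (m1 setT < +oo)%E -> (forall b, m1 (orthant b) = m2 (orthant b)) ->
  forall A, measurable A -> m1 A = m2 A.
Proof.
move=> m1oo m12 A mA.
apply: (@measure_unique _ R (borelV R n) (range (@orthant))
  (fun k => orthant (const_mx k%:R)) _ _ _ _ m1 m2) => //.
- exact: borelV_orthant.
- exact: orthantI.
- exact: orthant_cover.
- by move=> _ [b _ <-].
- move=> k; apply: le_lt_trans m1oo; apply: le_measure; rewrite ?inE//.
  by rewrite borelV_orthant; apply: sub_sigma_algebra; eexists.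
Qed.

End borel_vectors.

(** * Laws, and measures on a product with the finite state space *)

Section law.
Context d d' (T : measurableType d) (T' : measurableType d') (R : realType).
Context (P : probability T R) (f : T -> T') (mf : measurable_fun setT f).

Let f_mixin := isMeasurableFun.Build _ _ _ _ _ mf.
Let f_pack : {mfun T >-> T'} := HB.pack f f_mixin.

(** [distribution] takes a packed measurable function; this form takes the proof of
    measurability instead, which suits functions built on the spot. *)
Definition law : probability T' R := distribution P f_pack.

Lemma lawE A : law A = P (f @^-1` A). Proof. by []. Qed.

Lemma integral_law (g : T' -> \bar R) : measurable_fun setT g ->
  (forall y, (0 <= g y)%E) -> (\int[law]_y g y = \int[P]_w g (f w))%E.
Proof. by move=> mg g0; exact: ge0_integral_distribution. Qed.

End law.

Section states.
Context d (T1 : measurableType d) (N : nat).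

Lemma measurable_fun_state d' (U : measurableType d') (f : T1 * stateS N -> U) :
  (forall j, measurable_fun setT (fun x => f (x, j))) -> measurable_fun setT f.
Proof.
move=> mf _ A mA; rewrite setTI.
have -> : f @^-1` A = \bigcup_(j in [set: 'I_N.+1])
   (((fun x => f (x, j)) @^-1` A) `*` [set (j : stateS N)]).
  apply/seteqP; split => [[x j] fA|[x j] [k _ [/= fA ->//]]].
  by exists j.
apply: fin_bigcup_measurable => [|j _]; first exact: finite_finset.
by apply: measurableX => //; rewrite -[X in measurable X]setTI; exact: mf.
Qed.

Context (R : realType).

Definition slice (mu : {measure set (T1 * stateS N) -> \bar R}) (j : 'I_N.+1)
  : set T1 -> \bar R := fun B => mu (B `*` [set (j : stateS N)]).

Section slice_measure.
Variables (mu : {measure set (T1 * stateS N) -> \bar R}) (j : 'I_N.+1).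

Let slice0 : slice mu j set0 = 0%E.
Proof. by rewrite /slice set0X measure0. Qed.

Let slice_ge0 A : (0 <= slice mu j A)%E.
Proof. exact: measure_ge0. Qed.

Let slice_sigma_additive : semi_sigma_additive (slice mu j).
Proof.
move=> F mF tF mUF; rewrite /slice setX_bigcupl.
apply: measure_semi_sigma_additive.
- by move=> n; exact: measurableX.
- apply/trivIsetP => a b _ _ ab; rewrite -setXI.
  by move/trivIsetP : tF => ->//; rewrite set0X.
- by rewrite -setX_bigcupl; exact: measurableX.
Qed.

HB.instance Definition _ := isMeasure.Build _ _ _ (slice mu j)
  slice0 slice_ge0 slice_sigma_additive.

End slice_measure.

Lemma integral_slice (mu : {measure set (T1 * stateS N) -> \bar R})
    (f : T1 * stateS N -> \bar R) :
  measurable_fun setT f -> (forall z, 0 <= f z)%E ->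
  (\int[mu]_z f z = \sum_(j < N.+1) \int[slice mu j]_x f (x, j))%E.
Proof.
move=> mf f0.
have -> : [set: T1 * stateS N] = \big[setU/set0]_(j <- index_enum 'I_N.+1)
    ([set: T1] `*` [set (j : stateS N)]).
  apply/seteqP; split => // -[x j] _; rewrite -bigcup_seq; exists j => //=.
  exact: mem_index_enum.
rewrite ge0_integral_bigsetU//=.
- apply: eq_bigr => j _.
  have mp : measurable_fun setT (fun x : T1 => (x, j : stateS N)).
    exact: measurable_fun_pair.
  transitivity (\int[pushforward (slice mu j) (fun x : T1 => (x, j : stateS N))]_(z in
     [set: T1] `*` [set (j : stateS N)]) f z)%E.
    apply: eq_measure_integral => A mA Aj; rewrite /pushforward /slice.
    congr (mu _); apply/seteqP; split => [[x k] Axk|[x k] [/= H ->//]].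
    by have /= [_ kj] := Aj _ Axk; rewrite /preimage/= -kj.
  rewrite ge0_integral_pushforward//; last exact: measurable_funTS.
  by congr (integral _ _ _); apply/seteqP; split.
  exact: measurableX.
- by move=> j; exact: measurableX.
- exact: index_enum_uniq.
- by move=> i k _ _ [x [[_ /= ->] [_ /= ->]]].
- exact: measurable_funTS.
Qed.

End states.

Lemma state_measure_eq (R : realType) (n N : nat)
    (mu nu : probability (borelV R n * stateS N)%type R) :
  (forall b (j : 'I_N.+1), mu (orthant b `*` [set (j : stateS N)])
     = nu (orthant b `*` [set (j : stateS N)])) ->
  forall A, measurable A -> mu A = nu A.
Proof.
move=> mn A mA.
have slice_eq (j : 'I_N.+1) B : measurable B -> slice mu j B = slice nu j B.
  move=> mB; apply: (@borelV_measure_eq _ _ (slice mu j) (slice nu j)) => //.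
  - rewrite /= /slice; apply: le_lt_trans (ltry 1).
    by apply: probability_le1; exact: measurableX.
  - by move=> b; exact: mn.
have mI : measurable_fun setT (fun z : borelV R n * stateS N => ((\1_A z)%:E : \bar R)).
  exact/measurable_EFinP/measurable_indic.
have IE (m : {measure set (borelV R n * stateS N) -> \bar R}) :
    m A = (\int[m]_z (\1_A z)%:E)%E.
  by rewrite integral_indic// setIT.
rewrite !IE !integral_slice//; apply: eq_bigr => j _.
by apply: eq_measure_integral => B mB _; exact: slice_eq.
Qed.

(** * Symmetry and second moment of the centred Gaussian law *)

Section gaussian.
Context (R : realType) (s : R).
Hypothesis s0 : s != 0.
Let mu := @lebesgue_measure R.
Let pdf := normal_pdf 0 s.

Lemma normal_pdfN x : pdf (- x) = pdf x.
Proof. by rewrite /pdf !normal_pdfE//= /normal_fun !subr0 sqrrN. Qed.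

Lemma normal_probN (B : set R) : measurable B ->
  normal_prob 0 s (-%R @^-1` B) = normal_prob 0 s B.
Proof.
move=> mB; rewrite /normal_prob.
transitivity (\int[pushforward mu (-%R : _ -> measurableTypeR R)]_(x in B)
  (pdf x)%:E)%E.
  rewrite ge0_integral_pushforward//=.
  - by apply: eq_integral => x _ /=; rewrite normal_pdfN.
  - by apply/measurable_EFinP/measurable_funTS; exact: measurable_normal_pdf.
  - by move=> x _; rewrite lee_fin normal_pdf_ge0.
by apply: eq_measure_integral => A mA _; exact: lebesgue_measureN.
Qed.

Lemma is_derive_normal_pdf (x : R) :
  is_derive x 1 (fun x => - s ^+ 2 * pdf x) (x * pdf x).
Proof.
have -> : (fun x => - s ^+ 2 * pdf x)
   = (fun x => (- s ^+ 2 * normal_peak s) * expR (- (2 * s ^+ 2)^-1 * x ^+ 2)).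
  apply/funext => y; rewrite /pdf normal_pdfE// /normal_fun subr0 mulrA.
  by congr (_ * expR _); rewrite -[s ^+ 2 *+ 2]mulr_natl; field.
have H : is_derive x (1:R) (fun y : R => - (2 * s ^+ 2)^-1 * y ^+ 2)
    (- (s ^+ 2)^-1 * x).
  apply: is_derive_eq; rewrite /GRing.scale/= !mulr1.
  by field.
have E := @is_derive1_comp _ (expR : R -> R) _ x _ _ (is_derive_expR _) H.
apply: is_derive_eq.
rewrite /pdf normal_pdfE// /normal_fun subr0 /GRing.scale/=.
have -> : - x ^+ 2 / (s ^+ 2 *+ 2) = - (2 * s ^+ 2)^-1 * x ^+ 2.
  by rewrite -[s ^+ 2 *+ 2]mulr_natl; field.
by field.
Qed.

Lemma integral_normal_prob_bounded (f : R -> R) (U : set R) (M : R) :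
  measurable U -> measurable_fun U f -> (forall x, U x -> `|f x| <= M) ->
  (\int[normal_prob 0 s]_(x in U) (f x)%:E =
   \int[mu]_(x in U) (f x * pdf x)%:E)%E.
Proof.
move=> mU mf fM; have dom := normal_prob_dominates 0 s.
have mfE : measurable_fun U (EFin \o f) by exact/measurable_EFinP.
rewrite -(Radon_Nikodym_change_of_variables dom)//=; last first.
  apply: measurable_bounded_integrable => //.
    by apply: le_lt_trans (ltry 1); exact: probability_le1.
  exists M; split; first exact: num_real.
  by move=> M' MM' x Ux; apply: le_trans (fM x Ux) (ltW MM').
under [RHS]eq_integral do rewrite EFinM.
have ipdf := integrable_normal_pdf 0 s.
apply: ae_eq_integral => //.
- apply: emeasurable_funM => //; apply: (measurable_int mu).
  apply: (integrableS _ _ (@subsetT _ _)) => //=.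
  exact: Radon_Nikodym_integrable.
- apply: emeasurable_funM => //=; apply/measurable_EFinP.
  by apply/measurable_funTS; exact: measurable_normal_pdf.
- apply: ae_eqe_mul2l => /=.
  rewrite Radon_NikodymE//=.
  case: cid => /= h [h1 h2 h3].
  apply: integral_ae_eq => //=.
  + exact: integrableS h2.
  + by apply/measurable_EFinP/measurable_funTS; exact: measurable_normal_pdf.
  + by move=> E EU mE; rewrite -h3.
Qed.

(** Integration by parts: [- s ^+ 2 * pdf] is a primitive of [x * pdf x], and the
    boundary terms have the right sign. *)
Lemma normal_second_moment_itv (a : R) : 0 < a ->
  (\int[normal_prob 0 s]_(x in `[(- a)%R, a]) (x ^+ 2)%:E <= (s ^+ 2)%:E)%E.
Proof.
move=> a0.
rewrite (@integral_normal_prob_bounded _ _ (a ^+ 2))//; last first.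
  move=> x /=; rewrite in_itv/= => ax; rewrite normrX lerXn2r ?nnegrE ?(ltW a0)//.
  by rewrite ler_norml.
have cpdf : continuous pdf by exact: continuous_normal_pdf.
have cs (f : R -> R) : continuous f -> {within `[- a, a], continuous f}.
  exact: continuous_subspaceT.
have cF : continuous (fun x => - s ^+ 2 * pdf x).
  by move=> x; apply: cvgM; [exact: cvg_cst|exact: cpdf].
have cf : continuous (fun x : R => x * pdf x).
  by move=> x; apply: cvgM; [exact: cvg_id|exact: cpdf].
have aa : - a < a by rewrite gtrN.
have LR (f : R -> R) : continuous f -> (forall x, derivable f x 1) ->
    derivable_oo_LRcontinuous f (- a) a.
  move=> fc fd; split => // [].
    exact: cvg_at_right_filter (fc _).
  exact: cvg_at_left_filter (fc _).
pose F x : R := - s ^+ 2 * pdf x.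
have dF (x : R) : is_derive x 1 F (x * pdf x) by exact: is_derive_normal_pdf.
have I2 : mu.-integrable `[- a, a] (fun x => (pdf x)%:E).
  exact: integrableS (integrable_normal_pdf 0 s).
have I1 : mu.-integrable `[- a, a] (fun x => (x ^+ 2 * pdf x)%:E).
  apply: continuous_compact_integrable; first exact: segment_compact.
  apply: cs => x; apply: cvgM; last exact: cpdf.
  exact: exprn_continuous.
have LF : derivable_oo_LRcontinuous F (- a) a.
  by apply: LR => // x; have [] := dF x.
have Lid : derivable_oo_LRcontinuous (@id R) (- a) a.
  by apply: LR => // x; exact: cvg_id.
have F' : {in `](- a), a[, derive1 F =1 (fun x => x * pdf x)}.
  by move=> x _; rewrite derive1E; have [_ <-] := dF x.
have c1 : {within `[- a, a], continuous (cst 1 : R -> R)}.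
  by apply: cs => x; exact: cvg_cst.
have id' : {in `](- a), a[, derive1 (@id R) =1 cst 1}.
  by move=> x _; rewrite derive1E derive_id.
have := integration_by_parts aa (cs _ cf) LF F'
  c1 Lid id'.
have -> : (\int[mu]_(x in `[(- a)%R, a]) (F x * cst 1 x)%:E
   = (- s ^+ 2)%:E * \int[mu]_(x in `[(- a)%R, a]) (pdf x)%:E)%E.
  rewrite -integralZl//; apply: eq_integral => x _.
  by rewrite /F mulr1 EFinM.
have -> : (\int[mu]_(x in `[(- a)%R, a]) (x * pdf x * id x)%:E
   = \int[mu]_(x in `[(- a)%R, a]) (x ^+ 2 * pdf x)%:E)%E.
  by apply: eq_integral => x _; rewrite mulrAC expr2.
have P2 : (\int[mu]_(x in `[(- a)%R, a]) (pdf x)%:E <= 1)%E.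
  exact: (@probability_le1 _ _ _ (normal_prob 0 s)).
set i1 := (\int[mu]_(x in _) (x ^+ 2 * pdf x)%:E)%E.
have f1 : i1 \is a fin_num by apply: integrable_fin_num.
set i2 := (\int[mu]_(x in _) (pdf x)%:E)%E in P2 *.
have f2 : i2 \is a fin_num by apply: integrable_fin_num.
move: P2; rewrite -(fineK f1) -(fineK f2); move: (fine i1) (fine i2) => r1 r2 r21.
move=> [] E; move: r21; rewrite !lee_fin => r21.
have pa := normal_pdf_ge0 0 s a; have pa' := normal_pdf_ge0 0 s (- a).
have s2 := sqr_ge0 s.
have t1 := mulr_ge0 (mulr_ge0 s2 pa) (ltW a0).
have t2 := mulr_ge0 (mulr_ge0 s2 pa') (ltW a0).
have t3 := ler_wpM2l s2 r21.
move: E; rewrite /F/= /pdf; lra.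
Qed.

Lemma normal_second_moment : (\int[normal_prob 0 s]_x (x ^+ 2)%:E <= (s ^+ 2)%:E)%E.
Proof.
have -> : [set: R] = \bigcup_k `[(- k.+1%:R : R), k.+1%:R]%classic.
  apply/seteqP; split => // x _; exists (Num.trunc `|x|) => //=.
  by rewrite in_itv/= -ler_norml ltW// truncnS_gt.
have H := @ge0_nondecreasing_set_cvg_integral _ (measurableTypeR R) R
  (fun k => `[(- k.+1%:R : R), k.+1%:R]%classic) (fun x => (x ^+ 2)%:E)
  (normal_prob 0 s).
apply: (cvge_to_le (H _ _ _ _)) => //.
- move=> k l kl; rewrite subsetEset => x /=; rewrite !in_itv/= => /andP[x1 x2].
  have kl' : k.+1%:R <= l.+1%:R :> R by rewrite ler_nat.
  by rewrite (le_trans x2 kl') (le_trans _ x1)// lerN2.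
- by move=> k; apply/measurable_EFinP/measurable_funTS; exact: exprn_measurable.
- by move=> k x _; rewrite lee_fin sqr_ge0.
by apply: nearW => k; exact: normal_second_moment_itv.
Qed.

End gaussian.

(** * Independence of generated sigma-algebras *)

Section independence.
Context d (T : measurableType d) (R : realType) (P : probability T R).

(** As functions of [X] the two sides are finite measures that agree on a pi-system. *)
Lemma indep_g_sigmal (A : set (set T)) Y : A `<=` measurable -> setI_closed A ->
  A setT -> measurable Y -> (forall X, A X -> P (X `&` Y) = (P X * P Y)%E) ->
  forall X, <<s A >> X -> P (X `&` Y) = (P X * P Y)%E.
Proof.
move=> Am AI AT mY AY X sX.
have PY0 : 0 <= fine (P Y) by rewrite fine_ge0.
pose r := NngNum PY0.
have PYE : P Y = (fine (P Y))%:E by rewrite fineK// fin_num_measure.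
transitivity (mscale r P X); last by rewrite /mscale/= -PYE muleC.
transitivity (mrestr P mY X) => //.
apply: (@g_sigma_algebra_measure_unique _ R T A Am (fun=> setT) _ _ (mrestr P mY) (mscale r P)) => //.
- by rewrite bigcup_const.
- by move=> Z AZ; rewrite /= /mrestr /mscale/= -PYE AY// muleC.
- by move=> _; rewrite /= /mrestr setTI (le_lt_trans (probability_le1 _ mY))// ltry.
Qed.

Lemma indep_g_sigma (A B : set (set T)) : A `<=` measurable -> B `<=` measurable ->
  setI_closed A -> setI_closed B -> A setT -> B setT ->
  (forall X Y, A X -> B Y -> P (X `&` Y) = (P X * P Y)%E) ->
  forall X Y, <<s A >> X -> <<s B >> Y -> P (X `&` Y) = (P X * P Y)%E.
Proof.
move=> Am Bm AI BI AT BT AB X Y sX sY.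
have mY : measurable Y by exact: (smallest_sub (@sigma_algebra_measurable _ T) Bm).
apply: (@indep_g_sigmal A) => // {sX}X AX.
rewrite setIC muleC; apply: (@indep_g_sigmal B) => //; first exact: Am.
by move=> Z BZ; rewrite setIC muleC; exact: AB.
Qed.

(** The joint law is the product of the laws, to which Tonelli applies. *)
Lemma integral_indep d1 d2 (U1 : measurableType d1) (U2 : measurableType d2)
    (Z1 : T -> U1) (Z2 : T -> U2) (m1 : measurable_fun setT Z1)
    (m2 : measurable_fun setT Z2) :
  (forall B1 B2, measurable B1 -> measurable B2 ->
     P (Z1 @^-1` B1 `&` Z2 @^-1` B2) = (P (Z1 @^-1` B1) * P (Z2 @^-1` B2))%E) ->
  forall f : U1 * U2 -> \bar R, measurable_fun setT f -> (forall z, 0 <= f z)%E ->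
  (\int[P]_w f (Z1 w, Z2 w) = \int[P]_w \int[law P m1]_e f (e, Z2 w))%E.
Proof.
move=> ind f mf f0.
have m12 : measurable_fun setT (fun w => (Z1 w, Z2 w)) by exact: measurable_fun_pair.
rewrite -(integral_law P m12)//.
transitivity (\int[(law P m1 \x law P m2)%E]_z f z)%E.
  apply: eq_measure_integral => A mA _; apply/esym.
  exact: product_measure_unique.
rewrite fubini_tonelli2// -(integral_law P m2 (g := fun y => \int[law P m1]_e f (e, y))%E)//.
  exact: measurable_fun_fubini_tonelli_G.
by move=> y; apply: integral_ge0.
Qed.

End independence.

Section rectangles.
Context d (T : measurableType d) (R : realType) (P : probability T R).
Context (I : finType) (X : I -> T -> R).
Hypothesis mX : forall i, measurable_fun setT (X i).
Hypothesis indX : mutually_independent P X.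

(** A pi-system that generates the sigma-algebra of the variables in [S]. *)
Definition rectangles (S : pred I) : set (set T) := [set E | exists B : I -> set R,
  [/\ forall i, measurable (B i), forall i, ~~ S i -> B i = setT &
      E = \bigcap_(i in [set: I]) (X i @^-1` B i)]].

Lemma rectangles_measurable S : rectangles S `<=` measurable.
Proof.
move=> _ [B [mB _ ->]]; apply: fin_bigcap_measurable => [|i _]; first exact: finite_finset.
by rewrite -[X in measurable X]setTI; exact: mX.
Qed.

Lemma rectanglesI S : setI_closed (rectangles S).
Proof.
move=> _ _ [B [mB BT ->]] [C [mC CT ->]]; exists (fun i => B i `&` C i); split.
- by move=> i; exact: measurableI.
- by move=> i Si; rewrite BT// CT// setIT.
- by rewrite -bigcapI; apply: eq_bigcapr => i _; rewrite preimage_setI.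
Qed.

Lemma rectanglesT S : rectangles S setT.
Proof.
exists (fun=> setT); split => //.
by apply/seteqP; split.
Qed.

Lemma rectangles_indep S1 S2 : (forall i, ~~ (S1 i && S2 i)) ->
  forall E1 E2, <<s rectangles S1 >> E1 -> <<s rectangles S2 >> E2 ->
  P (E1 `&` E2) = (P E1 * P E2)%E.
Proof.
move=> dis; apply: indep_g_sigma; try exact: rectangles_measurable;
  try exact: rectanglesI; try exact: rectanglesT.
move=> _ _ [B [mB BT ->]] [C [mC CT ->]].
have -> : \bigcap_(i in [set: I]) (X i @^-1` B i) `&` \bigcap_(i in [set: I]) (X i @^-1` C i)
   = \bigcap_(i in [set: I]) (X i @^-1` (B i `&` C i)).
  by rewrite -bigcapI; apply: eq_bigcapr => i _; rewrite preimage_setI.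
rewrite !indX//; last by move=> i; exact: measurableI.
rewrite -big_split/=; apply: eq_bigr => i _.
have := dis i; rewrite negb_and => /orP[/BT ->|/CT ->].
  by rewrite setTI preimage_setT probability_setT mul1e.
by rewrite setIT preimage_setT probability_setT mule1.
Qed.

Lemma rectangles_coord (S : pred I) i : S i ->
  measurable_fun setT (X i : g_sigma_algebraType (rectangles S) -> R).
Proof.
move=> Si _ B mB; rewrite setTI; apply: sub_sigma_algebra.
exists (fun k => if k == i then B else setT); split.
- by move=> k; case: ifP.
- by move=> k; case: eqP => // ->; rewrite Si.
apply/seteqP; split => [w XB k _|w /(_ i Logic.I)]; rewrite /preimage/=; last by rewrite eqxx.
by case: eqP => // ->.
Qed.

End rectangles.

(** * Increments of the Brownian motion *)

Section noise.
Context d (T : measurableType d) (R : realType) (P : probability T R) (m : nat).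
Context (W : R -> T -> borelV R m) (delta : R).
Hypothesis bmW : brownian_motion P W.
Hypothesis delta_gt0 : 0 < delta.

Definition increment (l : nat) (w : T) : borelV R m :=
  (W (l.+1%:R * delta) w : 'cV[R]_m) - (W (l%:R * delta) w : 'cV[R]_m).

Let time_ge0 l : 0 <= l%:R * delta.
Proof. by rewrite mulr_ge0// ltW. Qed.

Let coordinate K (a : 'I_K * 'I_m) (w : T) : R :=
  (increment a.1 w : 'cV[R]_m) a.2 0.

Lemma measurable_increment_coord l j :
  measurable_fun setT (fun w => (increment l w : 'cV[R]_m) j 0).
Proof.
have -> : (fun w => (increment l w : 'cV[R]_m) j 0) = (fun w =>
    (W (l.+1%:R * delta) w : 'cV[R]_m) j 0 - (W (l%:R * delta) w : 'cV[R]_m) j 0).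
  by apply/funext => w; rewrite /increment !mxE.
apply: measurable_funB; apply: (measurableT_comp (measurable_coord j));
  exact: (bm_measurable bmW).
Qed.

Lemma measurable_increment l : measurable_fun setT (increment l).
Proof. by apply: measurable_vec => j; exact: measurable_increment_coord. Qed.

Lemma increment_coord_indep K : mutually_independent P (@coordinate K).
Proof.
have lt l : (l%:R * delta : R) < l.+1%:R * delta by rewrite ltr_pM2r// ltr_nat.
have := @bm_independent _ _ _ _ _ _ bmW K (fun l => l%:R * delta) (time_ge0 0) lt.
congr (mutually_independent P _); apply/funext => a; apply/funext => w.
by rewrite /coordinate /increment !mxE.
Qed.

(** Only the first [K] increments are considered, since the independence of the
    increments of a Brownian motion is a statement on finite families. *)
Definition noise_events K (S : pred nat) : set (set T) :=
  rectangles (@coordinate K) (fun a => S a.1).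

Lemma increment_adapted K (S : pred nat) l : (l < K)%N -> S l ->
  measurable_fun setT (increment l : g_sigma_algebraType (noise_events K S) -> borelV R m).
Proof.
move=> lK Sl; apply: measurable_vec => j.
exact: (@rectangles_coord _ _ _ _ (@coordinate K) (fun a => S a.1) (Ordinal lK, j)).
Qed.

Lemma noise_events_measurable K S : noise_events K S `<=` measurable.
Proof.
by apply: rectangles_measurable => a; exact: measurable_increment_coord.
Qed.

Lemma adapted_measurable K S d' (U : measurableType d') (Z : T -> U) :
  measurable_fun setT (Z : g_sigma_algebraType (noise_events K S) -> U) ->
  measurable_fun setT Z.
Proof.
move=> mZ _ B mB; have := mZ measurableT B mB; rewrite !setTI => H.
apply: (smallest_sub (@sigma_algebra_measurable _ T) _ H).
exact: noise_events_measurable.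
Qed.

Definition noise_law : probability (borelV R m) R := law P (measurable_increment 0).

Lemma increment_rect l (B : 'I_m -> set R) : (forall j, measurable (B j)) ->
  P [set w | forall j, B j ((increment l w : 'cV[R]_m) j 0)]
  = (\prod_j normal_prob 0 (Num.sqrt delta) (B j))%E.
Proof.
move=> mB.
pose C (a : 'I_l.+1 * 'I_m) := if a.1 == ord_max then B a.2 else setT.
have mC a : measurable (C a) by rewrite /C; case: ifP.
have -> : [set w | forall j, B j ((increment l w : 'cV[R]_m) j 0)]
   = \bigcap_(a in [set: 'I_l.+1 * 'I_m]) (coordinate a @^-1` C a).
  apply/seteqP; split => [w /= wB [k j] _|w wC j].
    rewrite /preimage/= /C/=; case: eqP => //= ->; exact: wB.
  by have := wC (ord_max, j) I; rewrite /preimage/= /C/= eqxx.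
rewrite (increment_coord_indep mC).
rewrite -(pair_bigA _ (fun k j => P (coordinate (k, j) @^-1` C (k, j))))/=.
rewrite (bigD1 ord_max)//= [X in (_ * X)%E]big1 ?mule1 => [|k kl]; last first.
  by rewrite big1// => j _; rewrite /C/= (negbTE kl) preimage_setT probability_setT.
apply: eq_bigr => j _; rewrite /C/= eqxx.
have lt : (l%:R * delta : R) < l.+1%:R * delta by rewrite ltr_pM2r// ltr_nat.
have := bm_gaussian bmW j (time_ge0 l) lt (mB j).
have -> : l.+1%:R * delta - l%:R * delta = delta by rewrite -mulrBl -natrB// subSnn mul1r.
move=> <-; congr (P _); apply/seteqP; split => w /=;
  by rewrite /coordinate /increment /preimage/= !mxE.
Qed.

Lemma noise_law_rect (B : 'I_m -> set R) : (forall j, measurable (B j)) ->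
  noise_law [set e | forall j, B j ((e : 'cV[R]_m) j 0)]
  = (\prod_j normal_prob 0 (Num.sqrt delta) (B j))%E.
Proof. by move=> mB; rewrite -(increment_rect 0 mB). Qed.

Lemma measurable_ray (r : R) : measurable [set x | x <= r].
Proof.
by rewrite (_ : [set x | x <= r] = `]-oo, r]%classic)//; apply/seteqP; split => x /=;
  rewrite in_itv.
Qed.

(** The coordinates of every increment are independent with the same Gaussian law,
    so all increments give the same mass to orthants. *)
Lemma law_increment l A : measurable A -> law P (measurable_increment l) A = noise_law A.
Proof.
move=> mA; apply: borelV_measure_eq => //.
  by apply: (@le_lt_trans _ _ 1%E); [exact: probability_le1|exact: ltry].
move=> b; rewrite [RHS](noise_law_rect (B := fun j => [set x | x <= b j 0])) => [|j].
  rewrite -(increment_rect l)// => j; exact: measurable_ray.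
exact: measurable_ray.
Qed.

(** The increment [l] can be integrated out of a function of itself and of the
    increments in [S], with [l] not in [S]. *)
Lemma integral_increment_indep K S l d' (U : measurableType d') (Z : T -> U) f :
  (l < K)%N -> ~~ S l ->
  measurable_fun setT (Z : g_sigma_algebraType (noise_events K S) -> U) ->
  measurable_fun setT f -> (forall z, 0 <= f z)%E ->
  (\int[P]_w f (increment l w, Z w) = \int[P]_w \int[noise_law]_e f (e, Z w))%E.
Proof.
move=> lK Sl mZ mf f0.
have mZ' := adapted_measurable mZ.
rewrite (integral_indep (measurable_increment l) mZ' _ mf f0).
  by apply: eq_integral => w _; apply: eq_measure_integral => A mA _; exact: law_increment.
move=> B1 B2 mB1 mB2.
apply: (@rectangles_indep _ _ _ P _ (@coordinate K) _ _ (fun a => val a.1 == l) (fun a => S a.1)).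
- by move=> a; exact: measurable_increment_coord.
- exact: increment_coord_indep.
- by move=> a; apply/negP => /andP[/eqP ->]; exact/negP.
- by have := @increment_adapted K (pred1 l) l lK (eqxx _) measurableT _ mB1; rewrite setTI.
- by have := mZ measurableT _ mB2; rewrite setTI.
Qed.

End noise.

(** * Moments of the noise *)

Section has_mean.
Context d (T : measurableType d) (R : realType) (P : probability T R).

(** Integrability and value together, so that means can be combined linearly without
    side conditions. *)
Definition has_mean (f : T -> R) (c : R) : Prop :=
  P.-integrable setT (EFin \o f) /\ (\int[P]_w (f w)%:E = c%:E)%E.

Lemma has_mean_eq f g c : f =1 g -> has_mean f c -> has_mean g c.
Proof. by move=> /funext ->. Qed.

Lemma has_mean_cst c : has_mean (fun=> c) c.
Proof.
split; first exact: finite_measure_integrable_cst.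
by rewrite integral_cst// [X in (_ * X)%E]probability_setT mule1.
Qed.

Lemma has_meanD f g a b : has_mean f a -> has_mean g b ->
  has_mean (fun w => f w + g w) (a + b).
Proof.
move=> [If fa] [Ig gb]; split.
  by apply: (eq_integrable measurableT _ _ _ (integrableD measurableT If Ig)).
under eq_integral do rewrite EFinD.
by rewrite integralD//= fa gb.
Qed.

Lemma has_meanZ f a k : has_mean f a -> has_mean (fun w => k * f w) (k * a).
Proof.
move=> [If fa]; split.
  by apply: (eq_integrable measurableT _ _ _ (integrableZl measurableT k If)).
under eq_integral do rewrite EFinM.
by rewrite integralZl//= fa.
Qed.

Lemma has_mean_sum (I : Type) (s : seq I) (f : I -> T -> R) a :
  (forall i, has_mean (f i) (a i)) ->
  has_mean (fun w => \sum_(i <- s) f i w) (\sum_(i <- s) a i).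
Proof.
move=> H; elim: s => [|i s IH].
  apply: (has_mean_eq _ (has_mean_cst _)) => w; by rewrite !big_nil.
rewrite big_cons; apply: (has_mean_eq _ (has_meanD (H i) IH)) => w.
by rewrite big_cons.
Qed.

(** The change of variables [phi] shows that the mean equals its opposite. *)
Lemma has_mean_odd (phi : T -> T) (mphi : measurable_fun setT phi) f :
  (forall A, measurable A -> P (phi @^-1` A) = P A) ->
  P.-integrable setT (EFin \o f) -> (forall w, f (phi w) = - f w) ->
  has_mean f 0.
Proof.
move=> inv If odd; split => //.
have : (\int[P]_w (f w)%:E = - \int[P]_w (f w)%:E)%E.
  rewrite -[RHS](@integralN _ _ _ _ _ (EFin \o f)); last exact: integrable_add_def.
  transitivity (\int[pushforward P phi]_w (f w)%:E)%E.
    by apply: eq_measure_integral => A mA _; exact/esym/inv.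
  rewrite (@integral_pushforward _ _ _ _ _ _ mphi)//=.
  - by rewrite preimage_setT; apply: eq_integral => w _ /=; rewrite odd.
  - exact: measurable_int If.
  - rewrite preimage_setT; apply: (eq_integrable measurableT _ _ _ (integrableN If)).
    by move=> w _ /=; rewrite odd.
have /= := integrable_fin_num measurableT If.
move: (\int[P]_w (f w)%:E)%E => [r| |]//= _ [] rr.
by congr EFin; lra.
Qed.

End has_mean.

Section noise_moments.
Context d (T : measurableType d) (R : realType) (P : probability T R) (m : nat).
Context (W : R -> T -> borelV R m) (delta : R).
Hypothesis bmW : brownian_motion P W.
Hypothesis delta_gt0 : 0 < delta.
Let gam := noise_law bmW delta_gt0.

Let coord (j : 'I_m) (e : borelV R m) : R := (e : 'cV[R]_m) j 0.

Let sd_neq0 : Num.sqrt delta != 0.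
Proof. by rewrite gt_eqF// sqrtr_gt0. Qed.

Lemma noise_coord_law j (B : set R) : measurable B ->
  gam (coord j @^-1` B) = normal_prob 0 (Num.sqrt delta) B.
Proof.
move=> mB; have := @noise_law_rect _ _ _ P _ _ _ bmW delta_gt0
  (fun k => if k == j then B else setT).
rewrite (bigD1 j)//= eqxx big1 ?mule1 => [<-|k kj]; last first.
- by rewrite (negbTE kj) probability_setT.
- by move=> k; case: ifP.
congr (gam _); apply/seteqP; split => e; rewrite /preimage/= => H.
  by move=> k; case: eqP => // ->.
by have := H j; rewrite eqxx.
Qed.

(** Marginals of the noise are centred Gaussians of variance [delta]. *)
Lemma noise_coord_sq j : (\int[gam]_e (coord j e ^+ 2)%:E <= delta%:E)%E.
Proof.
have mj : measurable_fun setT (coord j : borelV R m -> measurableTypeR R).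
  exact: measurable_coord.
have m2 : measurable_fun setT (fun x : measurableTypeR R => ((x : R) ^+ 2)%:E).
  by apply/measurable_EFinP; exact: exprn_measurable.
rewrite -(integral_law gam mj m2) => [|y]; last by rewrite lee_fin sqr_ge0.
have := normal_second_moment sd_neq0; rewrite sqr_sqrtr ?(ltW delta_gt0)//.
apply: le_trans; rewrite le_eqVlt; apply/orP; left; apply/eqP.
apply: eq_measure_integral => A mA _; exact: noise_coord_law.
Qed.

Let coord_sq_int j : gam.-integrable setT (fun e => (coord j e ^+ 2)%:E).
Proof.
apply/integrableP; split.
  by apply/measurable_EFinP; apply: measurable_funX; exact: measurable_coord.
under eq_integral do rewrite gee0_abs ?lee_fin ?sqr_ge0//.
exact: le_lt_trans (noise_coord_sq j) (ltry _).
Qed.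

Let coord_mul_int j k : gam.-integrable setT (EFin \o (fun e => coord j e * coord k e)).
Proof.
apply: (le_integrable measurableT _ _ (integrableD measurableT (coord_sq_int j) (coord_sq_int k))).
  by apply/measurable_EFinP; apply: measurable_funM; exact: measurable_coord.
move=> e _ /=; rewrite lee_fin [leRHS]ger0_norm ?addr_ge0 ?sqr_ge0// normrM.
rewrite -[coord j e ^+ 2]real_normK ?num_real// -[coord k e ^+ 2]real_normK ?num_real//.
have := sqr_ge0 (`|coord j e| - `|coord k e|).
have := normr_ge0 (coord j e); have := normr_ge0 (coord k e); nra.
Qed.

Let coord_int j : gam.-integrable setT (EFin \o coord j).
Proof.
have I1 : gam.-integrable setT (fun=> 1%:E) by exact: finite_measure_integrable_cst.
apply: (le_integrable measurableT _ _ (integrableD measurableT I1 (coord_sq_int j))).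
  by apply/measurable_EFinP; exact: measurable_coord.
move=> e _ /=; rewrite lee_fin [leRHS]ger0_norm ?addr_ge0 ?sqr_ge0//.
rewrite -[coord j e ^+ 2]real_normK ?num_real//.
have := sqr_ge0 (`|coord j e| - 1); have := normr_ge0 (coord j e); nra.
Qed.

Let flip (j : 'I_m) (e : borelV R m) : borelV R m :=
  \col_k (if k == j then - (e : 'cV[R]_m) k 0 else (e : 'cV[R]_m) k 0).

Let measurable_flip j : measurable_fun setT (flip j).
Proof.
apply: measurable_vec => k; rewrite /flip.
under eq_fun do rewrite mxE.
case: eqP => _; [apply: measurableT_comp => //|]; exact: measurable_coord.
Qed.

Let flip_inv j A : measurable A -> gam (flip j @^-1` A) = gam A.
Proof.
move=> mA; apply: (@borelV_measure_eq _ _ (law gam (measurable_flip j))) => //.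
  by apply: (@le_lt_trans _ _ 1%E); [exact: probability_le1|exact: ltry].
move=> b; pose B (k : 'I_m) := [set x : R | x <= b k 0].
have mB k : measurable (B k) by exact: measurable_ray.
pose C k := if k == j then -%R @^-1` (B k) else B k.
have mC k : measurable (C k).
  rewrite /C; case: ifP => // _; rewrite -[X in measurable X]setTI.
  exact: (@oppr_measurable R setT).
transitivity (gam [set e | forall k, C k (coord k e)]).
  congr (gam _); apply/seteqP; split => e; rewrite /preimage/= => H k; have := H k;
    rewrite /flip mxE /C/B/coord; by case: eqP.
rewrite /gam noise_law_rect//.
transitivity (\prod_k normal_prob 0 (Num.sqrt delta) (B k))%E; last first.
  exact/esym/(noise_law_rect bmW delta_gt0 mB).
apply: eq_bigr => k _; rewrite /C; case: ifP => // _; exact: normal_probN.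
Qed.

Lemma noise_mean j : has_mean gam (coord j) 0.
Proof.
apply: (has_mean_odd (measurable_flip j)) => //; first exact: flip_inv.
by move=> e; rewrite /coord /flip mxE eqxx.
Qed.

Lemma noise_cov j k : j != k -> has_mean gam (fun e => coord j e * coord k e) 0.
Proof.
move=> jk; apply: (has_mean_odd (measurable_flip j)) => //; first exact: flip_inv.
by move=> e; rewrite /coord /flip !mxE eqxx eq_sym (negbTE jk) mulNr.
Qed.

Lemma noise_var j : exists2 v, 0 <= v <= delta & has_mean gam (fun e => coord j e * coord j e) v.
Proof.
have I := coord_mul_int j j.
exists (fine (\int[gam]_e (coord j e * coord j e)%:E)); last first.
  by split => //; rewrite fineK//; exact: integrable_fin_num.
have ge0 : (0 <= \int[gam]_e (coord j e * coord j e)%:E)%E.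
  by apply: integral_ge0 => e _; rewrite lee_fin -expr2 sqr_ge0.
rewrite fine_ge0//= -lee_fin fineK; last exact: integrable_fin_num.
by have := noise_coord_sq j; under eq_integral do rewrite expr2.
Qed.

Lemma hsnorm_sqr p q (A : 'M[R]_(p, q)) : hsnorm A ^+ 2 = \sum_i \sum_j A i j ^+ 2.
Proof.
rewrite sqr_sqrtr//; apply: sumr_ge0 => i _; apply: sumr_ge0 => j _.
exact: sqr_ge0.
Qed.

(** Expanding the square, the terms with a single coordinate or with two distinct
    ones have mean zero, because flipping the sign of a coordinate preserves
    the law of the noise. *)
Lemma noise_mean_square p (u : 'cV[R]_p) (A : 'M[R]_(p, m)) :
  exists2 c, c <= hsnorm u ^+ 2 + delta * hsnorm A ^+ 2 &
  has_mean gam (fun e : borelV R m => hsnorm (u + A *m (e : 'cV[R]_m)) ^+ 2) c.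
Proof.
have /choice[v vP] j : exists v, 0 <= v <= delta /\ has_mean gam (fun e => coord j e * coord j e) v.
  by have [v v01 vj] := noise_var j; exists v.
pose V j k : R := if j == k then v j else 0.
have HV j k : has_mean gam (fun e => coord j e * coord k e) (V j k).
  rewrite /V; case: eqP => [<-|/eqP jk]; first by have [] := vP j.
  exact: noise_cov.
exists (\sum_i (u i 0 ^+ 2 + \sum_j (2 * u i 0 * A i j) * 0
   + \sum_j \sum_k (A i j * A i k) * V j k)).
  rewrite !hsnorm_sqr mulr_sumr -big_split/=; apply: ler_sum => i _.
  rewrite big1 ?addr0 => [|j _]; last by rewrite mulr0.
  rewrite big_ord1 lerD2l mulr_sumr; apply: ler_sum => j _.
  rewrite (bigD1 j)//= big1 => [|k kj]; last first.
    by rewrite /V eq_sym (negbTE kj) mulr0.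
  rewrite addr0 /V eqxx -expr2 mulrC ler_wpM2r ?sqr_ge0//.
  by have [/andP[]] := vP j.
apply: (@has_mean_eq _ _ _ _ (fun e => \sum_i (u i 0 ^+ 2 +
    \sum_j (2 * u i 0 * A i j) * coord j e
   + \sum_j \sum_k (A i j * A i k) * (coord j e * coord k e)))); last first.
  apply: has_mean_sum => i; apply: has_meanD.
    apply: has_meanD; first exact: has_mean_cst.
    by apply: has_mean_sum => j; apply: has_meanZ; exact: noise_mean.
  by apply: has_mean_sum => j; apply: has_mean_sum => k; apply: has_meanZ.
move=> e; rewrite hsnorm_sqr; apply/esym/eq_bigr => i _.
rewrite big_ord1 !mxE sqrrD; congr (_ + _ + _).
  transitivity (2 * u i 0 * \sum_j A i j * (e : 'cV[R]_m) j 0); first by ring.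
  rewrite mulr_sumr; apply: eq_bigr => j _.
  by rewrite /coord; ring.
rewrite expr2 mulr_suml; apply: eq_bigr => j _.
rewrite mulr_sumr; apply: eq_bigr => k _; rewrite /coord; ring.
Qed.

End noise_moments.

(** * One step of the scheme *)

Section euclidean.
Context (R : realType).

Lemma hsnorm_ge0 p q (A : 'M[R]_(p, q)) : 0 <= hsnorm A.
Proof. exact: sqrtr_ge0. Qed.

Lemma le_hsnorm_entry p q (A : 'M[R]_(p, q)) i j : `|A i j| <= hsnorm A.
Proof.
rewrite -sqrtr_sqr ler_wsqrtr// (bigD1 i)//= (bigD1 j)//= -addrA lerDl.
by rewrite addr_ge0// sumr_ge0// => k _; rewrite ?sumr_ge0// => *; exact: sqr_ge0.
Qed.

Lemma hsnorm_sqr_col n (x : 'cV[R]_n) : hsnorm x ^+ 2 = \sum_i x i 0 ^+ 2.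
Proof. by rewrite hsnorm_sqr; apply: eq_bigr => i _; rewrite big_ord1. Qed.

Lemma hsnorm_le_sum n (x : 'cV[R]_n) : hsnorm x <= \sum_i `|x i 0|.
Proof.
have S0 : 0 <= \sum_i `|x i 0| by exact: sumr_ge0.
rewrite -(@ler_pXn2r _ 2) ?nnegrE ?hsnorm_ge0// hsnorm_sqr_col.
rewrite expr2 mulr_suml; apply: ler_sum => i _.
rewrite -real_normK ?num_real// expr2 ler_wpM2l//.
by rewrite (bigD1 i)//= lerDl sumr_ge0.
Qed.

(** The topology of column vectors is that of the sup norm, which bounds the
    Euclidean norm up to a factor. *)
Lemma continuous_of_hsnorm n (f : 'cV[R]_n -> R) K :
  (forall x y, `|f x - f y| <= K * hsnorm (x - y)) -> continuous f.
Proof.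
move=> fK x; apply: (proj2 (@cvgrPdist_le _ _ _ (nbhs x) (nbhs_filter x) f (f x))) => e e0.
pose c : R := (`|K| + 1) * n.+1%:R.
have c0 : 0 < c by rewrite mulr_gt0// ltr_wpDl.
have ec : 0 < e / c by rewrite divr_gt0.
near=> y; have [_ xy] : ball x (e / c) y by near: y; exact: nbhsx_ballx.
apply: le_trans (fK _ _) _.
have h : hsnorm (x - y) <= n%:R * (e / c).
  apply: le_trans (hsnorm_le_sum _) _.
  rewrite -[n in n%:R]card_ord mulr_natl -sumr_const; apply: ler_sum => j _.
  by rewrite !mxE; exact: ltW (xy j 0).
have h' : hsnorm (x - y) <= n.+1%:R * (e / c).
  by apply: le_trans h _; rewrite ler_wpM2r ?(ltW ec)// ler_nat.
apply: (@le_trans _ _ ((`|K| + 1) * (n.+1%:R * (e / c)))); last first.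
  have cu : e / c * c = e by rewrite divfK// gt_eqF.
  by rewrite -[leRHS]cu [leRHS]mulrC {2}/c -mulrA.
apply: (@le_trans _ _ ((`|K| + 1) * hsnorm (x - y))).
  by rewrite ler_wpM2r ?hsnorm_ge0// (le_trans (ler_norm _))// lerDl.
by rewrite ler_wpM2l// addr_ge0.
Unshelve. all: by end_near. Qed.

(** The square of [L * x + y] is nonnegative. *)
Lemma inner_cross n (L : R) (x y : 'cV[R]_n) : 0 < L -> hsnorm y <= L * hsnorm x ->
  - (2 * L) * hsnorm x ^+ 2 <= 2 * inner x y.
Proof.
move=> L0 yx.
have y2 : hsnorm y ^+ 2 <= L ^+ 2 * hsnorm x ^+ 2.
  by rewrite -exprMn lerXn2r ?nnegrE ?hsnorm_ge0 ?mulr_ge0 ?hsnorm_ge0 ?(ltW L0).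
have : 0 <= \sum_i (L * x i 0 + y i 0) ^+ 2 by apply: sumr_ge0 => i _; exact: sqr_ge0.
have -> : \sum_i (L * x i 0 + y i 0) ^+ 2
   = L ^+ 2 * hsnorm x ^+ 2 + 2 * L * inner x y + hsnorm y ^+ 2.
  rewrite !hsnorm_sqr_col /inner !mulr_sumr -!big_split/=.
  by apply: eq_bigr => i _; ring.
move=> H; rewrite -(ler_pM2l L0); move: H y2; move: (hsnorm x ^+ 2) (hsnorm y ^+ 2) => a c.
rewrite expr2; lra.
Qed.

Lemma hsnorm_sqrD n (x y : 'cV[R]_n) (k : R) :
  hsnorm (x + k *: y) ^+ 2 = hsnorm x ^+ 2 + k * (2 * inner x y) + k ^+ 2 * hsnorm y ^+ 2.
Proof.
rewrite !hsnorm_sqr_col /inner !mulr_sumr -!big_split/=.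
by apply: eq_bigr => i _; rewrite !mxE; ring.
Qed.

End euclidean.

Section em_map.
Context (R : realType) (n m N : nat).
Context (b : 'cV[R]_n -> 'I_N.+1 -> 'cV[R]_n).
Context (sigma : 'cV[R]_n -> 'I_N.+1 -> 'M[R]_(n, m)).
Context (L delta : R) (beta : 'I_N.+1 -> R).
Hypothesis lip : forall i x y,
  hsnorm (b x i - b y i) + hsnorm (sigma x i - sigma y i) <= L * hsnorm (x - y).
Hypothesis diss : forall i x y,
     2 * inner (x - y) (b x i - b y i) + hsnorm (sigma x i - sigma y i) ^+ 2
     <= beta i * hsnorm (x - y) ^+ 2.
Hypothesis L_gt0 : 0 < L.
Hypothesis delta_gt0 : 0 < delta.

Definition em_map (i : 'I_N.+1) (x : borelV R n) (e : borelV R m) : borelV R n :=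
  (x : 'cV[R]_n) + delta *: b x i + sigma x i *m (e : 'cV[R]_m).

Let lip_b i x y : hsnorm (b x i - b y i) <= L * hsnorm (x - y).
Proof. by apply: le_trans (lip i x y); rewrite lerDl hsnorm_ge0. Qed.

Let lip_sigma i x y : hsnorm (sigma x i - sigma y i) <= L * hsnorm (x - y).
Proof. by apply: le_trans (lip i x y); rewrite lerDr hsnorm_ge0. Qed.

Lemma measurable_em_map i :
  measurable_fun setT (fun z : borelV R n * borelV R m => em_map i z.1 z.2).
Proof.
have cb j : continuous (fun x => b x i j 0).
  apply: (@continuous_of_hsnorm _ _ _ L) => x y; apply: le_trans (lip_b i x y).
  by have := le_hsnorm_entry (b x i - b y i) j 0; rewrite !mxE.
have cs j l : continuous (fun x => sigma x i j l).
  apply: (@continuous_of_hsnorm _ _ _ L) => x y; apply: le_trans (lip_sigma i x y).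
  by have := le_hsnorm_entry (sigma x i - sigma y i) j l; rewrite !mxE.
apply: measurable_vec => j; rewrite /em_map.
have -> : (fun w : borelV R n * borelV R m =>
    ((w.1 : 'cV[R]_n) + delta *: b w.1 i + sigma w.1 i *m (w.2 : 'cV[R]_m)) j 0)
  = (fun w => (w.1 : 'cV[R]_n) j 0 + delta * b w.1 i j 0
      + \sum_l sigma w.1 i j l * (w.2 : 'cV[R]_m) l 0).
  by apply/funext => w; rewrite !mxE.
apply: measurable_funD.
  apply: measurable_funD.
    by apply: (measurableT_comp (measurable_coord j)).
  apply: measurable_funM => //.
  exact: (measurableT_comp (borelV_continuous (cb j))).
apply: measurable_sum => l; apply: measurable_funM.
  exact: (measurableT_comp (borelV_continuous (cs j l))).
exact: (measurableT_comp (measurable_coord l)).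
Qed.

(** The Lipschitz bound limits how fast two distinct points can be driven together;
    with [0 < n] there are two distinct points. *)
Lemma dissipativity_ge i : (0 < n)%N -> - (2 * L) <= beta i.
Proof.
move=> n0; pose x : 'cV[R]_n := const_mx 1.
have x0 : 0 < hsnorm (x - 0) ^+ 2.
  rewrite subr0 exprn_gt0//; apply: lt_le_trans (le_hsnorm_entry x (Ordinal n0) 0).
  by rewrite mxE normr1.
rewrite -(ler_pM2r x0); apply: le_trans (diss i x 0).
apply: le_trans (inner_cross L_gt0 (lip_b i x 0)) _.
by rewrite lerDl sqr_ge0.
Qed.

Section step.
Context d (T : measurableType d) (P : probability T R) (W : R -> T -> borelV R m).
Hypothesis bmW : brownian_motion P W.
Let gam := noise_law bmW delta_gt0.

(** The mean-square of the noise contributes [delta] times the squared norm of the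
    difference of the [sigma], which is the term in the dissipativity condition;
    the drift squared costs [L ^+ 2 * delta ^+ 2]. *)
Lemma em_map_contraction i (x y : 'cV[R]_n) :
  (\int[gam]_e (hsnorm (em_map i x e - em_map i y e : 'cV[R]_n) ^+ 2)%:E
   <= ((1 + beta i * delta + L ^+ 2 * delta ^+ 2) * hsnorm (x - y) ^+ 2)%:E)%E.
Proof.
have [c cle [_ cE]] := noise_mean_square bmW delta_gt0
  ((x - y) + delta *: (b x i - b y i)) (sigma x i - sigma y i).
have -> : (\int[gam]_e (hsnorm (em_map i x e - em_map i y e : 'cV[R]_n) ^+ 2)%:E = c%:E)%E.
  rewrite -cE; apply: eq_integral => e _; congr (hsnorm _ ^+ 2)%:E.
  by rewrite /em_map mulmxBl scalerBr !opprD !addrA; apply/matrixP => k l; rewrite !mxE; ring.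
rewrite lee_fin; apply: le_trans cle _.
rewrite hsnorm_sqrD.
have b2 : hsnorm (b x i - b y i) ^+ 2 <= L ^+ 2 * hsnorm (x - y) ^+ 2.
  by rewrite -exprMn lerXn2r ?nnegrE ?hsnorm_ge0 ?mulr_ge0 ?hsnorm_ge0 ?(ltW L_gt0).
have := ler_wpM2l (ltW delta_gt0) (diss i x y).
have := ler_wpM2l (sqr_ge0 delta) b2.
lra.
Qed.

Lemma em_map_displacement i (x : 'cV[R]_n) :
  exists c : R, (\int[gam]_e (hsnorm (em_map i x e - x : 'cV[R]_n) ^+ 2)%:E <= c%:E)%E.
Proof.
have [c cle [_ cE]] := noise_mean_square bmW delta_gt0 (delta *: b x i) (sigma x i).
exists c; rewrite -cE le_eqVlt; apply/orP; left; apply/eqP.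
apply: eq_integral => e _; congr (hsnorm _ ^+ 2)%:E.
by rewrite /em_map; apply/matrixP => k l; rewrite !mxE; ring.
Qed.

End step.

End em_map.

(** * Forward and backward compositions of random maps *)

Section random_maps.
Context du (U : measurableType du) (R : realType) (m N : nat).
Context (F : 'I_N.+1 -> U -> borelV R m -> U).
Hypothesis mF : forall j, measurable_fun setT (fun z : U * borelV R m => F j z.1 z.2).
Implicit Types (s : seq 'I_N.+1) (g : U -> \bar R).

Section compositions.
Context (T : Type) (eps : nat -> T -> borelV R m).

Fixpoint run l s x w := if s is j :: s' then run l.+1 s' (F j x (eps l w)) w else x.

(** Here the first noise acts last, so that a state appended to [s] only changes
    the point at which the other maps are started: see [bwd_rcons]. *)
Fixpoint bwd l s x w := if s is j :: s' then F j (bwd l.+1 s' x w) (eps l w) else x.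

Lemma bwd_rcons l s j x w :
  bwd l (rcons s j) x w = bwd l s (F j x (eps (l + size s) w)) w.
Proof.
elim: s l => [|k s IH] l /=; first by rewrite addn0.
by rewrite IH addSnnS.
Qed.

Lemma run_rcons l s j x w :
  run l (rcons s j) x w = F j (run l s x w) (eps (l + size s) w).
Proof.
elim: s l x => [|k s IH] l x /=; first by rewrite addn0.
by rewrite IH addSnnS.
Qed.

End compositions.

Section measurability.
Context dt (T : measurableType dt) (eps : nat -> T -> borelV R m).

Lemma measurable_step j d' (V : measurableType d') (f : V -> U) (e : V -> borelV R m) :
  measurable_fun setT f -> measurable_fun setT e ->
  measurable_fun setT (fun v => F j (f v) (e v)).
Proof.
move=> mf me.
exact: (measurableT_comp (mF j) (measurable_fun_pair mf me)).
Qed.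

Lemma measurable_run l s :
  (forall k, (l <= k < l + size s)%N -> measurable_fun setT (eps k)) ->
  measurable_fun setT (fun z : U * T => run eps l s z.1 z.2).
Proof.
elim: s l => [|j s IH] l me /=; first exact: measurable_fst.
have m0 : measurable_fun setT (fun z : U * T => (F j z.1 (eps l z.2), z.2)).
  apply: measurable_fun_pair => //; apply: measurable_step => //.
  by apply: (measurableT_comp (me l _)) => //; rewrite leqnn -addSnnS leq_addr.
have mr : measurable_fun setT (fun z : U * T => run eps l.+1 s z.1 z.2).
  by apply: IH => k /andP[lk kl]; apply: me; rewrite (ltnW lk)/= -addSnnS.
exact: (measurableT_comp mr m0).
Qed.

Lemma measurable_bwd l s :
  (forall k, (l <= k < l + size s)%N -> measurable_fun setT (eps k)) ->
  measurable_fun setT (fun z : U * T => bwd eps l s z.1 z.2).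
Proof.
elim: s l => [|j s IH] l me /=; first exact: measurable_fst.
apply: measurable_step.
  apply: IH => k /andP[lk kl]; apply: me; rewrite (ltnW lk)/=.
  by rewrite -addSnnS.
by apply: (measurableT_comp (me l _)) => //; rewrite leqnn -addSnnS leq_addr.
Qed.

End measurability.

Section kernels.
Context (gam : probability (borelV R m) R).

(** [run_mean] and [bwd_mean] below iterate this along a path, in the order of [run] and
    of [bwd] respectively. *)
Definition map_mean j g x := (\int[gam]_e g (F j x e))%E.

Lemma map_mean_ge0 j g x : (forall y, 0 <= g y)%E -> (0 <= map_mean j g x)%E.
Proof. by move=> g0; apply: integral_ge0. Qed.

Lemma measurable_map_mean j g : measurable_fun setT g -> (forall y, 0 <= g y)%E ->
  measurable_fun setT (map_mean j g).
Proof.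
move=> mg g0.
apply: (@measurable_fun_fubini_tonelli_F _ _ _ _ _ gam (fun z : U * borelV R m => g (F j z.1 z.2))) => //.
exact: (measurableT_comp mg (mF j)).
Qed.

Fixpoint run_mean s g x := if s is j :: s' then map_mean j (run_mean s' g) x else g x.

Fixpoint bwd_mean s g := if s is j :: s' then bwd_mean s' (map_mean j g) else g.

Lemma run_mean_ge0 s g x : (forall y, 0 <= g y)%E -> (0 <= run_mean s g x)%E.
Proof. by move=> g0; elim: s x => //= j s IH x; apply: map_mean_ge0. Qed.

Lemma measurable_run_mean s g : measurable_fun setT g -> (forall y, 0 <= g y)%E ->
  measurable_fun setT (run_mean s g).
Proof.
move=> mg g0; elim: s => //= j s IH; apply: measurable_map_mean => // y.
exact: run_mean_ge0.
Qed.

Lemma bwd_mean_ge0 s g x : (forall y, 0 <= g y)%E -> (0 <= bwd_mean s g x)%E.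
Proof. by elim: s g => [|j s IH] g g0 //=; apply: IH => y; exact: map_mean_ge0. Qed.

End kernels.

Section expectation.
Context d (T : measurableType d) (P : probability T R).
Context (W : R -> T -> borelV R m) (delta : R).
Hypothesis bmW : brownian_motion P W.
Hypothesis delta_gt0 : 0 < delta.
Let gam := noise_law bmW delta_gt0.
Let eps := increment W delta.

(** The first noise is independent of the others and can be integrated out last. *)
Lemma expectation_run l s g x : measurable_fun setT g -> (forall y, 0 <= g y)%E ->
  (\int[P]_w g (run eps l s x w) = run_mean gam s g x)%E.
Proof.
move=> mg g0; elim: s l x => [|j s IH] l x /=.
  by rewrite integral_cst// [X in (_ * X)%E]probability_setT mule1.
pose K := (l + size s).+1; pose S := [pred k | l < k]%N.
pose TS := g_sigma_algebraType (noise_events W delta K S).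
pose f (z : borelV R m * TS) := g (run eps l.+1 s (F j x z.1) z.2).
have mrun : measurable_fun setT (fun z : U * TS => run eps l.+1 s z.1 z.2).
  by apply: measurable_run => k /andP[lk kl]; exact: increment_adapted.
have mf : measurable_fun setT f.
  apply: (measurableT_comp mg).
  have m1 : measurable_fun setT (fun z : borelV R m * TS => (F j x z.1, z.2)).
    by apply: measurable_fun_pair => //; apply: measurable_step.
  exact: (measurableT_comp mrun m1).
have lK : (l < K)%N by rewrite /K ltnS leq_addr.
have Sl : ~~ S l by rewrite /S/= ltnn.
have idT : measurable_fun setT (id : TS -> TS) by exact: measurable_id.
rewrite (@integral_increment_indep _ _ _ P _ _ _ bmW delta_gt0 K S l _ TS id f)//; last first.
  by move=> z; exact: g0.
have mfT : measurable_fun setT (fun z : borelV R m * T => g (run eps l.+1 s (F j x z.1) z.2)).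
  apply: (measurableT_comp mg).
  have m1 : measurable_fun setT (fun z : borelV R m * T => (F j x z.1, z.2)).
    by apply: measurable_fun_pair => //; apply: measurable_step.
  have mrunT : measurable_fun setT (fun z : U * T => run eps l.+1 s z.1 z.2).
    apply: measurable_run => k _; exact: (measurable_increment bmW delta_gt0).
  exact: (measurableT_comp mrunT m1).
rewrite -(@fubini_tonelli _ _ _ _ _ gam P _ mfT)//=.
by apply: eq_integral => e _; exact: IH.
Qed.

Lemma adapted_bwd K (S : pred nat) l s (Z : T -> U) :
  (forall k, (l <= k < l + size s)%N -> S k) -> (l + size s <= K)%N ->
  measurable_fun setT (Z : g_sigma_algebraType (noise_events W delta K S) -> U) ->
  measurable_fun setT ((fun w => bwd eps l s (Z w) w)
    : g_sigma_algebraType (noise_events W delta K S) -> U).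
Proof.
move=> Sk lK mZ; pose TS := g_sigma_algebraType (noise_events W delta K S).
have mb : measurable_fun setT (fun z : U * TS => bwd eps l s z.1 z.2).
  apply: measurable_bwd => k kl; apply: increment_adapted; last exact: Sk.
  by case/andP: kl => _ /leq_trans; apply.
have m1 : measurable_fun setT (fun w : TS => (Z w, w)) by exact: measurable_fun_pair.
exact: (measurableT_comp mb m1).
Qed.

(** The first noise is applied last, hence integrated out first. *)
Lemma expectation_bwd l s g x : measurable_fun setT g -> (forall y, 0 <= g y)%E ->
  (\int[P]_w g (bwd eps l s x w) = bwd_mean gam s g x)%E.
Proof.
elim: s l g => [|j s IH] l g mg g0 /=.
  by rewrite integral_cst// [X in (_ * X)%E]probability_setT mule1.
rewrite -(IH l.+1); last 2 first.
- exact: measurable_map_mean.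
- by move=> y; exact: map_mean_ge0.
pose K := (l + size s).+1; pose S := [pred k | l < k]%N.
pose f (z : borelV R m * U) := g (F j z.2 z.1).
rewrite (@integral_increment_indep _ _ _ P _ _ _ bmW delta_gt0 K S l _ U
  (bwd eps l.+1 s x) f)//.
- by rewrite /K ltnS leq_addr.
- by rewrite /S/= ltnn.
- apply: (@adapted_bwd K S l.+1 s (fun=> x)); last exact: measurable_cst.
    by move=> k /andP[].
  by rewrite /K addSn.
- exact: (measurableT_comp mg (measurable_step _ measurable_snd measurable_fst)).
- by move=> z; exact: g0.
Qed.

(** The contraction estimate [cost (F j x e, F j y e) <= c j * cost (x, y)] in
    mean survives composition because the noise of the last map is independent
    of everything that precedes it. *)
Lemma bwd_contraction (cost : U * U -> \bar R) (c : 'I_N.+1 -> R) :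
  measurable_fun setT cost -> (forall z, 0 <= cost z)%E ->
  (forall j, 0 <= c j) ->
  (forall j x y, (\int[gam]_e cost (F j x e, F j y e) <= (c j)%:E * cost (x, y))%E) ->
  forall K (S : pred nat) l s (Z1 Z2 : T -> U),
  (l + size s <= K)%N -> (forall k, S k -> (l + size s <= k)%N) ->
  measurable_fun setT (Z1 : g_sigma_algebraType (noise_events W delta K S) -> U) ->
  measurable_fun setT (Z2 : g_sigma_algebraType (noise_events W delta K S) -> U) ->
  (\int[P]_w cost (bwd eps l s (Z1 w) w, bwd eps l s (Z2 w) w)
    <= (\prod_(j <- s) c j)%:E * \int[P]_w cost (Z1 w, Z2 w))%E.
Proof.
move=> mcost cost0 c0 cc K S l s Z1 Z2 lK SK mZ1 mZ2.
elim: s l lK SK => [|j s IH] l lK SK /=; first by rewrite big_nil mul1e.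
pose S' : pred nat := fun k => S k || (l < k < l + (size s).+1)%N.
have sub : noise_events W delta K S `<=` noise_events W delta K S'.
  move=> _ [B [mB BT ->]]; exists B; split => // a; rewrite /S' negb_or => /andP[+ _].
  exact: BT.
have mZ' (Z : T -> U) : measurable_fun setT (Z : g_sigma_algebraType (noise_events W delta K S) -> U) ->
    measurable_fun setT (Z : g_sigma_algebraType (noise_events W delta K S') -> U).
  move=> mZ _ B mB; rewrite setTI; have := mZ measurableT B mB; rewrite setTI.
  exact: sub_smallest2r.
pose TS' := g_sigma_algebraType (noise_events W delta K S').
have mB (Z : T -> U) : measurable_fun setT (Z : g_sigma_algebraType (noise_events W delta K S) -> U) ->
    measurable_fun setT ((fun w => bwd eps l.+1 s (Z w) w) : TS' -> U).
  move=> /mZ' mZ; apply: adapted_bwd => //; last by rewrite addSnnS.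
  by move=> k /andP[lk kl]; rewrite /S' lk/= -addSnnS kl orbT.
pose f (z : borelV R m * (U * U)) := cost (F j z.2.1 z.1, F j z.2.2 z.1).
have mf : measurable_fun setT f.
  apply: (measurableT_comp mcost); apply: measurable_fun_pair; apply: measurable_step => //.
    exact: (measurableT_comp measurable_fst measurable_snd).
  exact: (measurableT_comp measurable_snd measurable_snd).
have mBB : measurable_fun setT
   ((fun w => (bwd eps l.+1 s (Z1 w) w, bwd eps l.+1 s (Z2 w) w)) : TS' -> U * U).
  by apply: measurable_fun_pair; exact: mB.
have lK' : (l < K)%N by apply: leq_trans lK; rewrite -addSnnS leq_addr.
have Sl : ~~ S' l.
  rewrite /S' ltnn/= orbF; apply/negP => /SK.
  by rewrite leqNgt -addSnnS ltnS leq_addr.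
rewrite (@integral_increment_indep _ _ _ P _ _ _ bmW delta_gt0 K S' l _ (U * U)%type
  (fun w => (bwd eps l.+1 s (Z1 w) w, bwd eps l.+1 s (Z2 w) w)) f)//; last first.
  by move=> z; exact: cost0.
have mBB' := adapted_measurable bmW delta_gt0 mBB.
apply: (@le_trans _ _ (\int[P]_w ((c j)%:E *
    cost (bwd eps l.+1 s (Z1 w) w, bwd eps l.+1 s (Z2 w) w)))%E).
  apply: ge0_le_integral => //.
  - by move=> w _; apply: integral_ge0 => e _; exact: cost0.
  - have mG := @measurable_fun_fubini_tonelli_G _ _ _ _ _ gam f mf (fun z => cost0 _).
    exact: (measurableT_comp mG mBB').
  - apply: emeasurable_funM; first exact: measurable_cst.
    exact: (measurableT_comp mcost mBB').
  - by move=> w _; exact: cc.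
rewrite ge0_integralZl//; last 2 first.
- exact: (measurableT_comp mcost mBB').
- by rewrite lee_fin.
rewrite big_cons EFinM -muleA lee_wpmul2l ?lee_fin//.
by apply: IH; rewrite ?addSnnS.
Qed.

End expectation.

End random_maps.

(** * Paths of the switching chain *)

Section path_sums.
Context (R : realType) (N : nat) (q : 'I_N.+1 -> 'I_N.+1 -> R).
Hypothesis q_ge0 : forall i j, 0 <= q i j.
Implicit Types H : seq 'I_N.+1 -> \bar R.

(** Expectation of [H] over the [k] states that follow [i], as an iterated sum, so
    that it can be handled with no reference to a probability space. *)
Fixpoint path_mean k i H : \bar R :=
  if k is k'.+1 then (\sum_j (q i j)%:E * path_mean k' j (fun s => H (j :: s)))%E
  else H [::].

Lemma path_mean_ge0 k i H : (forall s, 0 <= H s)%E -> (0 <= path_mean k i H)%E.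
Proof.
elim: k i H => [|k IH] i H H0 //=; apply: sume_ge0 => j _.
by rewrite mule_ge0 ?lee_fin//; exact: IH.
Qed.

Lemma eq_path_mean k i H H' : (forall s, size s = k -> H s = H' s) -> path_mean k i H = path_mean k i H'.
Proof.
elim: k i H H' => [|k IH] i H H' HH' /=; first exact: HH'.
by apply: eq_bigr => j _; congr (_ * _)%E; apply: IH => s sk; apply: HH'; rewrite /= sk.
Qed.

Lemma le_path_mean k i H H' : (forall s, size s = k -> H s <= H' s)%E ->
  (path_mean k i H <= path_mean k i H')%E.
Proof.
elim: k i H H' => [|k IH] i H H' HH' /=; first exact: HH'.
apply: lee_sum => j _; rewrite lee_wpmul2l ?lee_fin//.
by apply: IH => s sk; apply: HH'; rewrite /= sk.
Qed.

Lemma path_meanZ k i H (c : R) : 0 <= c -> (forall s, 0 <= H s)%E ->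
  path_mean k i (fun s => c%:E * H s)%E = (c%:E * path_mean k i H)%E.
Proof.
move=> c0; elim: k i H => [|k IH] i H H0 //=.
rewrite ge0_sume_distrr => [|j _]; last first.
  by rewrite mule_ge0 ?lee_fin//; exact: path_mean_ge0.
by apply: eq_bigr => j _; rewrite IH// muleCA.
Qed.

Lemma path_mean_sum k i (I : finType) (H : I -> seq 'I_N.+1 -> \bar R) :
  (forall a s, 0 <= H a s)%E ->
  path_mean k i (fun s => \sum_a H a s)%E = (\sum_a path_mean k i (H a))%E.
Proof.
elim: k i H => [|k IH] i H H0 //=.
rewrite exchange_big/=; apply: eq_bigr => j _; rewrite IH//.
by rewrite ge0_sume_distrr// => a _; exact: path_mean_ge0.
Qed.

Lemma measurable_path_mean d (V : measurableType d) k i (H : V -> seq 'I_N.+1 -> \bar R) :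
  (forall s, measurable_fun setT (H ^~ s)) ->
  measurable_fun setT (fun v => path_mean k i (H v)).
Proof.
elim: k i H => [|k IH] i H mH /=; first exact: mH.
apply: emeasurable_sum => j; apply: emeasurable_funM; first exact: measurable_cst.
by apply: (IH j (fun v s => H v (j :: s))) => s; exact: mH.
Qed.

Lemma path_mean_integral d (V : measurableType d) (mu : {measure set V -> \bar R})
    k i (H : V -> seq 'I_N.+1 -> \bar R) :
  (forall v s, 0 <= H v s)%E -> (forall s, measurable_fun setT (H ^~ s)) ->
  (\int[mu]_v path_mean k i (H v) = path_mean k i (fun s => \int[mu]_v H v s))%E.
Proof.
move=> + mH; elim: k i H mH => [|k IH] i H mH H0 //=.
have mE j : measurable_fun setT (fun v => path_mean k j (fun s => H v (j :: s))).
  by apply: (@measurable_path_mean _ _ k j (fun v s => H v (j :: s))) => s; exact: mH.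
rewrite ge0_integral_sum//; last 2 first.
- by move=> j; apply: emeasurable_funM; [exact: measurable_cst|exact: mE].
- by move=> j v _; rewrite mule_ge0 ?lee_fin//; apply: path_mean_ge0.
apply: eq_bigr => j _; rewrite ge0_integralZl ?lee_fin//; last first.
  by move=> v _; exact: path_mean_ge0.
by congr (_ * _)%E; rewrite (IH j (fun v s => H v (j :: s))).
Qed.

End path_sums.

Section markov_paths.
Context d (T : measurableType d) (R : realType) (P : probability T R) (m N : nat).
Context (W : R -> T -> borelV R m) (La : R -> T -> stateS N) (i : 'I_N.+1).
Context (delta : R) (q : 'M[R]_N.+1).
Hypothesis W_meas : forall t, 0 <= t -> measurable_fun setT (W t).
Hypothesis La_meas : forall t, 0 <= t -> measurable_fun setT (La t).
Hypothesis indWL : independent_processes P W La.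
Hypothesis delta_gt0 : 0 < delta.
Hypothesis q_ge0 : forall i j, 0 <= q i j.
Hypothesis fdd : forall k (a : nat -> 'I_N.+1),
  P [set w | forall l, (l <= k)%N -> La (l%:R * delta) w = a l]
  = ((a 0%N == i)%:R * \prod_(l < k) q (a l) (a l.+1))%:E.

Let time_ge0 l : 0 <= l%:R * delta.
Proof. by rewrite mulr_ge0// ltW. Qed.

Definition process_events d1 (U1 : measurableType d1) (X : R -> T -> U1) : set (set T) :=
  [set A | exists t B, 0 <= t /\ measurable B /\ A = X t @^-1` B].

Lemma process_events_measurable d1 (U1 : measurableType d1) (X : R -> T -> U1) :
  (forall t, 0 <= t -> measurable_fun setT (X t)) ->
  <<s process_events X >> `<=` measurable.
Proof.
move=> mX; apply: smallest_sub; first exact: sigma_algebra_measurable.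
move=> _ [t [B [t0 [mB ->]]]]; rewrite -[X in measurable X]setTI; exact: mX.
Qed.

Lemma process_adapted d1 (U1 : measurableType d1) (X : R -> T -> U1) t : 0 <= t ->
  measurable_fun setT (X t : g_sigma_algebraType (process_events X) -> U1).
Proof.
by move=> t0 _ B mB; rewrite setTI; apply: sub_sigma_algebra; exists t, B.
Qed.

Lemma sub_adapted (G : set (set T)) d1 (U1 : measurableType d1) (f : T -> U1) :
  <<s G >> `<=` measurable ->
  measurable_fun setT (f : g_sigma_algebraType G -> U1) -> measurable_fun setT f.
Proof.
move=> Gm mf _ B mB; rewrite setTI; apply: Gm.
by have := mf measurableT B mB; rewrite setTI.
Qed.

Definition path_event (s : seq 'I_N.+1) : set T :=
  [set w | forall l, (l <= size s)%N -> La (l%:R * delta) w = nth i (i :: s) l].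

Lemma path_event_sigma s : <<s process_events La >> (path_event s).
Proof.
pose TL := g_sigma_algebraType (process_events La).
have -> : path_event s = \bigcap_(l in `I_(size s).+1)
    (La (l%:R * delta) @^-1` [set (nth i (i :: s) l : stateS N)]).
  by apply/seteqP; split => w H l; have := H l.
apply: (@fin_bigcap_measurable _ TL _ `I_(size s).+1) => [|l _]; first exact: finite_II.
by apply: sub_sigma_algebra; exists (l%:R * delta), [set (nth i (i :: s) l : stateS N)].
Qed.

Lemma measurable_path_event s : measurable (path_event s).
Proof. exact: (process_events_measurable La_meas (path_event_sigma s)). Qed.

Lemma path_event_nil : P (path_event [::]) = 1%E.
Proof.
have := fdd 0 (fun=> i); rewrite eqxx mul1r big_ord0 => <-; congr (P _).
by apply/seteqP; split => w /= H l; rewrite leqn0 => /eqP ->; apply: H.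
Qed.

Lemma path_event_rcons s j :
  P (path_event (rcons s j)) = (P (path_event s) * (q (last i s) j)%:E)%E.
Proof.
rewrite (fdd (size (rcons s j)) (nth i (i :: rcons s j))) /=.
rewrite (fdd (size s) (nth i (i :: s))) /=.
rewrite !eqxx !mul1r -EFinM size_rcons big_ord_recr/=.
congr ((_ * q _ _)%:E).
- apply: eq_bigr => -[l ls] _ /=; rewrite nth_rcons ls.
  by case: l ls => //= l ls; rewrite nth_rcons (ltnW ls).
- case: (lastP s) => [|s' k] /=; first by [].
  by rewrite size_rcons/= last_rcons nth_rcons size_rcons leqnn nth_rcons ltnn eqxx.
- by rewrite nth_rcons ltnn eqxx.
Qed.

Lemma path_event_split s w : (\1_(path_event s) w : R)
  = \sum_j \1_(path_event (rcons s j)) w.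
Proof.
pose j0 : 'I_N.+1 := La ((size s).+1%:R * delta) w.
have E j : path_event (rcons s j) w <-> path_event s w /\ j = j0.
  rewrite /path_event/= size_rcons; split => [H|[H ->] l].
    split; last first.
      by have := H (size s).+1 (leqnn _); rewrite /= nth_rcons ltnn eqxx.
    move=> l ls; rewrite H; last exact: leq_trans ls (leqnSn _).
    by case: l ls => //= l ls; rewrite nth_rcons ls.
  rewrite leq_eqVlt => /orP[/eqP ->|]; first by rewrite /= nth_rcons ltnn eqxx.
  rewrite ltnS => ls; rewrite H//; case: l ls => //= l ls.
  by rewrite nth_rcons ls.
rewrite (bigD1 j0)//= big1 ?addr0 => [|j jj0].
  rewrite !indicE; congr (_%:R); congr nat_of_bool; apply/idP/idP; rewrite !inE => H.
    by apply/E.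
  by have [] := (E j0).1 H.
rewrite indicE memNset// => /E[_ jE].
by rewrite jE eqxx in jj0.
Qed.

Definition next_states r k w : seq 'I_N.+1 :=
  [seq La (l%:R * delta) w | l <- iota r.+1 k].

Lemma size_next_states r k w : size (next_states r k w) = k.
Proof. by rewrite size_map size_iota. Qed.

Lemma measurable_next_states r k d1 (V : measurableType d1)
    (G : seq 'I_N.+1 -> T -> V) :
  (forall s, measurable_fun setT (G s)) ->
  measurable_fun setT (fun w => G (next_states r k w) w).
Proof.
elim: k r G => [|k IH] r G mG; first exact: mG.
pose H (z : T * stateS N) := G (z.2 :: next_states r.+1 k z.1) z.1.
have mH : measurable_fun setT H.
  apply: measurable_fun_state => j.
  by apply: (IH r.+1 (fun s => G (j :: s))) => s; exact: mG.
have mw : measurable_fun setT (fun w => (w, La (r.+1%:R * delta) w)).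
  by apply: measurable_fun_pair => //; exact: La_meas.
exact: (measurableT_comp mH mw).
Qed.

(** The process [W] generates one sigma-algebra and the chain another; the identity
    maps to the space with either of them are independent variables. *)
Lemma path_event_indep (s : seq 'I_N.+1) (f : T -> \bar R) :
  measurable_fun setT (f : g_sigma_algebraType (process_events W) -> \bar R) ->
  (forall w, 0 <= f w)%E ->
  (\int[P]_w (f w * (\1_(path_event s) w)%:E) = P (path_event s) * \int[P]_w f w)%E.
Proof.
move=> mf f0.
pose TW := g_sigma_algebraType (process_events W).
pose TL := g_sigma_algebraType (process_events La).
have Wm := process_events_measurable W_meas.
have Lm := process_events_measurable La_meas.
have m1 : measurable_fun setT (id : T -> TW) by exact: (sub_adapted (f := id : TW -> TW) Wm).
have m2 : measurable_fun setT (id : T -> TL) by exact: (sub_adapted (f := id : TL -> TL) Lm).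
pose g (z : TW * TL) : \bar R := (f z.1 * (\1_(path_event s) z.2)%:E)%E.
have mI : measurable_fun setT (fun w : TL => (\1_(path_event s) w)%:E : \bar R).
  by apply/measurable_EFinP/measurable_indic; exact: path_event_sigma.
have mg : measurable_fun setT g.
  by apply: emeasurable_funM; [exact: (measurableT_comp mf)|exact: (measurableT_comp mI)].
have g0 z : (0 <= g z)%E by rewrite mule_ge0// lee_fin.
have mfT : measurable_fun setT f by exact: sub_adapted Wm mf.
have c0 : (0 <= \int[P]_w f w)%E by apply: integral_ge0.
have ind (B1 : set TW) (B2 : set TL) : measurable B1 -> measurable B2 ->
    P (id @^-1` B1 `&` id @^-1` B2) = (P (id @^-1` B1) * P (id @^-1` B2))%E.
  by move=> mB1 mB2; exact: indWL.
rewrite (@integral_indep _ _ _ P _ _ TW TL id id m1 m2 ind g)//.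
transitivity (\int[P]_w ((\int[P]_w f w) * (\1_(path_event s) w)%:E))%E.
  apply: eq_integral => w _; rewrite /g/=.
  rewrite ge0_integralZr ?lee_fin//; first last.
  by rewrite (integral_law P m1).
rewrite ge0_integralZl//.
  by rewrite integral_indic ?setIT 1?muleC//; exact: measurable_path_event.
by apply/measurable_EFinP/measurable_indic; exact: measurable_path_event.
Qed.

(** Induction on the number of states still to come: the event of the path so far is
    split according to the next state, whose conditional law is a row of [q]. *)
Lemma path_expectation_from (G : seq 'I_N.+1 -> T -> \bar R) k s :
  (forall s, measurable_fun setT (G s : g_sigma_algebraType (process_events W) -> \bar R)) ->
  (forall s w, 0 <= G s w)%E ->
  (\int[P]_w (G (s ++ next_states (size s) k w) w * (\1_(path_event s) w)%:E)
   = P (path_event s) * path_mean q k (last i s) (fun s' => \int[P]_w G (s ++ s') w))%E.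
Proof.
move=> mG G0; have mGT s' : measurable_fun setT (G s').
  exact: sub_adapted (process_events_measurable W_meas) (mG s').
elim: k s => [|k IH] s /=.
  by rewrite cats0; exact: path_event_indep.
transitivity (\sum_j \int[P]_w (G (rcons s j ++ next_states (size (rcons s j)) k w) w
    * (\1_(path_event (rcons s j)) w)%:E))%E.
  rewrite -ge0_integral_sum//; last 2 first.
  - move=> j; apply: emeasurable_funM.
      by apply: (@measurable_next_states _ _ _ _ (fun s' => G (rcons s j ++ s'))).
    by apply/measurable_EFinP/measurable_indic; exact: measurable_path_event.
  - by move=> j w _; rewrite mule_ge0// lee_fin.
  apply: eq_integral => w _; rewrite path_event_split -sumEFin ge0_sume_distrr; last first.
    by move=> j _; rewrite lee_fin.
  apply: eq_bigr => j _; rewrite indicE.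
  have [|] := boolP (w \in path_event (rcons s j)); last by rewrite !mule0.
  rewrite inE /path_event/= size_rcons => H; rewrite !mule1 /next_states/=.
  have := H (size s).+1 (leqnn _); rewrite /= nth_rcons ltnn eqxx => ->.
  by rewrite cat_rcons.
rewrite ge0_sume_distrr; last first.
  move=> j _; rewrite mule_ge0 ?lee_fin//; apply: path_mean_ge0 => // s'.
  by apply: integral_ge0.
apply: eq_bigr => j _; rewrite IH path_event_rcons last_rcons muleA.
congr (_ * _)%E; apply: eq_path_mean => s' _.
by apply: eq_integral => w _; rewrite cat_rcons.
Qed.

(** The chain is at [i] at time [0] only almost surely. *)
Lemma ae_start (f g : T -> \bar R) : measurable_fun setT f -> measurable_fun setT g ->
  (forall w, 0 <= f w)%E -> (forall w, 0 <= g w)%E ->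
  (forall w, La 0 w = i -> f w = g w) -> (\int[P]_w f w = \int[P]_w g w)%E.
Proof.
move=> mf mg f0 g0 fg; apply: ge0_ae_eq_integral => //.
exists (~` path_event [::]); split.
- by apply: measurableC; exact: measurable_path_event.
- transitivity (1 - P (path_event [::]))%E; last by rewrite path_event_nil subee.
  exact: probability_setC (measurable_path_event _).
move=> w /= H H'; apply: H => _; apply: fg.
by have := H' 0%N isT; rewrite /= mul0r.
Qed.

Lemma path_expectation (G : seq 'I_N.+1 -> T -> \bar R) k :
  (forall s, measurable_fun setT (G s : g_sigma_algebraType (process_events W) -> \bar R)) ->
  (forall s w, 0 <= G s w)%E ->
  (\int[P]_w G (next_states 0 k w) w = path_mean q k i (fun s => \int[P]_w G s w))%E.
Proof.
move=> mG G0.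
have := path_expectation_from k [::] mG G0; rewrite path_event_nil mul1e /= => <-.
have mGT : measurable_fun setT (fun w => G (next_states 0 k w) w).
  apply: measurable_next_states => s.
  exact: sub_adapted (process_events_measurable W_meas) (mG s).
apply: ae_start => //.
- apply: emeasurable_funM => //.
  by apply/measurable_EFinP/measurable_indic; exact: measurable_path_event.
- by move=> w; rewrite mule_ge0// lee_fin.
move=> w w0; rewrite indicE mem_set ?mule1//= => l.
by rewrite leqn0 => /eqP ->; rewrite mul0r.
Qed.

End markov_paths.

(** * Merging of integrals *)

Section squeeze.
Context d (V : measurableType d) (R : realType) (mu : probability V R).

Lemma bounded_integral_fin_num (f : V -> \bar R) : (forall v, 0 <= f v <= 1)%E ->
  measurable_fun setT f -> (\int[mu]_v f v \is a fin_num)%E.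
Proof.
move=> f01 mf; rewrite ge0_fin_numE; last first.
  by apply: integral_ge0 => v _; have /andP[] := f01 v.
apply: (@le_lt_trans _ _ (\int[mu]_v (cst 1 v))%E).
  apply: ge0_le_integral => //; first by move=> v _; have /andP[] := f01 v.
  by move=> v _; have /andP[] := f01 v.
by rewrite integral_cst// [X in (_ * X)%E]probability_setT mule1 ltry.
Qed.

(** As the functions are bounded, the excess [C k] over [A] can be truncated at [1];
    it is then dominated and its integral tends to [0]. *)
Lemma integral_squeeze (f g : nat -> V -> \bar R) :
  (forall k v, 0 <= f k v <= 1)%E -> (forall k v, 0 <= g k v <= 1)%E ->
  (forall k, measurable_fun setT (f k)) -> (forall k, measurable_fun setT (g k)) ->
  (forall A, 0 < A -> exists C : nat -> V -> R,
     [/\ forall k, measurable_fun setT (C k), forall k v, 0 <= C k v,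
        forall v, C k v @[k --> \oo] --> (0 : R),
        forall k v, (f k v <= g k v + (A + C k v)%:E)%E &
        forall k v, (g k v <= f k v + (A + C k v)%:E)%E]) ->
  fine (\int[mu]_v f k v)%E - fine (\int[mu]_v g k v)%E @[k --> \oo] --> (0 : R).
Proof.
move=> f01 g01 mf mg H.
apply/cvgrPdist_le => e e0.
have e2 : 0 < e / 2 by rewrite divr_gt0.
have [C [mC C0 Ccvg fC gC]] := H _ e2.
pose M k v : R := Num.min 1 (C k v).
have M0 k v : 0 <= M k v by rewrite le_min C0 ler01.
have M1 k v : M k v <= 1 by rewrite ge_min lexx.
have mM k : measurable_fun setT (M k).
  by apply: measurable_minr => //; exact: measurable_cst.
have mME k : measurable_fun setT (fun v => (M k v)%:E) by exact/measurable_EFinP.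
have Mcvg : (\int[mu]_v (M k v)%:E @[k --> \oo] --> 0)%E.
  have -> : (0 = \int[mu]_v (cst 0 v))%E by rewrite integral_cst// mul0e.
  apply: (@dominated_cvg _ _ _ mu setT measurableT _ _ (cst 1%E)) => //.
  - move=> v _; apply: cvg_EFin; first by apply: nearW.
    have nr : \forall k \near \oo, cst 0 k <= (fine \o (fun k => (M k v)%:E)) k <= C k v.
      by apply: nearW => k /=; rewrite M0/= /M ge_min lexx orbT.
    exact: (squeeze_cvgr nr (cvg_cst _) (Ccvg v)).
  - exact: finite_measure_integrable_cst.
  - by move=> k v _; rewrite gee0_abs lee_fin.
have bnd (f1 g1 : nat -> V -> \bar R) k : (forall k v, 0 <= f1 k v <= 1)%E ->
    (forall k v, 0 <= g1 k v <= 1)%E ->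
    (forall k, measurable_fun setT (f1 k)) -> (forall k, measurable_fun setT (g1 k)) ->
    (forall k v, (f1 k v <= g1 k v + (e / 2 + C k v)%:E)%E) ->
    fine (\int[mu]_v f1 k v)%E <= fine (\int[mu]_v g1 k v)%E + (e / 2 + fine (\int[mu]_v (M k v)%:E)%E).
  move=> f1b g1b mf1 mg1 fg.
  have If := bounded_integral_fin_num (f1b k) (mf1 k).
  have Ig := bounded_integral_fin_num (g1b k) (mg1 k).
  have IM : (\int[mu]_v (M k v)%:E)%E \is a fin_num.
    by apply: bounded_integral_fin_num => // v; rewrite !lee_fin M0 M1.
  rewrite -lee_fin !EFinD !fineK//.
  have -> : ((e / 2)%:E = \int[mu]_v (cst (e / 2)%:E v))%E.
    by rewrite integral_cst// [X in (_ * X)%E]probability_setT mule1.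
  have g0 v : (0 <= g1 k v)%E by have /andP[] := g1b k v.
  have e20 : (0 <= (e / 2)%:E :> \bar R)%E by rewrite lee_fin ltW.
  rewrite -ge0_integralD//; last by move=> v _; rewrite lee_fin.
  rewrite -ge0_integralD//; last 2 first.
  - by move=> v _; rewrite adde_ge0// lee_fin.
  - by apply: emeasurable_funD => //; exact: measurable_cst.
  apply: ge0_le_integral => //.
  - by move=> v _; have /andP[] := f1b k v.
  - by apply: emeasurable_funD => //; apply: emeasurable_funD => //; exact: measurable_cst.
  move=> v _; have [C1|C1] := leP (C k v) 1.
    by rewrite /M (min_idPr C1) -EFinD.
  rewrite /M (min_idPl (ltW C1)).
  have /andP[_ f1le] := f1b k v; apply: le_trans f1le _.
  by rewrite -EFinD -[leLHS]add0e leeD// lee_fin lerDr (ltW e2).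
have : \forall k \near \oo, fine (\int[mu]_v (M k v)%:E)%E <= e / 2.
  have /fine_cvgP[_ /cvgrPdist_le /(_ _ e2)] := Mcvg.
  by apply: filterS => k /=; rewrite sub0r normrN => /(le_trans (ler_norm _)).
apply: filterS => k Mk; rewrite sub0r normrN ler_norml.
have := bnd f g k f01 g01 mf mg fC; have := bnd g f k g01 f01 mg mf gC.
move: Mk; move: (fine (\int[mu]_v f k v)%E) (fine (\int[mu]_v g k v)%E) (fine (\int[mu]_v (M k v)%:E)%E) => a c M' *.
apply/andP; split; lra.
Qed.

End squeeze.

(** * The transfer operator of the switched chain *)

Section transition.
Context du (U : measurableType du) (R : realType) (m N : nat).
Context (F : 'I_N.+1 -> U -> borelV R m -> U).
Hypothesis mF : forall j, measurable_fun setT (fun z : U * borelV R m => F j z.1 z.2).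
Context (gam : probability (borelV R m) R) (q : 'I_N.+1 -> 'I_N.+1 -> R).
Hypothesis q_ge0 : forall i j, 0 <= q i j.
Implicit Types (h : U * stateS N -> \bar R).

(** Expectation of [h] after one step of the chain made of the point and the state. *)
Definition transfer h (z : U * stateS N) : \bar R :=
  (\sum_j (q z.2 j)%:E * map_mean F gam z.2 (fun y => h (y, j : stateS N)) z.1)%E.

Let measurable_section h (j : stateS N) : measurable_fun setT h ->
  measurable_fun setT (fun y => h (y, j)).
Proof.
move=> mh; apply: (measurableT_comp mh).
by apply: measurable_fun_pair.
Qed.

Lemma transfer_ge0 h z : (forall z, 0 <= h z)%E -> (0 <= transfer h z)%E.
Proof.
move=> h0; apply: sume_ge0 => j _; rewrite mule_ge0 ?lee_fin//.
exact: map_mean_ge0.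
Qed.

Lemma measurable_transfer h : measurable_fun setT h -> (forall z, 0 <= h z)%E ->
  measurable_fun setT (transfer h).
Proof.
move=> mh h0; apply: measurable_fun_state => i; rewrite /transfer/=.
apply: emeasurable_sum => j; apply: emeasurable_funM; first exact: measurable_cst.
by apply: measurable_map_mean => //; exact: measurable_section.
Qed.

Lemma iter_transfer_ge0 k h z : (forall z, 0 <= h z)%E -> (0 <= iter k transfer h z)%E.
Proof. by move=> h0; elim: k z => //= k IH z; exact: transfer_ge0. Qed.

Lemma measurable_iter_transfer k h : measurable_fun setT h -> (forall z, 0 <= h z)%E ->
  measurable_fun setT (iter k transfer h).
Proof.
move=> mh h0; elim: k => //= k IH; apply: measurable_transfer => // z.
exact: iter_transfer_ge0.
Qed.

Lemma iter_transferE k h x (i : stateS N) : measurable_fun setT h -> (forall z, 0 <= h z)%E ->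
  iter k transfer h (x, i) = path_mean q k i (fun s =>
    run_mean F gam (belast i s) (fun y => h (y, last i s : stateS N)) x).
Proof.
move=> mh h0; elim: k x i => [|k IH] x i //=.
rewrite {1}/transfer/=; apply: eq_bigr => j _; congr (_ * _)%E.
rewrite /map_mean -(@path_mean_integral _ _ _ q_ge0 _ _ gam k j (fun e s =>
   run_mean F gam (belast j s) (fun y => h (y, last j s : stateS N)) (F i x e))).
- by apply: eq_integral => e _; exact: IH.
- by move=> e s; exact: run_mean_ge0.
move=> s; have mK := measurable_run_mean mF gam (belast j s) (measurable_section (last j s) mh)
  (fun y => h0 _).
have me : measurable_fun setT (fun e => F i x e) by exact: measurable_step.
exact: (measurableT_comp mK me).
Qed.

Lemma map_meanZsum j (I : finType) (c : I -> R) (g : I -> U -> \bar R) x :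
  (forall i, 0 <= c i) -> (forall i y, 0 <= g i y)%E ->
  (forall i, measurable_fun setT (g i)) ->
  map_mean F gam j (fun y => \sum_i (c i)%:E * g i y)%E x
  = (\sum_i (c i)%:E * map_mean F gam j (g i) x)%E.
Proof.
move=> c0 g0 mg; rewrite /map_mean.
have me : measurable_fun setT (fun e => F j x e) by exact: measurable_step.
have mge i : measurable_fun setT (fun e => g i (F j x e)).
  exact: (measurableT_comp (mg i) me).
rewrite ge0_integral_sum//; last 2 first.
- by move=> i; apply: emeasurable_funM => //; exact: measurable_cst.
- by move=> i y _; rewrite mule_ge0 ?lee_fin.
by apply: eq_bigr => i _; rewrite ge0_integralZl ?lee_fin.
Qed.

Lemma bwd_meanZsum s (I : finType) (c : I -> R) (g : I -> U -> \bar R) x :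
  (forall i, 0 <= c i) -> (forall i y, 0 <= g i y)%E ->
  (forall i, measurable_fun setT (g i)) ->
  bwd_mean F gam s (fun y => \sum_i (c i)%:E * g i y)%E x
  = (\sum_i (c i)%:E * bwd_mean F gam s (g i) x)%E.
Proof.
move=> c0; elim: s g => [|j s IH] g g0 mg //=.
rewrite -(IH (fun i => map_mean F gam j (g i))).
- congr bwd_mean; apply/funext => y; exact: map_meanZsum.
- by move=> i y; exact: map_mean_ge0.
- by move=> i; exact: measurable_map_mean.
Qed.

(** By detailed balance the path of the chain started from [pi] read in reverse has
    the same law.  Composing the maps backwards along a path is composing
    them forwards along the reversed one. *)
Lemma backward_forward (pi : 'I_N.+1 -> R) k h x :
  (forall i, 0 <= pi i) -> (forall i j, pi i * q i j = pi j * q j i) ->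
  measurable_fun setT h -> (forall z, 0 <= h z)%E ->
  (\sum_i (pi i)%:E * path_mean q k i (fun s => bwd_mean F gam s (fun y => h (y, i : stateS N)) x)
   = \sum_j (pi j)%:E * iter k transfer h (x, j : stateS N))%E.
Proof.
move=> pi0 rev; elim: k h => [|k IH] h mh h0 //=.
have -> : transfer (iter k transfer h) = iter k transfer (transfer h) by rewrite -iterS iterSr.
rewrite -IH; last 2 first.
- exact: measurable_transfer.
- by move=> z; exact: transfer_ge0.
have H0 (i j : stateS N) s : (0 <= bwd_mean F gam s (map_mean F gam j (fun y => h (y, i))) x)%E.
  by apply: bwd_mean_ge0 => y; exact: map_mean_ge0.
transitivity (\sum_i \sum_j ((pi j * q j i)%:E * path_mean q k j (fun s =>
    bwd_mean F gam s (map_mean F gam j (fun y => h (y, i : stateS N))) x)))%E.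
  apply: eq_bigr => i _; rewrite ge0_sume_distrr => [|j _]; last first.
    by rewrite mule_ge0 ?lee_fin//; exact: path_mean_ge0.
  by apply: eq_bigr => j _; rewrite muleA -EFinM rev.
rewrite exchange_big/=; apply: eq_bigr => j _.
under eq_bigr do rewrite EFinM -muleA.
rewrite -ge0_sume_distrr => [|i _]; last first.
  by rewrite mule_ge0 ?lee_fin//; exact: path_mean_ge0.
congr (_ * _)%E.
under eq_bigr do rewrite -(path_meanZ q_ge0)//.
rewrite -(path_mean_sum q_ge0) => [|i s]; last by rewrite mule_ge0 ?lee_fin.
apply: eq_path_mean => s _; rewrite -bwd_meanZsum//.
- by move=> i y; exact: map_mean_ge0.
- by move=> i; apply: measurable_map_mean => //; exact: measurable_section.
Qed.

Hypothesis q_sum1 : forall i, \sum_j q i j = 1.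

Lemma transfer_le1 h z : measurable_fun setT h -> (forall z, 0 <= h z <= 1)%E -> (transfer h z <= 1)%E.
Proof.
move=> mh h01; have h0 z' : (0 <= h z')%E by have /andP[] := h01 z'.
have K1 (j : stateS N) : (map_mean F gam z.2 (fun y => h (y, j)) z.1 <= 1)%E.
  apply: (@le_trans _ _ (\int[gam]_e (cst 1%E e))%E).
    apply: ge0_le_integral => //.
    - have me : measurable_fun setT (fun e => F z.2 z.1 e) by exact: measurable_step.
      exact: (measurableT_comp (measurable_section j mh) me).
    - by move=> e _; have /andP[] := h01 (F z.2 z.1 e, j).
  by rewrite integral_cst// [X in (_ * X)%E]probability_setT mule1.
apply: (@le_trans _ _ (\sum_j (q z.2 j)%:E * 1)%E).
  by apply: lee_sum => j _; rewrite lee_wpmul2l ?lee_fin.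
under eq_bigr do rewrite mule1.
by rewrite sumEFin q_sum1.
Qed.

Lemma iter_transfer_01 k h z : measurable_fun setT h -> (forall z, 0 <= h z <= 1)%E ->
  (0 <= iter k transfer h z <= 1)%E.
Proof.
move=> mh h01; have h0 z' : (0 <= h z')%E by have /andP[] := h01 z'.
elim: k z => [|k IH] z //=; rewrite transfer_ge0 ?transfer_le1//.
  exact: measurable_iter_transfer.
by move=> z'; exact: iter_transfer_ge0.
Qed.

Variables (cost : U -> U -> R) (c xi : 'I_N.+1 -> R) (rho : R).
Hypothesis cost_ge0 : forall x y, 0 <= cost x y.
Hypothesis mcost : measurable_fun setT (fun z : U * U => cost z.1 z.2).
Hypothesis c_ge0 : forall i, 0 <= c i.
Hypothesis contraction : forall i x y,
  (\int[gam]_e (cost (F i x e) (F i y e))%:E <= (c i * cost x y)%:E)%E.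
Hypothesis xi_gt0 : forall i, 0 < xi i.
Hypothesis rate : forall i, c i * (\sum_j q i j * xi j) <= rho * xi i.

(** A one-sided modulus of continuity that is linear in [h], hence carried by
    averages; [A] absorbs the gap between the quadratic cost and a Lipschitz
    bound. *)
Definition modulus (A B : R) h := forall (i : stateS N) x y,
  (h (x, i) <= h (y, i) + (A + B * xi i * cost x y)%:E)%E.

Let measurable_cost_at (f g : borelV R m -> U) : measurable_fun setT f -> measurable_fun setT g ->
  measurable_fun setT (fun e => (cost (f e) (g e))%:E).
Proof.
move=> mf mg; apply/measurable_EFinP.
exact: (measurableT_comp mcost (measurable_fun_pair mf mg)).
Qed.

(** A step in state [i] multiplies the mean cost by [c i], while the weight [xi] is
    averaged by [q]: the product is controlled by [rate]. *)
Lemma modulus_transfer A B h : 0 <= A -> 0 <= B -> measurable_fun setT h ->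
  (forall z, 0 <= h z)%E -> modulus A B h -> modulus A (rho * B) (transfer h).
Proof.
move=> A0 B0 mh h0 hAB i x y; rewrite /transfer/=.
have mFx z : measurable_fun setT (fun e => F i z e) by exact: measurable_step.
have mhF (j : stateS N) z : measurable_fun setT (fun e => h (F i z e, j)).
  exact: (measurableT_comp (measurable_section j mh) (mFx z)).
have mc := measurable_cost_at (mFx x) (mFx y).
have K (j : stateS N) : (map_mean F gam i (fun y0 => h (y0, j)) x <=
    map_mean F gam i (fun y0 => h (y0, j)) y + (A + B * xi j * (c i * cost x y))%:E)%E.
  have Bx : 0 <= B * xi j by rewrite mulr_ge0// ltW.
  pose C e := (cost (F i x e) (F i y e))%:E.
  have m1 : measurable_fun setT (fun e => (B * xi j)%:E * C e)%E.
    by apply: emeasurable_funM => //; exact: measurable_cst.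
  have m2 : measurable_fun setT (fun e => A%:E + (B * xi j)%:E * C e)%E.
    by apply: emeasurable_funD => //; exact: measurable_cst.
  have p0 e : (0 <= C e)%E by rewrite lee_fin.
  have p1 e : (0 <= (B * xi j)%:E * C e)%E by rewrite mule_ge0 ?lee_fin.
  have pA : (0 <= A%:E :> \bar R)%E by rewrite lee_fin.
  have p2 e : (0 <= A%:E + (B * xi j)%:E * C e)%E by exact: adde_ge0.
  apply: (@le_trans _ _ (\int[gam]_e (h (F i y e, j) + (A%:E + (B * xi j)%:E * C e)))%E).
    apply: ge0_le_integral => //.
    - by apply: emeasurable_funD.
  rewrite ge0_integralD//= leeD2l// ge0_integralD//=.
  rewrite integral_cst// [X in (A%:E * X)%E]probability_setT mule1 EFinD leeD2l//.
  rewrite ge0_integralZl ?lee_fin// [leRHS]EFinM lee_wpmul2l ?lee_fin//.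
  exact: contraction.
apply: (@le_trans _ _ (\sum_j (q i j)%:E * (map_mean F gam i (fun y0 => h (y0, j : stateS N)) y
    + (A + B * xi j * (c i * cost x y))%:E))%E).
  by apply: lee_sum => j _; rewrite lee_wpmul2l ?lee_fin//; exact: K.
have D0 (j : 'I_N.+1) : 0 <= A + B * xi j * (c i * cost x y).
  by rewrite addr_ge0// !mulr_ge0// ltW.
have -> : (\sum_j (q i j)%:E * (map_mean F gam i (fun y0 => h (y0, j : stateS N)) y
    + (A + B * xi j * (c i * cost x y))%:E)
  = \sum_j ((q i j)%:E * map_mean F gam i (fun y0 => h (y0, j : stateS N)) y
    + (q i j * (A + B * xi j * (c i * cost x y)))%:E))%E.
  apply: eq_bigr => j _; rewrite EFinM ge0_muleDr ?lee_fin//.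
  by apply: map_mean_ge0 => z.
rewrite big_split/= leeD2l// sumEFin lee_fin.
under eq_bigr do rewrite mulrDr.
rewrite big_split/= -mulr_suml q_sum1 mul1r lerD2l.
have -> : \sum_j q i j * (B * xi j * (c i * cost x y))
   = B * cost x y * (c i * \sum_j q i j * xi j).
  by rewrite !mulr_sumr; apply: eq_bigr => j _; ring.
apply: le_trans (ler_wpM2l _ (rate i)) _; first by rewrite mulr_ge0.
by rewrite le_eqVlt; apply/orP; left; apply/eqP; ring.
Qed.

Hypothesis rho01 : 0 <= rho < 1.

Lemma modulus_iter A B h k : 0 <= A -> 0 <= B -> measurable_fun setT h ->
  (forall z, 0 <= h z)%E -> modulus A B h -> modulus A (rho ^+ k * B) (iter k transfer h).
Proof.
move=> A0 B0 mh h0 hAB; have /andP[r0 _] := rho01.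
elim: k => [|k IH]; first by rewrite expr0 mul1r.
rewrite exprS -mulrA /=; apply: modulus_transfer => //.
- by rewrite mulr_ge0// exprn_ge0.
- exact: measurable_iter_transfer.
- by move=> z; exact: iter_transfer_ge0.
Qed.

(** A class that the transfer operator preserves and that is rich enough to
    determine a probability. *)
Definition test_function h := [/\ measurable_fun setT h, forall z, (0 <= h z <= 1)%E &
  forall A, 0 < A -> exists2 B, 0 <= B & modulus A B h].

Lemma test_function_iter k h : test_function h -> test_function (iter k transfer h).
Proof.
move=> [mh h01 hmod]; have h0 z' : (0 <= h z')%E by have /andP[] := h01 z'.
split; [exact: measurable_iter_transfer|by move=> z; exact: iter_transfer_01|].
move=> A A0; have [B B0 hB] := hmod A A0; exists (rho ^+ k * B).
  by rewrite mulr_ge0// exprn_ge0//; case/andP: rho01.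
by apply: modulus_iter => //; exact: ltW.
Qed.

(** The chain is started at the point [x], with a state drawn from [pi]. *)
Definition averaged (pi : 'I_N.+1 -> R) x h k : \bar R :=
  (\sum_j (pi j)%:E * iter k transfer h (x, j : stateS N))%E.

Lemma cost_decay B x0 (z : U * stateS N) :
  rho ^+ k * B * xi z.2 * (cost z.1 x0 + cost x0 z.1) @[k --> \oo] --> (0 : R).
Proof.
have -> : (fun k => rho ^+ k * B * xi z.2 * (cost z.1 x0 + cost x0 z.1))
   = (fun k => (B * xi z.2 * (cost z.1 x0 + cost x0 z.1)) * rho ^+ k).
  by apply/funext => k; ring.
rewrite -[X in _ --> X](mulr0 (B * xi z.2 * (cost z.1 x0 + cost x0 z.1))).
apply: cvgM; first exact: cvg_cst.
by apply: cvg_expr; case/andP: rho01 => r0 r1; rewrite ger0_norm.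
Qed.

(** The invariant law has marginal [pi] on the states, so it can be coupled with the
    chain started at [x0] without moving the states; [rho ^+ k] then kills the
    part of the modulus that depends on the distance to [x0]. *)
Lemma invariant_limit (nu : probability (U * stateS N)%type R) pi x0 h :
  (forall j, slice nu j setT = (pi j)%:E) ->
  (forall k, (\int[nu]_z iter k transfer h z = \int[nu]_z h z)%E) ->
  test_function h ->
  fine (averaged pi x0 h k) @[k --> \oo] --> fine (\int[nu]_z h z)%E.
Proof.
move=> nupi inv [mh h01 hmod]; have h0 z' : (0 <= h z')%E by have /andP[] := h01 z'.
pose f k := iter k transfer h.
pose g k (z : U * stateS N) := f k (x0, z.2).
have f01 k z : (0 <= f k z <= 1)%E by exact: iter_transfer_01.
have mf k : measurable_fun setT (f k) by exact: measurable_iter_transfer.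
have mg k : measurable_fun setT (g k).
  by apply: measurable_fun_state => j; exact: (measurable_cst (f k (x0, j))).
have gE k : (\int[nu]_z g k z = averaged pi x0 h k)%E.
  rewrite integral_slice//; last by move=> z; have /andP[] := f01 k (x0, z.2).
  apply: eq_bigr => j _; rewrite /g/= integral_cst// muleC.
  by congr (_ * _)%E; exact: nupi.
have /= := @integral_squeeze _ _ _ nu f g f01 (fun k z => f01 k (x0, z.2)) mf mg.
move=> /(_ _)/wrap[A A0|].
  have [B B0 hB] := hmod A A0.
  exists (fun k z => rho ^+ k * B * xi z.2 * (cost z.1 x0 + cost x0 z.1)).
  have /andP[r0 r1] := rho01.
  have rB k : 0 <= rho ^+ k * B by rewrite mulr_ge0// exprn_ge0.
  have rBx k (z : U * stateS N) : 0 <= rho ^+ k * B * xi z.2 by rewrite mulr_ge0// ltW.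
  split.
  - move=> k; apply: measurable_fun_state => j /=.
    apply: measurable_funM => //; apply: measurable_funD.
      exact: (measurableT_comp mcost (pair2_measurable x0)).
    exact: (measurableT_comp mcost (pair1_measurable x0)).
  - by move=> k z; rewrite mulr_ge0// addr_ge0.
  - by move=> z; exact: cost_decay.
  - move=> k [x i]; apply: le_trans (modulus_iter k (ltW A0) B0 mh h0 hB i x x0) _.
    by rewrite leeD2l// lee_fin lerD2l (ler_wpM2l (rBx k (x, i)))// lerDl.
  - move=> k [x i]; apply: le_trans (modulus_iter k (ltW A0) B0 mh h0 hB i x0 x) _.
    by rewrite leeD2l// lee_fin lerD2l (ler_wpM2l (rBx k (x, i)))// lerDr.
move=> H; have -> : (fun k => fine (averaged pi x0 h k)) =
  (fun k => fine (\int[nu]_z h z)%E - (fine (\int[nu]_z f k z)%E - fine (\int[nu]_z g k z)%E)).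
  by apply/funext => k; rewrite inv gE subKr.
rewrite -[X in _ --> X]subr0; apply: cvgB; first exact: cvg_cst.
exact: H.
Qed.

End transition.

(** * Test functions determine a law *)

Section determining_class.
Context (R : realType) (n N : nat) (xi : 'I_N.+1 -> R).
Hypothesis xi_gt0 : forall i, 0 < xi i.
Implicit Types (b x y : 'cV[R]_n).

Definition sqdist (x y : borelV R n) : R := hsnorm ((x : 'cV[R]_n) - (y : 'cV[R]_n)) ^+ 2.

Lemma sqdist_ge0 x y : 0 <= sqdist x y. Proof. exact: sqr_ge0. Qed.

Lemma measurable_sqdist :
  measurable_fun setT (fun z : borelV R n * borelV R n => sqdist z.1 z.2).
Proof.
have -> : (fun z : borelV R n * borelV R n => sqdist z.1 z.2)
   = (fun z => \sum_l ((z.1 : 'cV[R]_n) l 0 - (z.2 : 'cV[R]_n) l 0) ^+ 2).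
  apply/funext => z; rewrite /sqdist hsnorm_sqr_col.
  by apply: eq_bigr => l _; rewrite !mxE.
apply: measurable_sum => l; apply: measurable_funX; apply: measurable_funB.
  exact: (measurableT_comp (measurable_coord l) measurable_fst).
exact: (measurableT_comp (measurable_coord l) measurable_snd).
Qed.

Definition excess b x : R := \sum_l Num.max 0 (x l 0 - b l 0).

Lemma excess_ge0 b x : 0 <= excess b x.
Proof. by apply: sumr_ge0 => l _; rewrite le_max lexx. Qed.

Lemma excess_orthant b x : orthant b x -> excess b x = 0.
Proof.
by move=> bx; rewrite /excess big1// => l _; apply/max_idPl; rewrite subr_le0.
Qed.

Lemma excess_gt0 b x : ~ orthant b x -> 0 < excess b x.
Proof.
move=> /existsNP[l /negP]; rewrite -ltNge => bx.
rewrite /excess (bigD1 l)//= ltr_pwDl//; last first.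
  by apply: sumr_ge0 => k _; rewrite le_max lexx.
by rewrite lt_max subr_gt0 bx orbT.
Qed.

(** As [k] grows these functions decrease to the indicator of the orthant at [b]. *)
Definition bump b (k : nat) x : R := Num.max 0 (1 - k%:R * excess b x).

Lemma bump_ge0 b k x : 0 <= bump b k x.
Proof. by rewrite le_max lexx. Qed.

Lemma bump_le1 b k x : bump b k x <= 1.
Proof. by rewrite ge_max ler01 gerBl mulr_ge0// excess_ge0. Qed.

Lemma excess_lip b x y : excess b y <= excess b x + \sum_l `|x l 0 - y l 0|.
Proof.
rewrite /excess -big_split/=; apply: ler_sum => l _; rewrite ge_max.
have h1 : 0 <= Num.max 0 (x l 0 - b l 0) by rewrite le_max lexx.
have h2 : x l 0 - b l 0 <= Num.max 0 (x l 0 - b l 0) by rewrite le_max lexx orbT.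
have := ler_norm (- (x l 0 - y l 0)); rewrite normrN => h3.
have := normr_ge0 (x l 0 - y l 0); move=> h4.
by apply/andP; split; lra.
Qed.

Lemma bump_lip b k x y : bump b k x <= bump b k y + k%:R * \sum_l `|x l 0 - y l 0|.
Proof.
have S0 : 0 <= k%:R * \sum_l `|x l 0 - y l 0| :> R by rewrite mulr_ge0// sumr_ge0.
rewrite [leLHS]/bump ge_max addr_ge0 ?bump_ge0//=.
have : 1 - k%:R * excess b y <= bump b k y by rewrite le_max lexx orbT.
have := ler_wpM2l (ler0n R k) (excess_lip b x y); rewrite mulrDr; lra.
Qed.

(** The bump is Lipschitz, and [r * t <= A / p + r ^+ 2 * p / A * t ^+ 2] trades the
    distance for its square in each of the at most [p] coordinates. *)
Lemma bump_modulus b k A : 0 < A -> forall x y,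
  bump b k x <= bump b k y + (A + k%:R ^+ 2 * n.+1%:R / A * sqdist x y).
Proof.
move=> A0 x y; apply: le_trans (bump_lip b k x y) _; rewrite lerD2l.
have n0 : 0 < n.+1%:R :> R by rewrite ltr0n.
set r : R := k%:R; set p : R := n.+1%:R in n0 *.
have r0 : 0 <= r by rewrite ler0n.
apply: (@le_trans _ _ (\sum_(l < n) (A / p + r ^+ 2 * p / A * (x l 0 - y l 0) ^+ 2))).
  rewrite mulr_sumr; apply: ler_sum => l _.
  rewrite -[(x l 0 - y l 0) ^+ 2]real_normK ?num_real//.
  set t := `|_|; have t0 : 0 <= t by exact: normr_ge0.
  set u := r * t * p / A.
  have -> : A / p + r ^+ 2 * p / A * t ^+ 2 = (A / p) * (1 + u ^+ 2).
    by rewrite /u; field; rewrite !gt_eqF.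
  have -> : r * t = (A / p) * u by rewrite /u; field; rewrite !gt_eqF.
  apply: ler_wpM2l; first by rewrite divr_ge0// ltW.
  by have := sqr_ge0 (u - 1); have := sqr_ge0 u; rewrite sqrrB; lra.
rewrite big_split/= /sqdist hsnorm_sqr_col mulr_sumr lerD//.
  rewrite sumr_const card_ord -mulr_natr mulrAC ler_pdivrMr// ler_wpM2l ?(ltW A0)//.
  by rewrite ler_nat.
by apply: ler_sum => l _; rewrite !mxE.
Qed.

Lemma bump_cvg b x : bump b k x @[k --> \oo] --> (`[< orthant b x >]%:R : R).
Proof.
apply: cvg_near_cst; have [/asboolP bx|/asboolP bx] := boolP `[< orthant b x >].
  apply: nearW => k; rewrite /bump excess_orthant// mulr0 subr0.
  exact/max_idPr.
have e0 := excess_gt0 bx.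
near=> k; apply/max_idPl; rewrite subr_le0 -ler_pdivrMr//.
near: k; exact: nbhs_infty_ger.
Unshelve. all: by end_near. Qed.

Definition state_bump b (i : 'I_N.+1) k (z : borelV R n * stateS N) : \bar R :=
  ((z.2 == i :> 'I_N.+1)%:R * bump b k z.1)%:E.

Lemma state_bump01 b i k z : (0 <= state_bump b i k z <= 1)%E.
Proof.
rewrite /state_bump !lee_fin; case: eqP => _; rewrite ?mul1r ?mul0r ?lexx ?ler01//.
by rewrite bump_ge0 bump_le1.
Qed.

Lemma measurable_state_bump b i k : measurable_fun setT (state_bump b i k).
Proof.
apply: measurable_fun_state => j; apply/measurable_EFinP => /=.
apply: measurable_funM; first exact: measurable_cst.
apply: measurable_maxr; first exact: measurable_cst.
apply: measurable_funB; first exact: measurable_cst.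
apply: measurable_funM; first exact: measurable_cst.
apply: measurable_sum => l; apply: measurable_maxr; first exact: measurable_cst.
by apply: measurable_funB; [exact: measurable_coord|exact: measurable_cst].
Qed.

Lemma test_function_state_bump b i k : test_function sqdist xi (state_bump b i k).
Proof.
split; [exact: measurable_state_bump|exact: state_bump01|move=> A A0].
pose C := k%:R ^+ 2 * n.+1%:R / A : R.
have C0 : 0 <= C by rewrite divr_ge0 ?(ltW A0)// mulr_ge0// sqr_ge0.
exists (\sum_j C / xi j); first by apply: sumr_ge0 => j _; rewrite divr_ge0// ltW.
move=> j x y; rewrite /state_bump/= -EFinD lee_fin.
have CB : C <= (\sum_j C / xi j) * xi j.
  rewrite -ler_pdivrMr// (bigD1 (j : 'I_N.+1))//= lerDl.
  by apply: sumr_ge0 => l _; rewrite divr_ge0// ltW.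
have Cs := ler_wpM2r (sqdist_ge0 x y) CB.
case: eqP => _; rewrite ?mul0r ?mul1r.
  apply: le_trans (bump_modulus b k A0 x y) _; rewrite !lerD2l.
  exact: Cs.
have := mulr_ge0 C0 (sqdist_ge0 x y); lra.
Qed.

Lemma state_bump_integral (mu : probability (borelV R n * stateS N)%type R) b i :
  fine (\int[mu]_z state_bump b i k z)%E @[k --> \oo]
  --> fine (mu (orthant b `*` [set (i : stateS N)])).
Proof.
have mO : measurable (orthant b : set (borelV R n)).
  by rewrite borelV_orthant; apply: sub_sigma_algebra; exists b.
have mA : measurable ((orthant b : set (borelV R n)) `*` [set (i : stateS N)]).
  exact: measurableX.
set A := _ `*` _ in mA *.
have mI : measurable_fun setT (fun z : borelV R n * stateS N => (\1_A z)%:E : \bar R).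
  exact/measurable_EFinP/measurable_indic.
pose f k z := state_bump b i k z.
pose g (k : nat) (z : borelV R n * stateS N) : \bar R := (\1_A z)%:E.
have g01 k z : (0 <= g k z <= 1)%E.
  by rewrite /g !lee_fin indicE; case: (_ \in _); rewrite ?ler01 ?lexx.
have IE z : (\1_A z : R) = (z.2 == i :> 'I_N.+1)%:R * `[< orthant b z.1 >]%:R.
  rewrite indicE -natrM mulnb; congr (_%:R); congr nat_of_bool.
  apply/idP/andP => [|[/eqP z2 /asboolP z1]]; first by rewrite inE => -[z1 /= ->]; split; [exact: eqxx|exact/asboolP].
  by rewrite inE.
have H := @integral_squeeze _ _ _ mu f g (fun k => state_bump01 b i k) g01
  (fun k => measurable_state_bump b i k) (fun=> mI).
have -> : (fun k => fine (\int[mu]_z state_bump b i k z)%E) =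
  (fun k => fine (mu A) + (fine (\int[mu]_z f k z)%E - fine (\int[mu]_z g k z)%E)).
  apply/funext => k; have -> : (\int[mu]_z g k z = mu A)%E by rewrite /g integral_indic// setIT.
  by rewrite addrC subrK.
rewrite -[X in _ --> X]addr0; apply: cvgD; first exact: cvg_cst.
apply: H => e e0.
exists (fun k z => `|fine (state_bump b i k z) - \1_A z|); split => //.
- move=> k; apply: measurableT_comp => //; apply: measurable_funB; last exact: measurable_indic.
  by apply/measurable_EFinP; exact: measurable_state_bump.
- move=> z; rewrite -[X in _ --> X](normr0 R) -(subrr (\1_A z : R)).
  apply: cvg_norm; apply: cvgB; last exact: cvg_cst.
  rewrite IE /state_bump/=; apply: cvgM; first exact: cvg_cst.
  exact: bump_cvg.
- move=> k z; rewrite /f /g /state_bump -EFinD lee_fin/=.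
  by have := ler_norm ((z.2 == i :> 'I_N.+1)%:R * bump b k z.1 - \1_A z); lra.
- move=> k z; rewrite /f /g /state_bump -EFinD lee_fin/= distrC.
  by have := ler_norm (\1_A z - (z.2 == i :> 'I_N.+1)%:R * bump b k z.1); lra.
Qed.

Lemma test_functions_determine (mu nu : probability (borelV R n * stateS N)%type R) :
  (forall h, test_function sqdist xi h -> (\int[mu]_z h z = \int[nu]_z h z)%E) ->
  forall A, measurable A -> mu A = nu A.
Proof.
move=> H; apply: state_measure_eq => b j.
have mO : measurable ((orthant b : set (borelV R n)) `*` [set (j : stateS N)]).
  apply: measurableX => //.
  by rewrite borelV_orthant; apply: sub_sigma_algebra; exists b.
rewrite -[LHS]fineK ?fin_num_measure// -[RHS]fineK ?fin_num_measure//; congr EFin.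
have := @state_bump_integral mu b j.
under eq_fun do rewrite (H _ (test_function_state_bump b j _)).
move=> h1; exact: (norm_cvg_unique h1 (@state_bump_integral nu b j)).
Qed.

End determining_class.

(** * Almost sure convergence from geometric increments *)

Lemma cvg_sumr (R : realType) (I : Type) (r : seq I) (f : nat -> I -> R) (a : I -> R) :
  (forall i, f k i @[k --> \oo] --> a i) ->
  \sum_(i <- r) f k i @[k --> \oo] --> \sum_(i <- r) a i.
Proof.
move=> H; elim: r => [|i r IH].
  by under eq_fun do rewrite big_nil; rewrite big_nil; exact: cvg_cst.
by under eq_fun do rewrite big_cons; rewrite big_cons; exact: cvgD.
Qed.

Section geometric_limit.
Context d (T : measurableType d) (R : realType) (P : probability T R) (n : nat).
Variables (X : nat -> T -> borelV R n) (D rho : R).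
Hypothesis mX : forall k, measurable_fun setT (X k).
Hypothesis rho01 : 0 < rho < 1.
Hypothesis step : forall k,
  (\int[P]_w (sqdist (X k.+1 w) (X k w))%:E <= (D * rho ^+ k)%:E)%E.

Let s := Num.sqrt rho.
Let s0 : 0 < s. Proof. by rewrite sqrtr_gt0; case/andP: rho01. Qed.
Let s1 : s < 1.
Proof.
case/andP: rho01 => r0 r1.
by rewrite -(@ltr_pXn2r _ 2) ?nnegrE ?(ltW s0)// sqr_sqrtr ?(ltW r0)// expr1n.
Qed.
Let s2 : s ^+ 2 = rho.
Proof. by rewrite sqr_sqrtr// ltW//; case/andP: rho01. Qed.

(** Dominates the distance of consecutive terms by [t <= a + t ^+ 2 / a], with
    [a = s ^+ k] chosen so that both terms have a geometric mean. *)
Let jump k w : R := s ^+ k + sqdist (X k.+1 w) (X k w) / s ^+ k.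

Let sk_gt0 k : 0 < s ^+ k. Proof. by rewrite exprn_gt0. Qed.

Let jump_ge0 k w : 0 <= jump k w.
Proof. by rewrite addr_ge0 ?divr_ge0 ?sqdist_ge0 ?ltW. Qed.

Let coord_le_jump k w l :
  `|(X k.+1 w : 'cV[R]_n) l 0 - (X k w : 'cV[R]_n) l 0| <= jump k w.
Proof.
have := le_hsnorm_entry ((X k.+1 w : 'cV[R]_n) - (X k w : 'cV[R]_n)) l 0.
rewrite !mxE => /le_trans; apply; rewrite /jump /sqdist.
set t := hsnorm _; have t0 : 0 <= t by exact: hsnorm_ge0.
set a := s ^+ k; have a0 : 0 < a by exact: sk_gt0.
have -> : a + t ^+ 2 / a = t + ((t - a) ^+ 2 + t * a) / a by field; rewrite gt_eqF.
by rewrite lerDl divr_ge0 ?(ltW a0)// addr_ge0 ?sqr_ge0// mulr_ge0// ltW.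
Qed.

Let measurable_dist k : measurable_fun setT (fun w => sqdist (X k.+1 w) (X k w)).
Proof.
exact: (measurableT_comp (@measurable_sqdist R n) (measurable_fun_pair (mX k.+1) (mX k))).
Qed.

Let measurable_jump k : measurable_fun setT (fun w => (jump k w)%:E).
Proof.
apply/measurable_EFinP; apply: measurable_funD; first exact: measurable_cst.
by apply: measurable_funM => //; exact: measurable_cst.
Qed.

Let integral_jump k : (\int[P]_w (jump k w)%:E <= ((1 + D) * s ^+ k)%:E)%E.
Proof.
have -> : (\int[P]_w (jump k w)%:E
   = \int[P]_w ((s ^+ k)%:E + (s ^- k)%:E * (sqdist (X k.+1 w) (X k w))%:E))%E.
  by apply: eq_integral => w _; rewrite /jump EFinD EFinM muleC.
have md : measurable_fun setT (fun w => (sqdist (X k.+1 w) (X k w))%:E).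
  exact/measurable_EFinP.
have p0 : (0 <= (s ^+ k)%:E :> \bar R)%E by rewrite lee_fin ltW.
have p1 : (0 <= (s ^- k)%:E :> \bar R)%E by rewrite lee_fin invr_ge0 ltW.
have pd w : (0 <= (sqdist (X k.+1 w) (X k w))%:E)%E by rewrite lee_fin sqdist_ge0.
have mm : measurable_fun setT (fun w => (s ^- k)%:E * (sqdist (X k.+1 w) (X k w))%:E)%E.
  by apply: emeasurable_funM => //; exact: measurable_cst.
have pm w : (0 <= (s ^- k)%:E * (sqdist (X k.+1 w) (X k w))%:E)%E by rewrite mule_ge0.
rewrite ge0_integralD//=.
rewrite integral_cst// [X in (_ * X)%E]probability_setT mule1.
rewrite ge0_integralZl// mulrDl mul1r EFinD leeD2l//.
apply: (@le_trans _ _ ((s ^- k)%:E * (D * rho ^+ k)%:E)%E).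
  by rewrite lee_wpmul2l//; exact: step.
rewrite -EFinM lee_fin -s2 le_eqVlt; apply/orP; left; apply/eqP.
rewrite -exprM mulnC exprM; field; rewrite expf_neq0// gt_eqF//.
Qed.

Let total w := (\sum_(0 <= k <oo) (jump k w)%:E)%E.

Let measurable_total : measurable_fun setT total.
Proof. by apply: ge0_emeasurable_sum => // k w _ _; rewrite lee_fin. Qed.

Let total_ge0 w : (0 <= total w)%E.
Proof. by apply: nneseries_ge0 => k _ _; rewrite lee_fin. Qed.

Let integral_total : (\int[P]_w total w < +oo)%E.
Proof.
rewrite integral_nneseries//; last by move=> k w _; rewrite lee_fin.
apply: (@le_lt_trans _ _ (\sum_(0 <= k <oo) ((1 + D) * s ^+ k)%:E)%E).
  apply: lee_nneseries => *; last exact: integral_jump.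
  by apply: integral_ge0 => w _; rewrite lee_fin.
have cv := @cvg_geometric_series R (1 + D) s.
have s1' : `|s| < 1 by rewrite gtr0_norm.
have := cv s1' => {}cv.
have -> : (\sum_(0 <= k <oo) ((1 + D) * s ^+ k)%:E)%E = ((1 + D) / (1 - s))%:E.
  apply/cvg_lim => //; apply: cvg_EFin; first by apply: nearW => k; rewrite /= sumEFin.
  have -> : fine \o (fun k => \sum_(0 <= i < k) ((1 + D) * s ^+ i)%:E)%E
     = series (geometric (1 + D) s).
    by apply/funext => k; rewrite /= sumEFin.
  exact: cv.
by rewrite ltry.
Qed.

Let conv : set T := [set w | (total w < +oo)%E].

Let measurable_conv : measurable conv.
Proof.
rewrite -[conv]setTI; exact: emeasurable_fun_infty_o.
Qed.

Let conv_ae : {ae P, forall w, conv w}.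
Proof.
have I : P.-integrable setT total.
  apply/integrableP; split => //.
  by under eq_integral do rewrite gee0_abs//.
have := integrable_ae measurableT I.
by apply: filterS => w /(_ Logic.I); rewrite ge0_fin_numE.
Qed.

Let X' k w : borelV R n := if w \in conv then X k w else (0 : 'cV[R]_n).

Let measurable_X' k : measurable_fun setT (X' k).
Proof.
apply: measurable_fun_ifT => //.
apply: (measurable_fun_bool true); rewrite setTI (_ : _ @^-1` _ = conv)//.
by apply/seteqP; split => w /=; [exact: set_mem|exact: mem_set].
Qed.

Let X'_cvg w l : cvg ((X' k w : 'cV[R]_n) l 0 @[k --> \oo]).
Proof.
rewrite /X'; have [wc|_] := boolP (w \in conv); last exact: is_cvg_cst.
pose u k : R := (X k.+1 w : 'cV[R]_n) l 0 - (X k w : 'cV[R]_n) l 0.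
have cu : cvg (series u @ \oo).
  apply: normed_cvg.
  apply: (@series_le_cvg _ (fun k => `|u k|) (jump^~ w) (fun k => normr_ge0 _)
    (fun k => jump_ge0 k w) (fun k => coord_le_jump k w l)).
  move: wc; rewrite inE /conv/= => tot.
  have fin : total w \is a fin_num by rewrite ge0_fin_numE.
  have H : (\sum_(0 <= k < m) (jump k w)%:E)%E @[m --> \oo] --> (fine (total w))%:E.
    rewrite fineK//; apply: is_cvg_nneseries => k _ _; by rewrite lee_fin.
  have /fine_cvgP[_ H'] := H; apply/cvg_ex; exists (fine (total w)).
  by apply: cvg_trans H'; apply: near_eq_cvg; apply: nearW => m /=; rewrite sumEFin.
have -> : (fun k => (X k w : 'cV[R]_n) l 0) = (fun k => (X 0 w : 'cV[R]_n) l 0 + series u k).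
  apply/funext => k; rewrite /series/= telescope_sumr//; ring.
by apply: is_cvgD => //; exact: is_cvg_cst.
Qed.

(** The jumps have a finite sum almost surely.  Where they do not, the sequence is
    replaced by [0], so that the convergence of [X'] holds everywhere. *)
Lemma geometric_limit : exists (Xinf : T -> borelV R n) (X' : nat -> T -> borelV R n),
  [/\ measurable_fun setT Xinf, forall k, measurable_fun setT (X' k),
   {ae P, forall w, forall k, X k w = X' k w} &
   forall w, sqdist (X' k w) (Xinf w) @[k --> \oo] --> (0 : R)].
Proof.
pose Xinf w : borelV R n := \col_l lim ((X' k w : 'cV[R]_n) l 0 @[k --> \oo]).
exists Xinf, X'; split => //.
- apply: measurable_vec => l; rewrite /Xinf.
  under eq_fun do rewrite mxE.
  apply: (@measurable_fun_cvg _ _ _ _ (fun k w => (X' k w : 'cV[R]_n) l 0)).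
    by move=> k; exact: (measurableT_comp (measurable_coord l) (measurable_X' k)).
  by move=> w _; exact: X'_cvg.
- by apply: filterS conv_ae => w wc k; rewrite /X' mem_set.
move=> w.
have -> : (fun k => sqdist (X' k w) (Xinf w)) =
   (fun k => \sum_l ((X' k w : 'cV[R]_n) l 0 - (Xinf w : 'cV[R]_n) l 0) ^+ 2).
  apply/funext => k; rewrite /sqdist hsnorm_sqr_col.
  by apply: eq_bigr => l _; rewrite !mxE.
suff H : \sum_l ((X' k w : 'cV[R]_n) l 0 - (Xinf w : 'cV[R]_n) l 0) ^+ 2 @[k --> \oo]
    --> \sum_(l < n) (0 : R) by move: H; rewrite big1.
apply: cvg_sumr => l.
have cX : (X' k w : 'cV[R]_n) l 0 @[k --> \oo] --> ((Xinf w : 'cV[R]_n) l 0 : R).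
  rewrite /Xinf mxE; exact: X'_cvg.
have cC : ((Xinf w : 'cV[R]_n) l 0 : R) @[_ --> \oo] --> ((Xinf w : 'cV[R]_n) l 0 : R).
  exact: cvg_cst.
pose v k : R := (X' k w : 'cV[R]_n) l 0 - (Xinf w : 'cV[R]_n) l 0.
have c0 : v k @[k --> \oo] --> (0 : R).
  by rewrite -(subrr ((Xinf w : 'cV[R]_n) l 0)); exact: cvgB cX cC.
have c1 : v k * v k @[k --> \oo] --> (0 * 0 : R) by exact: cvgM.
by rewrite mul0r in c1.
Qed.

End geometric_limit.

(** * The limit of the backward iterates *)

(** Independence from the chain is known for the sigma-algebra of the whole process
    [W], so the iterates have to be measurable for it. *)
Lemma increment_process_adapted d (T : measurableType d) (R : realType) (m : nat)
    (W : R -> T -> borelV R m) (delta : R) (l : nat) : 0 < delta ->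
  measurable_fun setT (increment W delta l : g_sigma_algebraType (process_events W) -> borelV R m).
Proof.
move=> delta0; apply: measurable_vec => j.
have -> : (fun w => (increment W delta l w : 'cV[R]_m) j 0) = (fun w =>
    (W (l.+1%:R * delta) w : 'cV[R]_m) j 0 - (W (l%:R * delta) w : 'cV[R]_m) j 0).
  by apply/funext => w; rewrite /increment !mxE.
have H k : measurable_fun setT ((fun w => (W (k%:R * delta) w : 'cV[R]_m) j 0)
    : g_sigma_algebraType (process_events W) -> R).
  have h : measurable_fun setT
      (W (k%:R * delta) : g_sigma_algebraType (process_events W) -> borelV R m).
    by apply: process_adapted; rewrite mulr_ge0// ltW.
  exact: (measurableT_comp (measurable_coord j) h).
exact: measurable_funB (H l.+1) (H l).
Qed.

Lemma next_statesS d (T : measurableType d) (R : realType) (N : nat) (La : R -> T -> stateS N)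
    (delta : R) k w :
  next_states La delta 0 k.+1 w
  = rcons (next_states La delta 0 k w) (La (k.+1%:R * delta) w).
Proof. by rewrite /next_states -cats1 -[k.+1 in LHS]addn1 iotaD map_cat. Qed.

Section mixture.
Context d (V : measurableType d) (R : realType) (N : nat).
Variables (pi : 'I_N.+1 -> R) (nu : 'I_N.+1 -> probability V R).
Hypothesis pi_ge0 : forall i, 0 <= pi i.
Hypothesis pi_sum1 : \sum_i pi i = 1.

(** Built from sums of scaled measures, which are indexed by natural numbers. *)
Definition mixture : set V -> \bar R :=
  msum (fun k => mscale (NngNum (pi_ge0 (inord k))) (nu (inord k))) N.+1.

HB.instance Definition _ := Measure.on mixture.

Lemma mixtureE A : mixture A = (\sum_(i < N.+1) (pi i)%:E * nu i A)%E.
Proof.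
by rewrite /mixture/= /msum; apply: eq_bigr => i _; rewrite /mscale/= inord_val.
Qed.

Let mixture_setT : mixture setT = 1%E.
Proof.
rewrite mixtureE; under eq_bigr do rewrite [X in (_ * X)%E]probability_setT mule1.
by rewrite sumEFin pi_sum1.
Qed.

HB.instance Definition _ := Measure_isProbability.Build _ _ _ mixture mixture_setT.

Lemma integral_mixture h : measurable_fun setT h -> (forall v, 0 <= h v)%E ->
  (\int[mixture]_v h v = \sum_(i < N.+1) (pi i)%:E * \int[nu i]_v h v)%E.
Proof.
move=> mh h0; rewrite ge0_integral_measure_sum//; apply: eq_bigr => i _.
by rewrite ge0_integral_mscale// inord_val.
Qed.

Lemma mixture_exists : exists mu : probability V R,
  (forall A, mu A = \sum_(i < N.+1) (pi i)%:E * nu i A)%E /\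
  forall h, measurable_fun setT h -> (forall v, 0 <= h v)%E ->
   (\int[mu]_v h v = \sum_(i < N.+1) (pi i)%:E * \int[nu i]_v h v)%E.
Proof. by exists mixture; split; [exact: mixtureE|exact: integral_mixture]. Qed.

End mixture.

Section backward_limit.
Context d (T : measurableType d) (R : realType) (P : probability T R) (n m N : nat).
Context (F : 'I_N.+1 -> borelV R n -> borelV R m -> borelV R n).
Hypothesis mF : forall j, measurable_fun setT (fun z : borelV R n * borelV R m => F j z.1 z.2).
Context (W : R -> T -> borelV R m) (delta : R).
Hypothesis bmW : brownian_motion P W.
Hypothesis delta_gt0 : 0 < delta.
Let gam := noise_law bmW delta_gt0.
Let eps := increment W delta.
Context (La : 'I_N.+1 -> R -> T -> stateS N) (q : 'M[R]_N.+1).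
Hypothesis La_meas : forall i t, 0 <= t -> measurable_fun setT (La i t).
Hypothesis indWL : forall i, independent_processes P W (La i).
Hypothesis fdd : forall i k (a : nat -> 'I_N.+1),
  P [set w | forall l, (l <= k)%N -> La i (l%:R * delta) w = a l]
  = ((a 0%N == i)%:R * \prod_(l < k) q (a l) (a l.+1))%:E.
Hypothesis q_ge0 : forall i j, 0 <= q i j.
Hypothesis q_sum1 : forall i, \sum_j q i j = 1.
Variables (c xi : 'I_N.+1 -> R) (rho : R).
Hypothesis c_ge0 : forall i, 0 <= c i.
Hypothesis contraction : forall i x y,
  (\int[gam]_e (sqdist (F i x e) (F i y e))%:E <= (c i * sqdist x y)%:E)%E.
Hypothesis xi_gt0 : forall i, 0 < xi i.
Hypothesis rate : forall i, c i * (\sum_j q i j * xi j) <= rho * xi i.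
Hypothesis rho01 : 0 < rho < 1.
Variable x0 : borelV R n.
Hypothesis displacement : forall i, exists M,
  (\int[gam]_e (sqdist (F i x0 e) x0)%:E <= M%:E)%E.

Let X i k w : borelV R n := bwd F eps 0 (next_states (La i) delta 0 k w) x0 w.

Let W_meas := bm_measurable bmW.

Let bwd_adapted s : measurable_fun setT
  ((fun w => bwd F eps 0 s x0 w) : g_sigma_algebraType (process_events W) -> borelV R n).
Proof.
pose TW := g_sigma_algebraType (process_events W).
have mb : measurable_fun setT (fun z : borelV R n * TW => bwd F eps 0 s z.1 z.2).
  by apply: measurable_bwd => // k _; exact: increment_process_adapted.
exact: (measurableT_comp mb (pair1_measurable x0)).
Qed.

Let bwd_measurable s : measurable_fun setT (fun w => bwd F eps 0 s x0 w).
Proof.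
by apply: (sub_adapted (process_events_measurable W_meas)); exact: bwd_adapted.
Qed.

Let measurable_X i k : measurable_fun setT (X i k).
Proof.
exact: (measurable_next_states (@La_meas i) delta_gt0 0 k bwd_measurable).
Qed.

Lemma backward_law h i k : measurable_fun setT h -> (forall x, 0 <= h x)%E ->
  (\int[P]_w h (X i k w) = path_mean q k i (fun s => bwd_mean F gam s h x0))%E.
Proof.
move=> mh h0.
have G s : measurable_fun setT ((fun w => h (bwd F eps 0 s x0 w))
    : g_sigma_algebraType (process_events W) -> \bar R).
  exact: (measurableT_comp mh (@bwd_adapted s)).
rewrite (path_expectation W_meas (@La_meas i) (@indWL i) delta_gt0 q_ge0 (@fdd i) k G)//.
by apply: eq_path_mean => s _; exact: expectation_bwd.
Qed.

Let displacement_bound : exists2 M, 0 <= M & forall i k,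
  (\int[P]_w (sqdist (F i x0 (eps k w)) x0)%:E <= M%:E)%E.
Proof.
have /choice[M HM] := displacement.
have mg : measurable_fun setT (fun y : borelV R n => (sqdist y x0)%:E).
  apply/measurable_EFinP.
  exact: (measurableT_comp (@measurable_sqdist R n) (pair2_measurable x0)).
exists (\sum_i Num.max 0 (M i)); first by apply: sumr_ge0 => i _; rewrite le_max lexx.
move=> i k; have := @expectation_run _ _ _ _ _ _ mF _ _ _ _ _ bmW delta_gt0 k [:: i]
  (fun y => (sqdist y x0)%:E) x0 mg.
move=> /= -> => [|y]; last by rewrite lee_fin sqdist_ge0.
apply: le_trans (HM i) _; rewrite lee_fin (bigD1 i)//=.
apply: (@le_trans _ _ (Num.max 0 (M i))); first by rewrite le_max lexx orbT.
by rewrite lerDl; apply: sumr_ge0 => l _; rewrite le_max lexx.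
Qed.

Let pm (s : seq 'I_N.+1) : R := \prod_(j <- take (size s).-1 s) c j.

Let pm_ge0 s : 0 <= pm s.
Proof. by apply: prodr_ge0. Qed.

Let path_bound : exists2 D, 0 <= D & forall i k,
  (path_mean q k.+1 i (fun s => (pm s)%:E) <= (D * rho ^+ k)%:E)%E.
Proof.
case/andP: rho01 => r0 r1.
have xi0 i : 0 <= xi i by exact: ltW.
pose C : R := \sum_l c l / xi l.
have C0 : 0 <= C by apply: sumr_ge0 => l _; rewrite divr_ge0.
pose Xi : R := \sum_l xi l.
have Xi0 : 0 <= Xi by exact: sumr_ge0.
have qxi i : \sum_j q i j * xi j <= Xi.
  apply: ler_sum => j _; rewrite -[leRHS]mul1r ler_wpM2r// -(q_sum1 i).
  by rewrite (bigD1 j)//= lerDl sumr_ge0.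
have E0 i : path_mean q 1 i (fun s => (pm s)%:E) = 1%E.
  rewrite /=; under eq_bigr do rewrite /pm/= big_nil mule1.
  by rewrite sumEFin q_sum1.
have ES k i : path_mean q k.+2 i (fun s => (pm s)%:E)
    = (\sum_j (q i j)%:E * ((c j)%:E * path_mean q k.+1 j (fun s => (pm s)%:E)))%E.
  transitivity (\sum_j (q i j)%:E * path_mean q k.+1 j (fun s => (pm (j :: s))%:E))%E => //.
  apply: eq_bigr => j _; congr (_ * _)%E.
  rewrite -path_meanZ//.
  apply: eq_path_mean => s sk; rewrite -EFinM /pm/= sk/=.
  by case: s sk => // a s [sk]; rewrite /= big_cons.
have claim k i : ((c i)%:E * path_mean q k.+1 i (fun s => (pm s)%:E)
    <= (C * rho ^+ k * xi i)%:E)%E.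
  elim: k i => [|k IH] i.
    rewrite E0 mule1 lee_fin expr0 mulr1 -ler_pdivrMr// /C (bigD1 i)//= lerDl.
    by apply: sumr_ge0 => l _; rewrite divr_ge0.
  rewrite ES.
  apply: (@le_trans _ _ ((c i)%:E * \sum_j (q i j)%:E * (C * rho ^+ k * xi j)%:E)%E).
    apply: lee_wpmul2l; first by rewrite lee_fin.
    by apply: lee_sum => j _; apply: lee_wpmul2l; [rewrite lee_fin|exact: IH].
  under eq_bigr do rewrite -EFinM; rewrite sumEFin -EFinM lee_fin.
  have -> : \sum_j q i j * (C * rho ^+ k * xi j) = C * rho ^+ k * \sum_j q i j * xi j.
    by rewrite mulr_sumr; apply: eq_bigr => j _; rewrite mulrCA.
  rewrite mulrCA exprSr -!mulrA; apply: ler_wpM2l => //.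
  apply: ler_wpM2l; last exact: rate.
  by rewrite exprn_ge0// ltW.
exists (1 + C * Xi / rho).
  by rewrite addr_ge0// divr_ge0 ?(ltW r0)// mulr_ge0.
move=> i [|k].
  by rewrite E0 lee_fin expr0 mulr1 lerDl divr_ge0 ?(ltW r0)// mulr_ge0.
rewrite ES.
apply: (@le_trans _ _ (\sum_j (q i j)%:E * (C * rho ^+ k * xi j)%:E)%E).
  by apply: lee_sum => j _; apply: lee_wpmul2l; [rewrite lee_fin|exact: claim].
under eq_bigr do rewrite -EFinM; rewrite sumEFin lee_fin.
have -> : \sum_j q i j * (C * rho ^+ k * xi j) = C * rho ^+ k * \sum_j q i j * xi j.
  by rewrite mulr_sumr; apply: eq_bigr => j _; rewrite mulrCA.
have rk : 0 <= rho ^+ k by rewrite exprn_ge0// ltW.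
rewrite mulrDl mul1r.
have -> : C * Xi / rho * rho ^+ k.+1 = C * rho ^+ k * Xi.
  by rewrite exprS; field; rewrite gt_eqF.
apply: ler_wpDl; first by rewrite exprn_ge0// ltW.
by apply: ler_wpM2l => //; rewrite mulr_ge0.
Qed.

(** Consecutive backward iterates share all maps but the innermost one, so their
    distance is contracted by every map they share. *)
Lemma backward_steps : exists2 D, 0 <= D & forall i k,
  (\int[P]_w (sqdist (X i k.+1 w) (X i k w))%:E <= (D * rho ^+ k)%:E)%E.
Proof.
have [M M0 HM] := displacement_bound; have [D D0 HD] := path_bound.
exists (M * D); first by rewrite mulr_ge0.
move=> i k.
pose G s w : \bar R := (sqdist (bwd F eps 0 s x0 w)
   (bwd F eps 0 (take (size s).-1 s) x0 w))%:E.
have mG s : measurable_fun setT (G s : g_sigma_algebraType (process_events W) -> \bar R).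
  apply/measurable_EFinP.
  have m1 := measurable_fun_pair (@bwd_adapted s) (@bwd_adapted (take (size s).-1 s)).
  exact: (measurableT_comp (@measurable_sqdist R n) m1).
have G0 s w : (0 <= G s w)%E by rewrite lee_fin sqdist_ge0.
have -> : (\int[P]_w (sqdist (X i k.+1 w) (X i k w))%:E
    = \int[P]_w G (next_states (La i) delta 0 k.+1 w) w)%E.
  apply: eq_integral => w _; rewrite /G size_next_states /X/= next_statesS.
  by rewrite -cats1 take_size_cat// size_next_states.
rewrite (path_expectation W_meas (@La_meas i) (@indWL i) delta_gt0 q_ge0 (@fdd i) _ mG G0).
apply: (@le_trans _ _ (path_mean q k.+1 i (fun s => M%:E * (pm s)%:E)%E)); last first.
  rewrite path_meanZ//.
  apply: (@le_trans _ _ (M%:E * (D * rho ^+ k)%:E)%E).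
    by apply: lee_wpmul2l; [rewrite lee_fin|exact: HD].
  by rewrite -EFinM mulrA.
apply: le_path_mean => // s; case/lastP: s => // s j _.
rewrite /G /pm size_rcons/= -cats1 take_size_cat// cats1.
under eq_integral do rewrite bwd_rcons add0n.
pose S : pred nat := fun l => (size s <= l)%N.
have mZ1 : measurable_fun setT ((fun w => F j x0 (eps (size s) w))
    : g_sigma_algebraType (noise_events W delta (size s).+1 S) -> borelV R n).
  apply: measurable_step => //.
  exact: (@increment_adapted _ T R m W delta (size s).+1 S (size s) (leqnn _) (leqnn _)).
have mcost : measurable_fun setT (fun z : borelV R n * borelV R n => (sqdist z.1 z.2)%:E).
  by apply/measurable_EFinP; exact: measurable_sqdist.
have cost0 (z : borelV R n * borelV R n) : (0 <= (sqdist z.1 z.2)%:E)%E.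
  by rewrite lee_fin sqdist_ge0.
have ctr l x y : (\int[gam]_e (sqdist (F l x e) (F l y e))%:E
   <= (c l)%:E * (sqdist x y)%:E)%E by rewrite -EFinM.
have H := @bwd_contraction _ _ _ _ _ _ mF _ _ _ _ _ _ _
  (fun z => (sqdist z.1 z.2)%:E) c mcost cost0 c_ge0 ctr (size s).+1 S 0 s
  (fun w => F j x0 (eps (size s) w)) (fun=> x0) (leqnSn _) (fun k => id) mZ1
  (measurable_cst _).
apply: le_trans H _; rewrite muleC lee_wpmul2r//; last exact: HM.
by rewrite lee_fin prodr_ge0.
Qed.

Variable pi : 'I_N.+1 -> R.
Hypothesis pi_ge0 : forall i, 0 <= pi i.
Hypothesis pi_sum1 : \sum_i pi i = 1.
Hypothesis pi_rev : forall i j, pi i * q i j = pi j * q j i.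

Let averagedE h k : measurable_fun setT h -> (forall z, 0 <= h z)%E ->
  averaged F gam q pi x0 h k
  = (\sum_i (pi i)%:E * \int[P]_w h (X i k w, i : stateS N))%E.
Proof.
move=> mh h0; rewrite /averaged -(backward_forward mF)//.
apply: eq_bigr => i _; congr (_ * _)%E; apply/esym/backward_law => //.
exact: (measurableT_comp mh (pair2_measurable _)).
Qed.

(** Run backwards in time, the chain started at [x0] converges almost surely; the
    limit, averaged over the initial state, is the candidate invariant law.  By
    reversibility it also attracts the averaged forward chain. *)
Lemma backward_limit_law : exists mu : probability (borelV R n * stateS N)%type R,
  (forall j, slice mu j setT = (pi j)%:E) /\
  forall h : borelV R n * stateS N -> \bar R, test_function (@sqdist R n) xi h ->
    fine (averaged F gam q pi x0 h k) @[k --> \oo] --> fine (\int[mu]_z h z)%E.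
Proof.
have [D D0 HD] := backward_steps.
have lim i := geometric_limit (measurable_X i) rho01 (HD i).
have /choice[Y HY] := lim.
have /choice[X' HX'] := HY.
have mY i : measurable_fun setT (Y i) by case: (HX' i).
have mX' i k : measurable_fun setT (X' i k) by case: (HX' i).
have mpair (f : T -> borelV R n) (i : stateS N) : measurable_fun setT f ->
    measurable_fun setT (fun w => (f w, i)).
  by move=> mf; apply: measurable_fun_pair => //; exact: measurable_cst.
have [mu [muE int_mu]] := mixture_exists
  (fun i => law P (mpair _ (i : stateS N) (mY i))) pi_ge0 pi_sum1.
exists mu; split => [j|h [mh h01 hmod]].
  pose A : set (borelV R n * stateS N) := setT `*` [set (j : stateS N)].
  have lawA i : law P (mpair _ (i : stateS N) (mY i)) A = ((i == j)%:R)%:E.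
    rewrite lawE; have [->|ij] := eqVneq i j.
      have -> : (fun w => (Y j w, j : stateS N)) @^-1` A = setT by apply/seteqP; split.
      exact: probability_setT.
    have -> : (fun w => (Y i w, i : stateS N)) @^-1` A = set0.
      by apply/seteqP; split => // w [_ /= ij']; rewrite ij' eqxx in ij.
    exact: measure0.
  have -> : slice mu j setT = mu A by [].
  rewrite muE; under eq_bigr do rewrite lawA -EFinM.
  by rewrite sumEFin (bigD1 j)//= eqxx mulr1 big1 ?addr0// => i /negPf ->; rewrite mulr0.
have h0 z : (0 <= h z)%E by case/andP: (h01 z).
rewrite int_mu//.
have intfin (f : T -> borelV R n) (i : stateS N) : measurable_fun setT f ->
    (\int[P]_w h (f w, i) \is a fin_num)%E.
  move=> mf; apply: bounded_integral_fin_num => //.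
  exact: (measurableT_comp mh (mpair f i mf)).
have -> : fine (\sum_(i < N.+1) (pi i)%:E
      * \int[law P (mpair _ (i : stateS N) (mY i))]_v h v)%E
    = \sum_(i < N.+1) pi i * fine (\int[P]_w h (Y i w, i : stateS N))%E.
  rewrite -sum_fine => [|i _]; last by rewrite integral_law// fin_numM// intfin.
  by apply: eq_bigr => i _; rewrite integral_law// fineM// intfin.
have -> : (fun k => fine (averaged F gam q pi x0 h k)) = (fun k =>
    \sum_(i < N.+1) pi i * fine (\int[P]_w h (X' i k w, i : stateS N))%E).
  apply/funext => k; rewrite averagedE//.
  have XX' i : (\int[P]_w h (X i k w, i : stateS N)
      = \int[P]_w h (X' i k w, i : stateS N))%E.
    apply: ge0_ae_eq_integral => //.
    - exact: (measurableT_comp mh (mpair _ _ (measurable_X i k))).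
    - exact: (measurableT_comp mh (mpair _ _ (mX' i k))).
    - case: (HX' i) => _ _ ae _; apply: filterS ae => w aew _.
      by rewrite aew.
  rewrite -sum_fine => [|i _]; last by rewrite fin_numM// intfin.
  by apply: eq_bigr => i _; rewrite fineM ?intfin// XX'.
apply: cvg_sumr => i.
rewrite -[X in _ --> X]addr0.
pose f k w := h (X' i k w, i : stateS N).
pose g (k : nat) w := h (Y i w, i : stateS N).
have -> : (fun k => pi i * fine (\int[P]_w f k w)%E) = (fun k =>
   pi i * fine (\int[P]_w g k w)%E
   + pi i * (fine (\int[P]_w f k w)%E - fine (\int[P]_w g k w)%E)).
  by apply/funext => k; rewrite -mulrDr addrC subrK.
have H : fine (\int[P]_w f k w)%E - fine (\int[P]_w g k w)%E @[k --> \oo] --> (0 : R).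
  apply: integral_squeeze.
  - by move=> k w; exact: h01.
  - by move=> k w; exact: h01.
  - by move=> k; exact: (measurableT_comp mh (mpair _ _ (mX' i k))).
  - by move=> k; exact: (measurableT_comp mh (mpair _ _ (mY i))).
  move=> A A0; have [B B0 hB] := hmod A A0.
  exists (fun k w => B * xi i * sqdist (X' i k w) (Y i w)); split.
  - move=> k; apply: measurable_funM; first exact: measurable_cst.
    exact: (measurableT_comp (@measurable_sqdist R n) (measurable_fun_pair (mX' i k) (mY i))).
  - by move=> k w; rewrite mulr_ge0 ?sqdist_ge0// mulr_ge0// ltW.
  - case: (HX' i) => _ _ _ cv w; rewrite -(mulr0 (B * xi i)).
    by apply: cvgM; [exact: cvg_cst|exact: cv].
  - by move=> k w; exact: hB.
  - move=> k w; apply: le_trans (hB i (Y i w) (X' i k w)) _.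
    rewrite leeD2l// lee_fin lerD2l// /sqdist.
    rewrite (_ : hsnorm ((Y i w : 'cV[R]_n) - (X' i k w : 'cV[R]_n)) ^+ 2
      = hsnorm ((X' i k w : 'cV[R]_n) - (Y i w : 'cV[R]_n)) ^+ 2)//.
    by rewrite !hsnorm_sqr_col; apply: eq_bigr => l _; rewrite !mxE -sqrrN opprB.
pose G := pi i * fine (\int[P]_w h (Y i w, i : stateS N))%E.
have cG : G @[_ --> \oo] --> G by exact: cvg_cst.
have cH : pi i * (fine (\int[P]_w f k w)%E - fine (\int[P]_w g k w)%E) @[k --> \oo]
    --> (0 : R).
  by rewrite -(mulr0 (pi i)); apply: cvgM; [exact: cvg_cst|exact: H].
exact: (cvgD cG cH).
Qed.

End backward_limit.

(** * The law of the Euler-Maruyama chain *)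

Section euler_chain.
Context d (T : measurableType d) (R : realType) (P : probability T R) (n m N : nat).
Context (b : 'cV[R]_n -> 'I_N.+1 -> 'cV[R]_n).
Context (sigma : 'cV[R]_n -> 'I_N.+1 -> 'M[R]_(n, m)).
Context (W : R -> T -> borelV R m) (delta : R).
Hypothesis bmW : brownian_motion P W.
Hypothesis delta_gt0 : 0 < delta.
Let gam := noise_law bmW delta_gt0.
Let F := em_map b sigma delta.
Hypothesis mF : forall j, measurable_fun setT (fun z : borelV R n * borelV R m => F j z.1 z.2).
Context (La : 'I_N.+1 -> R -> T -> stateS N) (q : 'M[R]_N.+1).
Hypothesis La_meas : forall i t, 0 <= t -> measurable_fun setT (La i t).
Hypothesis indWL : forall i, independent_processes P W (La i).
Hypothesis fdd : forall i k (a : nat -> 'I_N.+1),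
  P [set w | forall l, (l <= k)%N -> La i (l%:R * delta) w = a l]
  = ((a 0%N == i)%:R * \prod_(l < k) q (a l) (a l.+1))%:E.
Hypothesis q_ge0 : forall i j, 0 <= q i j.

Let eps := increment W delta.
Let W_meas := bm_measurable bmW.
Let K := transfer F gam q.

Let euler i x k w : borelV R n := euler_maruyama b sigma delta W (La i) x k w.

Let eulerE i x k w : euler i x k w =
  run F eps 0 [seq (La i (l%:R * delta) w : 'I_N.+1) | l <- iota 0 k] x w.
Proof.
elim: k => // k IH; pose f l : 'I_N.+1 := La i (l%:R * delta) w.
have sE : [seq f l | l <- iota 0 k.+1] = rcons [seq f l | l <- iota 0 k] (f k).
  by rewrite -[k.+1]addn1 iotaD map_cat cats1.
rewrite -/(map f (iota 0 k.+1)) sE run_rcons.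
by rewrite size_map size_iota -IH.
Qed.

Let euler_path i x k w : La i 0 w = i ->
  let s := next_states (La i) delta 0 k w in
  euler i x k w = run F eps 0 (belast i s) x w
  /\ La i (k%:R * delta) w = last i s.
Proof.
move=> Li s; rewrite eulerE; pose f l : 'I_N.+1 := La i (l%:R * delta) w.
have f0 : f 0%N = i by rewrite /f mul0r.
have [E1 E2] : belast 0%N (iota 1 k) = iota 0 k /\ last 0%N (iota 1 k) = k.
  have := lastI 0%N (iota 1 k); rewrite -[LHS]/(iota 0 (1 + k)) addnC iotaD/= cats1.
  by move=> /rcons_inj[-> <-].
have -> : s = map f (iota 1 k) by [].
have Eb : belast (f 0%N) (map f (iota 1 k)) = map f (iota 0 k) by rewrite belast_map E1.
have El : last (f 0%N) (map f (iota 1 k)) = f k by rewrite last_map E2.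
by rewrite f0 in Eb El; rewrite Eb El.
Qed.

Let time_ge0 k : 0 <= k%:R * delta. Proof. by rewrite mulr_ge0// ltW. Qed.

Lemma measurable_euler i k :
  measurable_fun setT (fun z : borelV R n * T => euler i z.1 k z.2).
Proof.
elim: k => [|k IH]; first exact: measurable_fst.
pose f (z : (borelV R n * borelV R m) * stateS N) := F z.2 z.1.1 z.1.2.
have mf : measurable_fun setT f by apply: measurable_fun_state => j; exact: mF.
have mL : measurable_fun setT (fun z : borelV R n * T => La i (k%:R * delta) z.2).
  exact: (measurableT_comp (La_meas i (time_ge0 k)) measurable_snd).
have me : measurable_fun setT (fun z : borelV R n * T => eps k z.2).
  exact: (measurableT_comp (measurable_increment bmW delta_gt0 k) measurable_snd).
exact: (measurableT_comp mf (measurable_fun_pair (measurable_fun_pair IH me) mL)).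
Qed.

Let measurable_euler_at i x k : measurable_fun setT (fun w => euler i x k w).
Proof.
exact: (measurableT_comp (measurable_euler i k) (pair1_measurable (x : borelV R n))).
Qed.

Let run_adapted s x : measurable_fun setT
  ((fun w => run F eps 0 s x w) : g_sigma_algebraType (process_events W) -> borelV R n).
Proof.
pose TW := g_sigma_algebraType (process_events W).
have mr : measurable_fun setT (fun z : borelV R n * TW => run F eps 0 s z.1 z.2).
  by apply: measurable_run => // k _; exact: increment_process_adapted.
exact: (measurableT_comp mr (pair1_measurable (x : borelV R n))).
Qed.

(** The noise is independent of the switching path, so one can average over the
    noise with the path held fixed, then over the path. *)
Lemma euler_expectation i x k h : measurable_fun setT h -> (forall z, 0 <= h z)%E ->
  (\int[P]_w h (euler i x k w, La i (k%:R * delta) w) = iter k K h (x, i : stateS N))%E.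
Proof.
move=> mh h0; rewrite /K iter_transferE//.
pose G s w := h (run F eps 0 (belast i s) x w, last i s : stateS N).
have mG s : measurable_fun setT (G s : g_sigma_algebraType (process_events W) -> \bar R).
  exact: (measurableT_comp mh (measurableT_comp (pair2_measurable _) (run_adapted (belast i s) x))).
have G0 s w : (0 <= G s w)%E by exact: h0.
transitivity (\int[P]_w G (next_states (La i) delta 0 k w) w)%E.
  apply: (ae_start (La_meas i) delta_gt0 (fdd i)) => //.
  - exact: (measurableT_comp mh (measurable_fun_pair (measurable_euler_at i x k)
      (La_meas i (time_ge0 k)))).
  - apply: (measurable_next_states (La_meas i) delta_gt0 0 k) => s.
    by apply: (sub_adapted (process_events_measurable W_meas)); exact: mG.
  by move=> w Li; have [-> ->] := euler_path x k Li.
rewrite (path_expectation W_meas (@La_meas i) (@indWL i) delta_gt0 q_ge0 (@fdd i) k mG G0).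
apply: eq_path_mean => s _; rewrite /G.
apply: (@expectation_run _ _ _ _ _ _ mF _ _ _ _ _ bmW delta_gt0 0 (belast i s)
  (fun y => h (y, last i s : stateS N)) x) => [|y]; last exact: h0.
exact: (measurableT_comp mh (pair2_measurable _)).
Qed.

Lemma em_kernelE k x i A : measurable A ->
  em_kernel P b sigma delta W La k x i A
  = iter k K (fun z => (\1_A z)%:E) (x, i : stateS N).
Proof.
move=> mA.
have mind : measurable_fun setT (fun z => (\1_A z)%:E : \bar R).
  by apply/measurable_EFinP; exact: measurable_indic.
have mE : measurable_fun setT (fun w => (euler i x k w, La i (k%:R * delta) w)).
  exact: (measurable_fun_pair (measurable_euler_at i x k) (La_meas i (time_ge0 k))).
have mB := mE measurableT A mA; rewrite setTI in mB.
rewrite -euler_expectation//.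
transitivity (\int[P]_w (\1_((fun w => (euler i x k w, La i (k%:R * delta) w)) @^-1` A) w)%:E)%E.
  by rewrite integral_indic// setIT.
by [].
Qed.

(** The law of the chain after [k] steps, as the image of [nu \x P]. *)
Lemma pushforward_exists (nu : probability (borelV R n * stateS N)%type R) k :
  exists nu' : probability (borelV R n * stateS N)%type R,
  forall h, measurable_fun setT h -> (forall z, 0 <= h z)%E ->
   (\int[nu']_z h z = \int[nu]_z iter k K h z)%E.
Proof.
pose Psi (z : (borelV R n * stateS N) * T) : borelV R n * stateS N :=
  (euler z.1.2 z.1.1 k z.2, La z.1.2 (k%:R * delta) z.2).
have mPsi : measurable_fun setT Psi.
  pose f (z : (borelV R n * T) * stateS N) : borelV R n * stateS N :=
    (euler z.2 z.1.1 k z.1.2, La z.2 (k%:R * delta) z.1.2).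
  have mf : measurable_fun setT f.
    apply: measurable_fun_state => j; apply: measurable_fun_pair.
      exact: measurable_euler.
    exact: (measurableT_comp (La_meas j (time_ge0 k)) measurable_snd).
  have m11 : measurable_fun setT (fun z : (borelV R n * stateS N) * T => z.1.1).
    exact: (measurableT_comp measurable_fst measurable_fst).
  have m12 : measurable_fun setT (fun z : (borelV R n * stateS N) * T => z.1.2).
    exact: (measurableT_comp measurable_snd measurable_fst).
  exact: (measurableT_comp mf (measurable_fun_pair (measurable_fun_pair m11 measurable_snd) m12)).
exists (law (nu \x P)%E mPsi) => h mh h0; rewrite integral_law//.
rewrite (@fubini_tonelli1 _ _ _ _ _ nu P (fun z => h (Psi z)))//; last first.
  exact: (measurableT_comp mh mPsi).
by apply: eq_integral => -[x i] _; rewrite -euler_expectation.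
Qed.

(** Invariance only speaks of rectangles, but laws that agree on those agree
    everywhere: [nu] is its own push-forward, hence has the same integrals. *)
Lemma em_invariant_transfer (nu : probability (borelV R n * stateS N)%type R) :
  em_invariant P b sigma delta W La nu <->
  forall k h, measurable_fun setT h -> (forall z, 0 <= h z)%E ->
    (\int[nu]_z iter k K h z = \int[nu]_z h z)%E.
Proof.
have mind (A : set (borelV R n * stateS N)) : measurable A ->
    measurable_fun setT (fun z => (\1_A z)%:E : \bar R).
  by move=> mA; apply/measurable_EFinP; exact: measurable_indic.
have sliceE k G (i : stateS N) : measurable (G : set (borelV R n)) ->
  (\sum_(j < N.+1)
         \int[fun B : set (borelV R n) => nu (B `*` [set (j : stateS N)])]_x
           em_kernel P b sigma delta W La k x j (G `*` [set i])
   = \int[nu]_z iter k K (fun z => (\1_(G `*` [set i]) z)%:E) z)%E.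
  move=> mG; have mGi : measurable (G `*` [set i]) by exact: measurableX.
  rewrite integral_slice//; last 2 first.
  - by apply: measurable_iter_transfer => //; exact: mind.
  - by move=> z; exact: iter_transfer_ge0.
  apply: eq_bigr => j _; rewrite -/(slice nu j).
  have -> : (fun x => em_kernel P b sigma delta W La k x j (G `*` [set i]))
    = (fun x => iter k K (fun z => (\1_(G `*` [set i]) z)%:E) (x, j)).
    by apply/funext => x; exact: em_kernelE.
  reflexivity.
split => [inv k h mh h0|inv k G i mG]; last first.
  have mGi : measurable (G `*` [set (i : stateS N)]) by exact: measurableX.
  rewrite (sliceE k G i mG) inv//; last exact: mind.
  by rewrite integral_indic// setIT.
have [nu' Hnu'] := pushforward_exists nu k.
rewrite -Hnu'//; apply: eq_measure_integral => A mA _.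
apply: state_measure_eq => // {A mA} c j.
have mO : measurable (orthant c : set (borelV R n)).
  by rewrite borelV_orthant; apply: sub_sigma_algebra; exists c.
have mA : measurable ((orthant c : set (borelV R n)) `*` [set (j : stateS N)]).
  exact: measurableX.
rewrite [RHS](inv k _ j mO) (sliceE k _ j mO) -Hnu'//; last exact: mind.
by rewrite integral_indic// setIT.
Qed.

End euler_chain.

(** * The invariant measure *)

(** By reversibility [v / pi] is harmonic for [q]; since all entries of [q] are
    positive, the maximum principle makes it constant. *)
Lemma reversible_stationary_unique (R : realType) (N : nat) (q : 'M[R]_N.+1)
    (pi v : 'I_N.+1 -> R) :
  (forall i j, 0 < q i j) -> (forall i, \sum_j q i j = 1) ->
  (forall i, 0 < pi i) -> \sum_i pi i = 1 ->
  (forall i j, pi i * q i j = pi j * q j i) ->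
  (forall i, \sum_j v j * q j i = v i) -> \sum_i v i = 1 -> v =1 pi.
Proof.
move=> q0 q1 pi0 pi1 rev vq v1; pose h i := v i / pi i.
have vE i : v i = h i * pi i by rewrite /h divfK// gt_eqF.
have harm i : \sum_j q i j * h j = h i.
  apply: (mulIf (lt0r_neq0 (pi0 i))); rewrite -vE -(vq i) mulr_suml.
  by apply: eq_bigr => j _; rewrite (vE j) -mulrA -rev; ring.
pose i0 : 'I_N.+1 := [arg max_(i > ord0) h i]%O.
have hmax j : h j <= h i0 by rewrite /i0; case: arg_maxP => // i _; exact.
have hc j : h j = h i0.
  have z : \sum_j q i0 j * (h i0 - h j) = 0.
    under eq_bigr do rewrite mulrBr.
    by rewrite sumrB -mulr_suml q1 mul1r harm subrr.
  have t0 l : true -> 0 <= q i0 l * (h i0 - h l) by rewrite mulr_ge0 ?subr_ge0// ltW.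
  have /(_ j isT)/eqP := psumr_eq0P t0 z.
  by rewrite /= mulf_eq0 gt_eqF//= subr_eq0 => /eqP ->.
have hi0 : h i0 = 1.
  transitivity (\sum_i v i); rewrite // -[LHS]mulr1 -pi1 mulr_sumr.
  by apply: eq_bigr => j _; rewrite (vE j) hc.
by move=> i; rewrite (vE i) hc hi0 mul1r.
Qed.

Section marginal.
Context (R : realType) (n m N : nat).
Context (F : 'I_N.+1 -> borelV R n -> borelV R m -> borelV R n).
Context (gam : probability (borelV R m) R) (q : 'M[R]_N.+1) (pi : 'I_N.+1 -> R).
Hypothesis q_gt0 : forall i j, 0 < q i j.
Hypothesis q_sum1 : forall i, \sum_j q i j = 1.
Hypothesis pi_gt0 : forall i, 0 < pi i.
Hypothesis pi_sum1 : \sum_i pi i = 1.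
Hypothesis pi_rev : forall i j, pi i * q i j = pi j * q j i.

(** On functions of the state alone the transfer operator is that of the switching
    chain, so the marginal on the states is stationary for it. *)
Lemma invariant_marginal (nu : probability (borelV R n * stateS N)%type R) :
  (forall h, measurable_fun setT h -> (forall z, 0 <= h z)%E ->
     (\int[nu]_z transfer F gam q h z = \int[nu]_z h z)%E) ->
  forall j, slice nu j setT = (pi j)%:E.
Proof.
move=> inv.
have fin j : slice nu j setT \is a fin_num.
  have -> : slice nu j setT = nu (setT `*` [set (j : stateS N)]) by [].
  by apply: fin_num_measure; exact: measurableX.
pose v j := fine (slice nu j setT).
have vE j : slice nu j setT = (v j)%:E by rewrite /v fineK.
have state_integral (f : 'I_N.+1 -> R) : (forall j, 0 <= f j) ->
    (\int[nu]_z (f z.2)%:E = (\sum_j v j * f j)%:E)%E.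
  move=> f0; rewrite integral_slice; last 2 first.
  - by apply: measurable_fun_state => j /=; exact: measurable_cst.
  - by move=> z; rewrite lee_fin.
  rewrite -sumEFin; apply: eq_bigr => j _ /=.
  by rewrite integral_cst// EFinM muleC -vE.
suff vpi : v =1 pi by move=> j; rewrite vE vpi.
apply: (reversible_stationary_unique q_gt0 q_sum1 pi_gt0 pi_sum1 pi_rev) => [i|].
  apply: EFin_inj; rewrite -state_integral => [|j]; last exact: ltW.
  pose f (j : 'I_N.+1) : R := (j == i)%:R.
  have f0 j : 0 <= f j by rewrite /f.
  have mf : measurable_fun setT (fun z : borelV R n * stateS N => (f z.2)%:E).
    by apply: measurable_fun_state => j /=; exact: measurable_cst.
  have := inv (fun z => (f z.2)%:E) mf (fun z => f0 z.2).
  rewrite state_integral// (_ : \sum_j v j * f j = v i); last first.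
    rewrite (bigD1 i)//= /f eqxx mulr1 big1 ?addr0// => j /negPf ->; by rewrite mulr0.
  move=> <-; apply: eq_integral => z _.
  rewrite /transfer/= (bigD1 i)//= big1 ?adde0 => [|j /negPf ji].
    rewrite /map_mean integral_cst// [X in (_ * (_ * X))%E](_ : _ = 1%E) ?mule1 /f ?eqxx ?mule1//.
    exact: probability_setT.
  by rewrite /map_mean integral_cst// /f ji mul0e mule0.
apply: EFin_inj; have <- := eq_bigr v (fun j (_ : true) => mulr1 (v j)).
rewrite -(state_integral (fun=> 1))//= integral_cst// mul1e.
exact: probability_setT.
Qed.

End marginal.

Theorem theorem4p1 (R : realType) (n m N : nat)
  (d : measure_display) (T : measurableType d) (P : probability T R)
  (W : R -> T -> borelV R m) (La : 'I_N.+1 -> R -> T -> stateS N)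
  (Q : 'M[R]_N.+1) (pi beta xi : 'I_N.+1 -> R)
  (b : 'cV[R]_n -> 'I_N.+1 -> 'cV[R]_n)
  (sigma : 'cV[R]_n -> 'I_N.+1 -> 'M[R]_(n, m))
  (L c0 delta : R) :
  brownian_motion P W ->
  conservative_Qmatrix Q -> irreducible_Qmatrix Q ->
  (forall i, markov_chain_from P Q i (La i)) ->
  (forall i, independent_processes P W (La i)) ->
  (forall i, 0 <= pi i) -> \sum_i pi i = 1 ->
  (forall i j, pi i * Q i j = pi j * Q j i) ->
  0 < L ->
  (forall i x y,
     hsnorm (b x i - b y i) + hsnorm (sigma x i - sigma y i)
     <= L * hsnorm (x - y)) ->
  0 < c0 ->
  (forall i x,
     2 * inner x (b x i) + hsnorm (sigma x i) ^+ 2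
     <= c0 + beta i * hsnorm x ^+ 2) ->
  (forall i x y,
     2 * inner (x - y) (b x i - b y i) + hsnorm (sigma x i - sigma y i) ^+ 2
     <= beta i * hsnorm (x - y) ^+ 2) ->
  0 < lambda0 Q pi beta ->
  (forall i, 0 < xi i) ->
  dirichlet Q pi beta xi = lambda0 Q pi beta * \sum_i pi i * xi i ^+ 2 ->
  0 < delta -> delta < 1 ->
  delta < Num.min (1 / (32 * L ^+ 2))
                  ((lambda0 Q pi beta / kappa Q beta xi L) ^+ 2) ->
  exists mu : probability (borelV R n * stateS N)%type R,
    em_invariant P b sigma delta W La mu /\
    forall nu : probability (borelV R n * stateS N)%type R,
      em_invariant P b sigma delta W La nu ->
      forall A, measurable A -> nu A = mu A.
Proof.
move=> bmW consQ irrQ markov indWL pi_ge0 pi_sum1 rev L_gt0 lip _ _ diss lam_gt0 xi_gt0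
  xi_min delta_gt0 delta_lt1 delta_small.
have [_ [p tfp _]] := markov ord0.
have La_meas i t : 0 <= t -> measurable_fun setT (La i t).
  by case: (markov i) => + _; exact.
have d0 : 0 <= delta by exact: ltW.
pose q := p delta.
have fdd i k (a : nat -> 'I_N.+1) :
  P [set w | forall l, (l <= k)%N -> La i (l%:R * delta) w = a l]
  = ((a 0%N == i)%:R * \prod_(l < k) q (a l) (a l.+1))%:E.
  have [_ [p' tfp' H]] := markov i.
  have t0 : 0%:R * delta = 0 :> R by rewrite mul0r.
  have tS l : l%:R * delta < l.+1%:R * delta by rewrite ltr_pM2r// ltr_nat.
  rewrite (H k (fun l => l%:R * delta) a t0 tS); congr ((_ * _)%:E).
  apply: eq_bigr => l _; rewrite /q (tf_unique tfp tfp' d0); congr (p' _ _ _).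
  by rewrite -mulrBl -natrB// subSnn mul1r.
have q_gt0 i j : 0 < q i j by exact: (tf_gt0 tfp).
have q_ge0 i j : 0 <= q i j by exact: ltW.
have q_sum1 i : \sum_j q i j = 1 by exact: (tf_sum1 tfp).
have pi_gt0 := invariant_gt0 irrQ pi_ge0 pi_sum1 rev.
have q_rev i j : pi i * q i j = pi j * q j i by exact: (tf_reversible tfp rev i j d0).
pose F := em_map b sigma delta.
pose gam := noise_law bmW delta_gt0.
have mF j := measurable_em_map delta lip j.
have [c [rho [c_ge0 contraction rate rho01]]] : exists c rho,
  [/\ forall i, 0 <= c i,
     forall i x y, (\int[gam]_e (sqdist (F i x e) (F i y e))%:E <= (c i * sqdist x y)%:E)%E,
     forall i, c i * (\sum_j q i j * xi j) <= rho * xi i &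
     0 < rho < 1].
  (* In dimension [0] nothing bounds [beta] from below, but all points coincide. *)
  have [n0|n_gt0] := posnP n.
    exists (fun=> 0), 2^-1; split => //.
    - move=> i x y; rewrite mul0r (_ : (fun e => _) = cst 0%E) ?integral0//.
      apply/funext => e /=; congr EFin; rewrite /sqdist hsnorm_sqr_col big1// => l.
      by exfalso; have := leq_ltn_trans (leq0n l) (ltn_ord l); rewrite n0.
    - by move=> i; rewrite mul0r mulr_ge0 ?invr_ge0// ltW.
    - by apply/andP; split; lra.
  have beta_ge i := dissipativity_ge lip diss L_gt0 i n_gt0.
  have [rho /andP[rho0 rho1] Hrho] := em_contraction_rate consQ irrQ pi_ge0 pi_sum1 rev
    xi_min tfp L_gt0 lam_gt0 xi_gt0 delta_gt0 delta_lt1 delta_small beta_ge.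
  (* A positive rate is required, since the geometric bounds divide by its powers. *)
  exists (fun i => 1 + beta i * delta + L ^+ 2 * delta ^+ 2), (Num.max 2^-1 rho); split.
  - exact: em_factor_ge0.
  - by move=> i x y; exact: (em_map_contraction lip diss L_gt0 delta_gt0 bmW).
  - move=> i; apply: le_trans (Hrho i) _; rewrite ler_wpM2r ?(ltW (xi_gt0 i))//.
    by rewrite le_max lexx orbT.
  - by rewrite lt_max gt_max rho1 invr_gt0 ltr0n/= andbT; lra.
have rho01' : 0 <= rho < 1 by case/andP: rho01 => /ltW -> ->.
have displacement i : exists M, (\int[gam]_e (sqdist (F i 0 e) 0)%:E <= M%:E)%E.
  exact: em_map_displacement.
have [mu [mu_marg mu_lim]] := backward_limit_law mF La_meas indWL fdd q_ge0 q_sum1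
  c_ge0 contraction xi_gt0 rate rho01 displacement pi_ge0 pi_sum1 q_rev.
have test_iter k h : test_function (@sqdist R n) xi h ->
    test_function (@sqdist R n) xi (iter k (transfer F gam q) h).
  exact: (test_function_iter mF q_ge0 q_sum1 (@sqdist_ge0 R n)
    (@measurable_sqdist R n) c_ge0 contraction xi_gt0 rate rho01' k).
have mu_inv k h : test_function (@sqdist R n) xi h ->
    (\int[mu]_z iter k (transfer F gam q) h z = \int[mu]_z h z)%E.
  move=> th; have tk := test_iter k _ th.
  have fin f : test_function (@sqdist R n) xi f -> (\int[mu]_z f z \is a fin_num)%E.
    by move=> [mf f01 _]; exact: bounded_integral_fin_num.
  rewrite -[LHS]fineK ?fin// -[RHS]fineK ?fin//; congr EFin.
  (* Both integrals are limits of the same sequence, up to a shift by [k]. *)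
  have lim_k := mu_lim _ tk.
  have E : (fun l => fine (averaged F gam q pi 0 (iter k (transfer F gam q) h) l))
     = (fun l => fine (averaged F gam q pi 0 h (l + k)%N)).
    by apply/funext => l; rewrite /averaged; under eq_bigr do rewrite -iterD.
  rewrite E in lim_k.
  have := mu_lim _ th; rewrite -(cvg_shiftn k) => lim_h.
  exact: (norm_cvg_unique lim_k lim_h).
have invP := em_invariant_transfer bmW delta_gt0 mF La_meas indWL fdd q_ge0.
have mu_em : em_invariant P b sigma delta W La mu.
  apply/invP => k h mh h0.
  have [nu' Hnu'] := pushforward_exists bmW delta_gt0 mF La_meas indWL fdd q_ge0 mu k.
  rewrite -Hnu'//; apply: eq_measure_integral => A mA _.
  apply: (test_functions_determine xi_gt0) => // f tf.
  by case: (tf) => mf f01 _; rewrite Hnu' ?mu_inv// => z; case/andP: (f01 z).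
exists mu; split => // nu /invP nu_inv A mA.
apply: (test_functions_determine xi_gt0) => // h th; have [mh h01 _] := th.
have h0 z : (0 <= h z)%E by case/andP: (h01 z).
have nu_marg : forall j, slice nu j setT = (pi j)%:E.
  apply: (invariant_marginal q_gt0 q_sum1 pi_gt0 pi_sum1 q_rev) => f mf f0.
  exact: (nu_inv 1%N).
rewrite -[LHS]fineK ?bounded_integral_fin_num// -[RHS]fineK ?bounded_integral_fin_num//.
congr EFin; apply: (norm_cvg_unique _ (mu_lim _ th)).
by apply: (invariant_limit mF q_ge0 q_sum1 (@sqdist_ge0 R n) (@measurable_sqdist R n)
  c_ge0 contraction xi_gt0 rate rho01') => // k; exact: nu_inv.
Qed.
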